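(* Let $V$ be a positive random variable with distribution function $G_V$, independent of the Lévy process $J(\cdot)$ described in the context, and let $W(t)=V+J(t)$, $\tau=\inf\{t\ge 0: W(t)=0\}$ and $A_f=\int_0^\tau f(W(t))\,\mathrm{d}t$. Assume that $U$ and $\zeta$ are nonnegative random variables such that: (1) $V$, $U$ and $\zeta$ are independent; (2) $U$ is uniformly distributed on $[0,1]$; (3) the Laplace–Stieltjes transform of $\zeta$ is $$\psi(\alpha)\equiv\mathbb{E}e^{-\alpha\zeta}=\frac{\alpha\,\varphi'(0+)}{\varphi(\alpha)},\qquad \alpha>0.$$ Then, for any Borel function $f:\mathbb{R}_+\to\mathbb{R}_+$, $$\mathbb{E}A_f=-\frac{1}{\varrho}\int_0^\infty x\,\mathbb{E}f(\zeta+xU)\,\mathrm{d}G_V(x).$$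
   Context: $J(\cdot)$ is a Lévy process (càdlàg, $J(0)=0$) that is the superposition of a subordinator and an independent drifted Brownian motion; its Laplace exponent is $$\varphi(\alpha)\equiv-\log\mathbb{E}e^{-\alpha J(1)}=c\alpha-\frac{\sigma^2\alpha^2}{2}-\int_{(0,\infty)}(e^{-\alpha y}-1)\,\nu(\mathrm{d}y),\qquad \alpha\ge0,$$ where $c\in\mathbb{R}$, $\sigma\ge0$ and $\nu$ is a Borel measure on $(0,\infty)$ with $\int_{(0,\infty)}(1\wedge y)\,\nu(\mathrm{d}y)<\infty$. Standing assumption: $\varrho\equiv\mathbb{E}J(1)=\varphi'(0+)=c+\int_{(0,\infty)}y\,\nu(\mathrm{d}y)$ is finite and negative. $\mathbb{R}_+=[0,\infty)$. *)

(* Defs.v *)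
From mathcomp Require Import all_boot all_order all_algebra.
From mathcomp Require Import all_classical all_reals all_analysis.

Set Implicit Arguments.
Unset Strict Implicit.
Unset Printing Implicit Defensive.

Import Order.TTheory GRing.Theory Num.Theory.
Import numFieldNormedType.Exports.

Local Open Scope classical_set_scope.
Local Open Scope ring_scope.

Section independence.
Context (R : realType) (d : measure_display) (T : measurableType d)
  (P : probability T R).

(* The product rule for proper subfamilies is the case where some of the
   [A i] are [setT]. *)
Definition independent_RVs (I : finType) (X : I -> T -> R) : Prop :=
  forall A : I -> set R, (forall i, measurable (A i)) ->
    P (\bigcap_(i in [set: I]) (X i @^-1` A i)) =
    (\prod_(i : I) P (X i @^-1` A i))%E.

Definition independent_systems (F G : set_system T) : Prop :=
  forall A B : set T, F A -> G B -> P (A `&` B) = (P A * P B)%E.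

Definition sigma_RV (X : T -> R) : set_system T :=
  preimage_set_system setT X measurable.

Definition sigma_process (X : R -> T -> R) : set_system T :=
  <<s \bigcup_(t in `[0, +oo[) sigma_RV (X t) >>.

End independence.

(* A process is a family of random variables indexed by the whole of [R], of
   which only the part with nonnegative index is ever constrained or used. *)
Section processes.
Context (R : realType) (d : measure_display) (T : measurableType d)
  (P : probability T R).

Definition independent_increments (X : R -> {RV P >-> R}) : Prop :=
  forall (n : nat) (t : nat -> R),
    0 <= t 0%N -> (forall i, t i <= t i.+1) ->
    independent_RVs P (fun (i : 'I_n) w => X (t i.+1) w - X (t i) w).

Definition stationary_increments (X : R -> {RV P >-> R}) : Prop :=
  forall s h : R, 0 <= s -> 0 <= h ->
    forall A : set R, measurable A ->
      P [set w | A (X (s + h) w - X s w)] = P [set w | A (X h w)].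

Definition cadlag (x : R -> R) : Prop :=
  (forall t, 0 <= t -> x s @[s --> t^'+] --> x t) /\
  (forall t, 0 < t -> exists l : R, x s @[s --> t^'-] --> l).

Definition levy_process (X : R -> {RV P >-> R}) : Prop :=
  [/\ forall w, X 0 w = 0,
      independent_increments X,
      stationary_increments X &
      forall w, cadlag (fun t => X t w)].

Definition subordinator (S : R -> {RV P >-> R}) : Prop :=
  levy_process S /\
  forall w (s t : R), 0 <= s -> s <= t -> S s w <= S t w.

Definition standard_brownian_motion (B : R -> {RV P >-> R}) : Prop :=
  [/\ levy_process B,
      forall t : R, 0 < t -> forall A : set R, measurable A ->
        distribution P (B t) A = normal_prob 0 (Num.sqrt t) A &
      forall w, {within `[0, +oo[, continuous (fun t : R => B t w)}].

(* When [sigma = 0] no Brownian motion is required to live on [T]. *)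
Definition drifted_brownian_motion (mu sigma : R) (X : R -> {RV P >-> R}) :
    Prop :=
  if sigma == 0 then forall t w, 0 <= t -> X t w = mu * t
  else exists2 B : R -> {RV P >-> R}, standard_brownian_motion B &
         forall t w, 0 <= t -> X t w = mu * t + sigma * B t w.

Definition laplace_transform (X : T -> R) (alpha : R) : \bar R :=
  'E_P[fun w => expR (- (alpha * X w))]%E.

Definition laplace_exponent (X : T -> R) (alpha : R) : \bar R :=
  (- lne (laplace_transform X alpha))%E.

End processes.

Definition levy_exponent (R : realType) (c sigma : R)
    (nu : {measure set R -> \bar R}) (alpha : R) : R :=
  c * alpha - sigma ^+ 2 * alpha ^+ 2 / 2
  - \int[nu]_(y in `]0, +oo[) (expR (- (alpha * y)) - 1).

Definition right_derivative_at0 (R : realType) (phi : R -> R) : R :=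
  lim (h^-1 * (phi h - phi 0) @[h --> 0^'+]).

(* Only the restriction of [nu] to the positive half-line is relevant.  The
   drift [mu] of the Brownian component and the drift of the subordinator add
   up to [c], so [mu] is not determined by [c]. *)
Definition levy_input (R : realType) (d : measure_display)
    (T : measurableType d) (P : probability T R) (c sigma : R)
    (nu : {measure set R -> \bar R}) (J : R -> {RV P >-> R}) : Prop :=
  [/\ 0 <= sigma,
      (\int[nu]_(y in `]0%R, +oo[) (Num.min 1 y)%:E < +oo)%E,
      levy_process J,
      exists (S X : R -> {RV P >-> R}) (mu : R),
        [/\ subordinator S,
            drifted_brownian_motion mu sigma X,
            independent_systems P (sigma_process S) (sigma_process X) &
            forall t w, 0 <= t -> J t w = S t w + X t w] &
      forall alpha : R, 0 <= alpha ->
        laplace_exponent P (J 1) alpha = (levy_exponent c sigma nu alpha)%:E].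

Section hitting.
Context (R : realType) (T : Type).

(* [+oo] on the paths that never vanish. *)
Definition hitting_time0 (W : R -> T -> R) (w : T) : \bar R :=
  ereal_inf [set t%:E | t in [set t : R | 0 <= t /\ W t w = 0]].

Definition integral_to_hitting (f : R -> R) (W : R -> T -> R) (w : T) :
    \bar R :=
  (\int[lebesgue_measure]_(t in
      [set t : R | (0 <= t)%R /\ t%:E < hitting_time0 W w])
    (f (W t w))%:E)%E.

End hitting.

(* Main.v *)
From HB Require Import structures.
Require Import Defs.
From mathcomp Require Import all_boot all_order all_algebra.
From mathcomp Require Import all_classical all_reals all_analysis.
From mathcomp Require Import measurable_realfun ring lra.

(** For [c > 0] put [p = - phi c], which is positive because [J] has negative
    mean.  The process [expR (- c W(t) - p t)] is a martingale, and [W], having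
    no negative jumps, is at 0 when it stops being positive.  Optional stopping
    of [expR (- c W(t)) - p int_0^t expR (- c W(s)) ds] at the hitting time
    [tau] therefore gives
<<
      E expR (- c V) + p E int_0^tau expR (- c W(t)) dt = 1.
>>
    On the other side [c x E expR (- c x U) = 1 - expR (- c x)] because [U] is
    uniform, and [E expR (- c zeta) = c rho / phi c], so that
<<
      E expR (- c V) - (p / rho) int x E expR (- c (zeta + x U)) dG_V(x) = 1.
>>
    Hence the occupation measure of [W] before [tau] and the measure that
    integrates [f] to the right-hand side of the theorem have the same finite
    Laplace transform on the positive half-line.  They are equal
    ([laplace_unique], [eq_integral_laplace]), which is the theorem for every
    nonnegative [f].

    The stopping argument is carried out on dyadic grids.  There it is a
    telescoping sum ([discrete_martingale]) of one-step identities, each an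
    instance of the independence of the past and the next increment
    ([integral_survive_grid]).  As the grid is refined, the value of the
    surplus at its first negative grid time tends to 0, since only the
    continuous component can bring the surplus down ([cvg_exit_value]); the
    same telescoping sum for the exponent [2 c] bounds the second moments of
    the exponentials at that time, which allows the passage to the limit
    ([cvg_integral_L2], [sojourn_identity]).  Letting the exponent tend to 0
    shows that the exit is almost sure ([exit_almost_surely]).

    The hitting time [tau] is an infimum over uncountably many times, and the
    set of pairs [(w, t)] with [t < tau w] is not obviously measurable.  It
    lies, up to a null set of [w], between two measurable sets described by
    the surplus at dyadic times: survival up to [t] from the initial value
    [V], and survival up to [t] from [V - eps] for some [eps > 0]
    ([lt_hitting_survive], [survive_lt_hitting]).  The identity above holds
    for both sets ([upper_occupation_laplace], [lower_occupation_laplace]), so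
    the integrals over them agree and determine the one in between
    ([integral_squeeze_ae]). *)

Import Order.TTheory GRing.Theory Num.Theory.
Import numFieldNormedType.Exports.

Local Open Scope classical_set_scope.
Local Open Scope ring_scope.

Set Implicit Arguments.
Unset Strict Implicit.
Unset Printing Implicit Defensive.

(** * Integrals and limits *)

Lemma fin_num_addeI (R : realType) (z : \bar R) :
  z \is a fin_num -> injective (fun x => x + z)%E.
Proof. by move=> fz x y /= /(congr1 (fun t => t - z)%E); rewrite !addeK. Qed.

Lemma adde_pmule_inj (R : realType) (p : R) (a x y : \bar R) : 0 < p ->
  (0 <= a)%E -> (0 <= x)%E -> (0 <= y)%E ->
  (a + p%:E * x = 1)%E -> (a + p%:E * y = 1)%E -> (x < +oo)%E /\ x = y.
Proof.
move=> p0; case: a => [a||]// _; last by case: x => [x||]//; rewrite ?gt0_muley.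
case: x => [x||]// _; last by rewrite gt0_muley.
case: y => [y||]// _; last by rewrite gt0_muley.
move=> [<-] [] /addrI/(mulfI (lt0r_neq0 p0)) ->; by rewrite ltry.
Qed.

Lemma cvge_eq_lim (R : realType) (u v : nat -> \bar R) (a b : \bar R) :
  u =1 v -> u n @[n --> \oo] --> a -> v n @[n --> \oo] --> b -> a = b.
Proof. by move=> /funext -> ua ub; exact: (cvg_unique _ ua ub). Qed.

Lemma cvg_expR (R : realType) (I : Type) (F : set_system I) (FF : Filter F)
    (f : I -> R) (a : R) :
  f x @[x --> F] --> a -> expR (f x) @[x --> F] --> expR a.
Proof. by move=> fa; apply: continuous_cvg => //; exact: continuous_expR. Qed.

Lemma measurable_expRN d (T : measurableType d) (R : realType) (a : R)
    (D : set T) (X : T -> R) : measurable_fun D X ->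
  measurable_fun D (fun w => expR (- (a * X w))).
Proof.
move=> mX; apply: measurableT_comp; first exact: measurable_expR.
apply: measurableT_comp => //.
by apply: (measurableT_comp (f := fun x => a * x)) => //; exact: mulrl_measurable.
Qed.

Lemma measurable_EFin_expRN d (T : measurableType d) (R : realType) (a : R)
    (D : set T) (X : T -> R) : measurable_fun D X ->
  measurable_fun D (fun w => (expR (- (a * X w)))%:E).
Proof. by move=> mX; apply/measurable_EFinP; exact: measurable_expRN. Qed.

Lemma ge0_le_integral_EFin d (T : measurableType d) (R : realType)
    (mu : {measure set T -> \bar R}) (D : set T) (f g : T -> R) :
  measurable D -> measurable_fun D f -> measurable_fun D g ->
  (forall x, D x -> 0 <= f x) -> (forall x, D x -> f x <= g x) ->
  (\int[mu]_(x in D) (f x)%:E <= \int[mu]_(x in D) (g x)%:E)%E.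
Proof.
move=> mD mf mg f0 fg; by apply: ge0_le_integral => //;
  do ?[exact/measurable_EFinP | by move=> x Dx; rewrite lee_fin ?f0 ?fg].
Qed.

Lemma ge0_integralD_EFin d (T : measurableType d) (R : realType)
    (mu : {measure set T -> \bar R}) (D : set T) (f g : T -> R) :
  measurable D -> measurable_fun D f -> measurable_fun D g ->
  (forall x, D x -> 0 <= f x) -> (forall x, D x -> 0 <= g x) ->
  (\int[mu]_(x in D) (f x + g x)%:E =
   \int[mu]_(x in D) (f x)%:E + \int[mu]_(x in D) (g x)%:E)%E.
Proof.
move=> mD mf mg f0 g0; by rewrite -ge0_integralD//;
  do ?[exact/measurable_EFinP | by move=> x Dx; rewrite lee_fin ?f0 ?g0].
Qed.

Lemma ge0_integralZl_EFin_EFin d (T : measurableType d) (R : realType)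
    (mu : {measure set T -> \bar R}) (D : set T) (k : R) (f : T -> R) :
  measurable D -> measurable_fun D f ->
  (forall x, D x -> 0 <= f x) -> 0 <= k ->
  (\int[mu]_(x in D) (k * f x)%:E = k%:E * \int[mu]_(x in D) (f x)%:E)%E.
Proof.
move=> mD mf f0 k0; by rewrite -ge0_integralZl//;
  do ?[exact/measurable_EFinP | by move=> x Dx; rewrite lee_fin f0].
Qed.

Lemma gt0_integral d (T : measurableType d) (R : realType) (P : probability T R)
    (f : T -> \bar R) :
  measurable_fun setT f -> (forall x, 0 < f x)%E -> (0 < \int[P]_x f x)%E.
Proof.
move=> mf f0; rewrite lt_neqAle integral_ge0 ?andbT; last by move=> x _; exact: ltW.
apply/eqP => If0.
have : ae_eq P setT f (cst 0%E).
  apply/ae_eq_integral_abs => //; rewrite If0; apply: eq_integral => x _.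
  by rewrite gee0_abs// ltW.
move=> [N [mN PN0 HN]].
have NT : N = setT.
  apply/seteqP; split => // x _; apply: HN => /= /(_ I) fx0.
  by have := f0 x; rewrite fx0 ltxx.
have : 1%E = 0%E :> \bar R by rewrite -(probability_setT P) -NT; exact: PN0.
by move/eqP; rewrite onee_eq0.
Qed.

Lemma cvg_integral_nondecreasing d (T : measurableType d) (R : realType)
    (mu : {measure set T -> \bar R}) (D : set T) (f_ : nat -> T -> \bar R)
    (f : T -> \bar R) : measurable D ->
  (forall n, measurable_fun D (f_ n)) ->
  (forall n x, D x -> 0 <= f_ n x)%E ->
  (forall x, D x -> nondecreasing_seq (f_ ^~ x)) ->
  (forall x, D x -> f_ n x @[n --> \oo] --> f x) ->
  (\int[mu]_(x in D) f_ n x)%E @[n --> \oo] --> (\int[mu]_(x in D) f x)%E.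
Proof.
move=> mD mf f0 ndf ff.
rewrite (eq_integral (fun x => limn (f_ ^~ x))); last first.
  by move=> x; rewrite inE => Dx; apply/esym/cvg_lim => //; exact: ff.
exact: cvg_monotone_convergence.
Qed.

Lemma cvg_integral_decreasing d (T : measurableType d) (R : realType)
    (mu : {measure set T -> \bar R}) (B : nat -> set T) (f : T -> R) :
  (forall m, measurable (B m)) -> (forall m, B m.+1 `<=` B m) ->
  measurable_fun setT f -> (forall w, 0 <= f w) ->
  (\int[mu]_(w in B 0%N) (f w)%:E < +oo)%E ->
  (\int[mu]_(w in B m) (f w)%:E)%E @[m --> \oo] -->
  (\int[mu]_(w in \bigcap_m B m) (f w)%:E)%E.
Proof.
move=> mB Bd mf f0 fin.
have B0 m : B m `<=` B 0%N by elim: m => // m IH; exact: subset_trans (Bd m) IH.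
have Bnd i m : (i <= m)%N -> B m `<=` B i.
  elim: m => [|m IH]; first by rewrite leqn0 => /eqP ->.
  rewrite leq_eqVlt => /predU1P[->//|im].
  by apply: subset_trans (Bd m) _; exact: IH.
have E (C : set T) : (\int[mu]_(w in C) (f w)%:E = \int[mu]_w (f w * \1_C w)%:E)%E.
  rewrite integral_mkcond; apply: eq_integral => w _.
  by rewrite patchE indicE; case: ifP => _; rewrite ?mulr1 ?mulr0.
have mfC (C : set T) : measurable C -> measurable_fun setT (fun w => (f w * \1_C w)%:E).
  by move=> mC; apply/measurable_EFinP/measurable_funM.
have mcap : measurable (\bigcap_m B m) by exact: bigcapT_measurable.
have [] := @dominated_convergence _ _ _ mu setT measurableT
  (fun m w => (f w * \1_(B m) w)%:E) (fun w => (f w * \1_(\bigcap_m B m) w)%:E)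
  (fun w => (f w * \1_(B 0%N) w)%:E) => //.
- by move=> m; exact: mfC.
- exact: mfC.
- apply: aeW => w _; apply: cvg_EFin; first exact: nearW.
  have [Bw|nBw] := pselect ((\bigcap_m B m) w).
    rewrite (_ : _ \o _ = fun=> f w * \1_(\bigcap_m B m) w); first exact: cvg_cst.
    by apply/funext => m /=; rewrite !indicE !mem_set//; exact: Bw.
  have [m0 nB] : exists m0, ~ B m0 w.
    by apply: contrapT => h; apply: nBw => m _; apply: contrapT => nB; apply: h; exists m.
  apply: cvg_near_cst; near=> m => /=.
  rewrite !indicE !memNset// => Bm; apply: nB; apply: Bnd Bm.
  by near: m; exists m0.
- apply/integrableP; split; first exact: mfC.
  under eq_integral => w _.
    rewrite gee0_abs; last by rewrite lee_fin mulr_ge0.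
    over.
  by rewrite -E.
- apply: aeW => w m _; rewrite gee0_abs ?lee_fin ?mulr_ge0//.
  rewrite ler_wpM2l// !indicE; have [Bw|nBw] := pselect (B m w).
    by rewrite !mem_set//; exact: B0 Bw.
  by rewrite (memNset nBw).
move=> _ _; rewrite E.
by under eq_fun do rewrite -E.
Unshelve. all: by end_near. Qed.

Lemma fatou_cvg d (T : measurableType d) (R : realType)
    (mu : {measure set T -> \bar R}) (f_ : nat -> T -> \bar R)
    (f : T -> \bar R) (u : nat -> \bar R) (l : \bar R) :
  (forall n, measurable_fun setT (f_ n)) -> (forall n x, 0 <= f_ n x)%E ->
  (forall x, f_ n x @[n --> \oo] --> f x) ->
  (forall n, \int[mu]_x f_ n x <= u n)%E -> u n @[n --> \oo] --> l ->
  (\int[mu]_x f x <= l)%E.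
Proof.
move=> mf f0 ff fu ul.
have h := @fatou _ _ _ mu setT measurableT f_ mf (fun n x _ => f0 n x).
rewrite (eq_integral (fun x => limn_einf (f_ ^~ x))); last first.
  by move=> x _; rewrite (cvg_limn_einf_sup (ff x)).
apply: (le_trans h).
rewrite -(cvg_limn_einf_sup ul).1.
rewrite !limn_einf_lim; apply: lee_lim; [exact/is_cvg_einfs|exact/is_cvg_einfs|].
apply: nearW => n; apply: le_ereal_inf_tmp => _ [m /= nm <-].
by apply: ge_ereal_inf; exists (\int[mu]_x f_ m x)%E; [exists m|exact: fu].
Qed.

(** The second moments give uniform integrability: truncating at [K] changes
    the expectations by at most [C / K], whatever [m], and the truncated
    variables converge in mean by domination. *)
Lemma cvg_integral_L2 d (T : measurableType d) (R : realType)
    (P : probability T R) (G_ : nat -> T -> R) (G : T -> R) (C : R) :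
  (forall m, measurable_fun setT (G_ m)) -> measurable_fun setT G ->
  (forall m w, 0 <= G_ m w) -> (forall w, 0 <= G w <= 1) ->
  (forall w, G_ m w @[m --> \oo] --> G w) ->
  (forall m, \int[P]_w (G_ m w ^+ 2)%:E <= C%:E)%E ->
  (\int[P]_w (G_ m w)%:E)%E @[m --> \oo] --> (\int[P]_w (G w)%:E)%E.
Proof.
move=> mG_ mG G_0 G01 GG GC.
have C0 : 0 <= C.
  rewrite -lee_fin; apply: le_trans (GC 0%N).
  by apply: integral_ge0 => w _; rewrite lee_fin exprn_ge0.
pose M K m w := Num.min (G_ m w) K.
have mM K m : measurable_fun setT (M K m).
  by apply: measurable_minr => //; exact: measurable_cst.
have IM K : 2 <= K ->
    (\int[P]_w (M K m w)%:E)%E @[m --> \oo] --> (\int[P]_w (G w)%:E)%E.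
  move=> K1.
  have [] := @dominated_convergence _ _ _ P setT measurableT
    (fun m w => (M K m w)%:E) (fun w => (G w)%:E) (fun=> K%:E) => //.
  - by move=> m; exact/measurable_EFinP.
  - exact/measurable_EFinP.
  - apply: aeW => w _; apply: cvg_EFin; first exact: nearW.
    apply: cvg_trans (GG w); apply: near_eq_cvg => /=.
    have h := @cvgr_lt _ _ _ _ (G_ ^~ w) (G w) (GG w) 2.
    near=> m; rewrite /M /=; apply/esym/min_idPl/ltW/(lt_le_trans _ K1).
    by near: m; apply: h; have /andP[_ /le_lt_trans] := G01 w; apply; rewrite ltr1n.
  - exact: finite_measure_integrable_cst.
  - apply: aeW => w m _; rewrite lee_fin ger0_norm ?ge_min ?lexx ?orbT//.
    by rewrite le_min G_0 (le_trans _ K1).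
have M0 K m w : 0 <= K -> 0 <= M K m w by move=> K0; rewrite le_min G_0.
have leM K m : 0 < K ->
    (\int[P]_w (M K m w)%:E <= \int[P]_w (G_ m w)%:E <=
     \int[P]_w (M K m w)%:E + (C / K)%:E)%E.
  move=> K0; apply/andP; split.
    apply: ge0_le_integral_EFin => // w _; first by rewrite M0// ltW.
    by rewrite ge_min lexx.
  have mG2 : measurable_fun setT (fun w => K^-1 * G_ m w ^+ 2).
    by apply: measurable_funM => //; exact: measurable_funX.
  apply: (@le_trans _ _ (\int[P]_w (M K m w + K^-1 * G_ m w ^+ 2)%:E)%E).
    apply: ge0_le_integral_EFin => //; first exact: measurable_funD.
    move=> w _; rewrite /M.
    case: (leP (G_ m w) K) => [_|KG].
      by rewrite lerDl mulr_ge0 ?exprn_ge0// invr_ge0 ltW.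
    rewrite -[leLHS]add0r lerD// ?(ltW K0)// expr2 mulrA.
    by rewrite ler_peMl// mulrC ler_pdivlMr// mul1r ltW.
  rewrite ge0_integralD_EFin//; last 2 first.
  - by move=> w _; rewrite M0// ltW.
  - by move=> w _; rewrite mulr_ge0 ?exprn_ge0// invr_ge0 ltW.
  rewrite leeD2l// ge0_integralZl_EFin_EFin//; last 3 first.
  - exact: measurable_funX.
  - by move=> w _; rewrite exprn_ge0.
  - by rewrite invr_ge0 ltW.
  by rewrite [C / K]mulrC EFinM lee_wpmul2l// lee_fin invr_ge0 ltW.
have fin1 (h : T -> R) (K : R) : measurable_fun setT h ->
    (forall w, 0 <= h w <= K) -> (\int[P]_w (h w)%:E)%E \is a fin_num.
  move=> mh h01; rewrite ge0_fin_numE; last first.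
    by apply: integral_ge0 => w _; rewrite lee_fin; have /andP[] := h01 w.
  apply: (@le_lt_trans _ _ (\int[P]_w K%:E)%E); last first.
    by rewrite integral_cst//= probability_setT mule1 ltry.
  by apply: ge0_le_integral_EFin => // w _; have /andP[] := h01 w.
have finM K m : 0 < K -> (\int[P]_w (M K m w)%:E)%E \is a fin_num.
  move=> K0; apply: (fin1 _ K) => // w; apply/andP.
  by split; [exact/M0/ltW|rewrite ge_min lexx orbT].
have finG : (\int[P]_w (G w)%:E)%E \is a fin_num by exact: (fin1 _ 1).
have finG_ m : (\int[P]_w (G_ m w)%:E)%E \is a fin_num.
  have /andP[_ h] := leM 1 m ltr01; rewrite ge0_fin_numE; last first.
    by apply: integral_ge0 => w _; rewrite lee_fin.
  apply: le_lt_trans h _; rewrite lte_add_pinfty ?ltry//.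
  by rewrite -ge0_fin_numE ?finM// integral_ge0// => w _; rewrite lee_fin M0.
rewrite -(fineK finG); apply: cvg_EFin; first exact: nearW.
apply/cvgrPdist_le => e e0.
(* K bounds the values of G strictly, and C / K is at most e / 2. *)
pose K := 2 + 2 * C / e.
have K1 : 2 <= K by rewrite lerDl divr_ge0 ?mulr_ge0// ltW.
have K0 : 0 < K by apply: lt_le_trans K1.
have CK : C / K <= e / 2.
  rewrite ler_pdivrMr// (_ : e / 2 * K = e + C); first by rewrite lerDr ltW.
  by rewrite /K; field; rewrite gt_eqF.
have := IM K K1; rewrite -(fineK finG) => /fine_cvgP[_].
have e2 : 0 < e / 2 by rewrite divr_gt0.
move=> /cvgrPdist_le/(_ (e / 2) e2); apply: filterS => m /=.
have /andP[] := leM K m K0.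
rewrite -(fineK (finM K m K0)) -(fineK (finG_ m)) -EFinD !lee_fin.
set x := fine _; set y := fine _; set z := fine _ => xy yx.
rewrite !ler_norml => /andP[h1 h2]; move: CK xy yx h1 h2 => /=.
set c := C / K => CK xy yx h1 h2; apply/andP; split; lra.
Unshelve. all: by end_near. Qed.

(** The integral of a nonnegative function is a supremum over the simple
    functions below it, hence monotone without any measurability. *)
Lemma ge0_le_integral_any d (T : measurableType d) (R : realType)
    (mu : {measure set T -> \bar R}) (f g : T -> \bar R) :
  (forall x, 0 <= f x)%E -> (forall x, f x <= g x)%E ->
  (\int[mu]_x f x <= \int[mu]_x g x)%E.
Proof.
move=> f0 fg; have g0 x : (0 <= g x)%E by exact: le_trans (f0 x) (fg x).
rewrite !ge0_integralTE//; apply: ereal_sup_le => _ [h hf <-]; exists h => //.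
by move=> x; apply: le_trans (hf x) (fg x).
Qed.

(** The integrand [F] may fail to be measurable.  Replacing the lower bound by 0 and
    the upper bound by [+oo] on [N] changes neither integral, and then
    monotonicity applies everywhere. *)
Lemma integral_squeeze_ae d (T : measurableType d) (R : realType)
    (mu : {measure set T -> \bar R}) (N : set T) (lo up F : T -> \bar R) :
  measurable N -> mu N = 0%E ->
  measurable_fun setT lo -> measurable_fun setT up ->
  (forall x, 0 <= lo x)%E -> (forall x, 0 <= up x)%E ->
  (forall x, ~ N x -> lo x <= F x <= up x)%E ->
  (\int[mu]_x lo x = \int[mu]_x up x)%E ->
  (\int[mu]_x F x = \int[mu]_x up x)%E.
Proof.
move=> mN N0 mlo mup lo0 up0 squeeze eq_lo_up.
have off_N x : (x \in N) = false -> (lo x <= F x <= up x)%E.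
  by move=> xN; apply: squeeze => Nx; rewrite mem_set in xN.
pose U x := maxe (up x) ((cst +oo%E \_ N) x).
pose L x := (lo \_ (~` N)) x.
have mU : measurable_fun setT U.
  by apply: measurable_maxe => //; apply/(measurable_restrictT _ _).1.
have mL : measurable_fun setT L.
  apply/(measurable_restrictT _ _).1; first exact: measurableC.
  exact: measurable_funTS.
have U0 x : (0 <= U x)%E by rewrite le_max up0.
have L0 x : (0 <= L x)%E by rewrite /L patchE; case: ifP.
have ULN x : (x \in N) = false -> L x = lo x /\ U x = up x.
  by move=> xN; rewrite /U /L !patchE in_setC xN; split => //; apply/max_idPl.
have IU : (\int[mu]_x U x = \int[mu]_x up x)%E.
  apply: ge0_ae_eq_integral => //; exists N; split => // x /=.
  by apply: contra_notP => nN _; have xN := memNset nN; have [_ ->] := ULN x xN.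
have IL : (\int[mu]_x L x = \int[mu]_x lo x)%E.
  apply: ge0_ae_eq_integral => //; exists N; split => // x /=.
  by apply: contra_notP => nN _; have xN := memNset nN; have [-> _] := ULN x xN.
have Fpos x : (x \in N) = false -> (F^\+ x = F x)%E.
  move=> /off_N/andP[loF _]; rewrite funeposE; apply/max_idPl.
  exact: le_trans (lo0 x) loF.
have IFneg : (\int[mu]_x F^\- x = 0)%E.
  apply/eqP; rewrite eq_le; apply/andP; split; last exact: integral_ge0.
  pose Z x : \bar R := ((cst +oo%E \_ N) x).
  have mZ : measurable_fun setT Z by apply/(measurable_restrictT _ _).1.
  have Z0 x : (0 <= Z x)%E by rewrite /Z patchE; case: ifP => _ /=; rewrite ?leey.
  have IZ : (\int[mu]_x Z x = 0)%E.
    rewrite -[RHS](integral0 mu setT).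
    apply: ge0_ae_eq_integral => //; exists N; split => // x /=.
    by apply: contra_notP => nN _; have xN := memNset nN; rewrite /Z patchE xN.
  rewrite -IZ; apply: ge0_le_integral_any => // x.
  rewrite /Z patchE; case: ifPn => [_|/negbTE xN]; first by rewrite leey.
  have /andP[loF _] := off_N x xN.
  by rewrite funenegE ge_max lexx andbT oppe_le0 (le_trans (lo0 x)).
rewrite integralE IFneg sube0; apply/eqP; rewrite eq_le; apply/andP; split.
  rewrite -IU; apply: ge0_le_integral_any => // x.
  case: (boolP (x \in N)) => [xN|/negbTE xN].
    by rewrite /U patchE xN /= le_max leey orbT.
  rewrite Fpos// (ULN x xN).2.
  by have /andP[_ ?] := off_N x xN.
rewrite -eq_lo_up -IL; apply: ge0_le_integral_any => // x.
case: (boolP (x \in N)) => [xN|/negbTE xN].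
  by rewrite /L patchE in_setC xN /= funepos_ge0.
rewrite Fpos// (ULN x xN).1.
by have /andP[] := off_N x xN.
Qed.

Section independence_integral.
Context {R : realType} d (T : measurableType d) (P : probability T R).

(** The joint law of independent variables is the product of their laws, so
    this is an instance of Tonelli's theorem. *)
Lemma integral_indepM (X Y : T -> R) (f g : R -> \bar R) :
  measurable_fun setT X -> measurable_fun setT Y ->
  (forall A B : set R, measurable A -> measurable B ->
    P (X @^-1` A `&` Y @^-1` B) = P (X @^-1` A) * P (Y @^-1` B))%E ->
  measurable_fun setT f -> measurable_fun setT g ->
  (forall x, 0 <= f x)%E -> (forall x, 0 <= g x)%E ->
  (\int[P]_w (f (X w) * g (Y w)) = \int[P]_w f (X w) * \int[P]_w g (Y w))%E.
Proof.
move=> mX mY XY mf mg f0 g0.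
pose X' : {RV P >-> R} := HB.pack X (isMeasurableFun.Build _ _ _ _ X mX).
pose Y' : {RV P >-> R} := HB.pack Y (isMeasurableFun.Build _ _ _ _ Y mY).
have mZ : measurable_fun setT (fun w => (X w, Y w)) by exact: measurable_fun_pair.
pose Z : {mfun T >-> (R * R)%type} :=
  HB.pack (fun w => (X w, Y w)) (isMeasurableFun.Build _ _ _ _ _ mZ).
pose F (z : R * R) := (f z.1 * g z.2)%E.
have mF : measurable_fun setT F.
  by apply: emeasurable_funM; apply: measurableT_comp.
have F0 z : (0 <= F z)%E by exact: mule_ge0.
transitivity (\int[distribution P Z]_z F z)%E.
  by rewrite ge0_integral_distribution.
transitivity (\int[distribution P X' \x distribution P Y']_z F z)%E.
  apply: eq_measure_integral => A mA _; apply/esym.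
  by apply: product_measure_unique => // B C mB mC; rewrite XY.
rewrite fubini_tonelli1//=.
rewrite /fubini_F/= /F/=.
under eq_integral => x _ do rewrite ge0_integralZl//.
rewrite ge0_integralZr//; last first.
  by apply: integral_ge0.
by rewrite !ge0_integral_distribution.
Qed.

End independence_integral.

Section product_sections.
Context {R : realType} d (T : measurableType d) (P : probability T R).
Local Notation mu := (@lebesgue_measure R).
Context (E : set (T * measurableTypeR R)) (g : T * measurableTypeR R -> R).
Hypotheses (mE : measurable E) (mg : measurable_fun setT g).
Hypothesis g0 : forall z, 0 <= g z.
Hypothesis E_ge0 : forall z, E z -> 0 <= z.2.

Let F z := (g z * \1_E z)%:E.

Let mF : measurable_fun setT F.
Proof.
by apply/measurable_EFinP; apply: measurable_funM => //; exact: measurable_indic.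
Qed.

Let F0 z : (0 <= F z)%E. Proof. by rewrite lee_fin mulr_ge0. Qed.

Let integralE : (\int[P \x mu]_(z in E) (g z)%:E = \int[P \x mu]_z F z)%E.
Proof.
rewrite integral_mkcond; apply: eq_integral => z _.
by rewrite patchE /F indicE; case: ifP => _; rewrite ?mulr1 ?mulr0.
Qed.

Lemma integral_prod_xsection : (\int[P \x mu]_(z in E) (g z)%:E =
  \int[P]_w \int[mu]_(s in [set s | E (w, s)]) (g (w, s))%:E)%E.
Proof.
rewrite integralE (fubini_tonelli1 F mF F0); apply: eq_integral => w _.
rewrite /fubini_F [RHS]integral_mkcond; apply: eq_integral => s _.
rewrite patchE /F indicE; have [Ew|nEw] := pselect (E (w, s)).
  by rewrite !mem_set//= mulr1.
by rewrite !memNset//= mulr0.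
Qed.

Lemma measurable_integral_xsection : measurable_fun setT
  (fun w => \int[mu]_(s in [set s | E (w, s)]) (g (w, s))%:E)%E.
Proof.
rewrite (_ : (fun w => _) = fubini_F mu F).
  exact: measurable_fun_fubini_tonelli_F.
apply/funext => w; rewrite /fubini_F [LHS]integral_mkcond; apply: eq_integral => s _.
rewrite patchE /F indicE; have [Ew|nEw] := pselect (E (w, s)).
  by rewrite !mem_set//= mulr1.
by rewrite !memNset//= mulr0.
Qed.

Lemma integral_prod_ysection : (\int[P \x mu]_(z in E) (g z)%:E =
  \int[mu]_(s in `[0%R, +oo[) \int[P]_(w in [set w | E (w, s)]) (g (w, s))%:E)%E.
Proof.
rewrite integralE (fubini_tonelli2 F mF F0) [RHS]integral_mkcond; apply: eq_integral => s _.
rewrite /fubini_G patchE; case: ifPn => [|/negP s0].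
  rewrite inE/= => s0; rewrite [RHS]integral_mkcond; apply: eq_integral => w _.
  rewrite patchE /F indicE; have [Ew|nEw] := pselect (E (w, s)).
    by rewrite !mem_set//= mulr1.
  by rewrite !memNset//= mulr0.
apply: integral0_eq => w _; rewrite /F indicE memNset ?mulr0// => /E_ge0 /= s1.
by apply: s0; rewrite inE/= in_itv/= s1.
Qed.

End product_sections.

(** * Measures on the half-line are determined by their Laplace transforms *)

Section laplace_uniqueness.
Context {R : realType}.
Implicit Types (m : {measure set (measurableTypeR R) -> \bar R}) (b c x : R).

Let H := [set x : R | 0 <= x].

Let mH : measurable H.
Proof.
rewrite (_ : H = `[0, +oo[%classic); first exact: measurable_itv.
by apply/seteqP; split => x; rewrite /H /= in_itv /= andbT.
Qed.

(** Expanding the power shows that the integral of this weight is a linear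
    combination of the values of the Laplace transform at [c], [c + n], ...,
    [c + k n].  For suitable [k], the weights approximate the indicator of a
    ray, up to the factor [expR (- (c * x))] that keeps them integrable. *)
Definition laplace_weight (n k : nat) c x : R :=
  expR (- (c * x)) * (1 - expR (- (n%:R * x))) ^+ k.

Lemma laplace_weight_ge0 n k c x : 0 <= x -> 0 <= laplace_weight n k c x.
Proof.
move=> x0; rewrite mulr_ge0 ?expR_ge0// exprn_ge0// subr_ge0 expR_le1.
by rewrite oppr_le0 mulr_ge0.
Qed.

Lemma laplace_weight_le n k c x : 0 <= x ->
  laplace_weight n k c x <= expR (- (c * x)).
Proof.
move=> x0; rewrite ler_piMr ?expR_ge0// exprn_ile1//.
  by rewrite subr_ge0 expR_le1 oppr_le0 mulr_ge0.
Qed.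

(** Induction on [k] along this recursion takes the place of the binomial
    expansion and of its signs. *)
Lemma laplace_weightS n k c x :
  laplace_weight n k.+1 c x + laplace_weight n k (c + n%:R) x =
  laplace_weight n k c x.
Proof.
rewrite /laplace_weight exprS [X in _ + expR X * _](_ : _ =
  - (c * x) + - (n%:R * x)); last by rewrite mulrDl opprD.
by rewrite expRD; ring.
Qed.

Lemma measurable_laplace_weight n k c (D : set R) :
  measurable_fun D (laplace_weight n k c).
Proof.
apply: measurable_funTS; apply: measurable_funM.
  apply: measurableT_comp; first exact: measurable_expR.
  by apply: measurableT_comp => //; exact: mulrl_measurable.
apply: measurable_funX; apply: measurable_funB => //.
apply: measurableT_comp; first exact: measurable_expR.
by apply: measurableT_comp => //; exact: mulrl_measurable.
Qed.

(** For [k] close to [n * expR (n * b)], the factor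
    [(1 - expR (- n x)) ^+ k] is close to [expR (- n * expR (n * (b - x)))],
    which tends to 1 or to 0 according to whether [x > b] or [x <= b]. *)
Lemma cvg_laplace_weight c b x : 0 <= x -> 0 <= b ->
  laplace_weight n (Num.truncn (n%:R * expR (n%:R * b))) c x @[n --> \oo] -->
  expR (- (c * x)) * (b < x)%R%:R.
Proof.
move=> x0 b0; apply: cvgM; first exact: cvg_cst.
set k := fun n : nat => Num.truncn (n%:R * expR (n%:R * b)).
have kle n : (k n)%:R <= n%:R * expR (n%:R * b).
  have /truncn_itv/andP[//] : 0 <= n%:R * expR (n%:R * b) by rewrite mulr_ge0 ?expR_ge0.
have kgt n : n%:R * expR (n%:R * b) < (k n).+1%:R by apply: truncnS_gt.
case: (ltP b x) => bx /=.
- have e0 : expR (x - b) > 1 by rewrite expR_gt1 subr_gt0.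
  have bern (y : R) j : 0 <= y <= 1 -> 1 - j%:R * y <= (1 - y) ^+ j.
    move=> /andP[y0 y1]; elim: j => [|j IH]; first by rewrite expr0 mul0r subr0.
    rewrite exprS; apply: (@le_trans _ _ ((1 - y) * (1 - j%:R * y))).
      rewrite -natr1 -subr_ge0.
      rewrite [leRHS](_ : _ = j%:R * y * y); first by rewrite !mulr_ge0.
      by ring.
    by rewrite ler_wpM2l// subr_ge0.
  apply: (@squeeze_cvgr _ _ _ _ (fun n => 1 - n%:R * expR (- (n%:R * (x - b))))
    (fun=> 1)); last 2 first.
  + rewrite -[X in _ --> X]subr0; apply: cvgB; first exact: cvg_cst.
    apply: (@squeeze_cvgr _ _ _ _ (fun=> 0) (fun n => (2 / (x - b) ^+ 2) * n%:R^-1)).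
    * near=> n; rewrite mulr_ge0 ?expR_ge0//=.
      have n0 : 0 < n%:R :> R by rewrite ltr0n; near: n; exists 1%N.
      have xb : 0 < x - b by rewrite subr_gt0.
      have := @expR_ge1Dxn R (n%:R * (x - b)) 1.
      move=> /(_ (mulr_ge0 (ltW n0) (ltW xb))); rewrite (_ : 2`! = 2)// => h.
      rewrite expRN -ler_pdivlMl//.
      rewrite [leRHS](_ : _ = ((n%:R * (x - b)) ^+ 2 / 2)^-1); last first.
        by field; rewrite !gt_eqF.
      rewrite lef_pV2 ?posrE ?expR_gt0 ?divr_gt0 ?exprn_gt0 ?mulr_gt0//.
      by apply: le_trans h; rewrite lerDr.
    * exact: cvg_cst.
    * rewrite -[X in _ --> X](mulr0 (2 / (x - b) ^+ 2)); apply: cvgM.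
        exact: cvg_cst.
      apply: (gtr0_cvgV0 (f := fun n : nat => n%:R : R) _).2; last exact: cvgr_idn.
      by near=> n; rewrite ltr0n; near: n; exists 1%N.
  + exact: cvg_cst.
  near=> n; apply/andP; split; last first.
    rewrite exprn_ile1// ?gerBl ?expR_ge0//.
    by rewrite subr_ge0 expR_le1 oppr_le0 mulr_ge0.
  apply: le_trans (bern _ _ _); last first.
    by rewrite expR_ge0/= expR_le1 oppr_le0 mulr_ge0.
  rewrite lerD2l lerN2; apply: le_trans (ler_wpM2r _ (kle n)) _.
    exact: expR_ge0.
  rewrite -mulrA -expRD ler_wpM2l// ler_expR.
  by rewrite mulrBr opprB.
- apply: (@squeeze_cvgr _ _ _ _ (fun=> 0) (fun n => expR 1 * expR (- n%:R))).
  + near=> n.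
    have e1 : expR (- (n%:R * x)) <= 1 by rewrite expR_le1 oppr_le0 mulr_ge0.
    rewrite exprn_ge0 ?subr_ge0//=.
    apply: (@le_trans _ _ (expR (- expR (- (n%:R * x))) ^+ k n)).
      rewrite lerXn2r ?nnegrE ?expR_ge0 ?subr_ge0//.
      exact: expR_ge1Dx.
    rewrite -expRM_natl -expRD ler_expR mulrN lerNl opprD opprK addrC.
    have -> : n%:R - 1 = n%:R * (expR (n%:R * b) * expR (- (n%:R * b))) - 1 :> R.
      by rewrite expRxMexpNx_1 mulr1.
    rewrite mulrA lerBlDr.
    apply: (@le_trans _ _ ((k n).+1%:R * expR (- (n%:R * x)))).
      apply: ler_pM; rewrite ?mulr_ge0 ?expR_ge0//; first exact: ltW.
      by rewrite ler_expR lerN2 ler_wpM2l.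
    by rewrite -natr1 mulrDl mul1r lerD2l.
  + exact: cvg_cst.
  + rewrite -[X in _ --> X](mulr0 (expR 1)); apply: cvgM; first exact: cvg_cst.
    exact: cvgn_expR.
Unshelve. all: by end_near. Qed.

Context (m1 m2 : {measure set (measurableTypeR R) -> \bar R}).
Hypothesis lap_eq : forall c, 0 < c ->
  (\int[m1]_(x in H) (expR (- (c * x)))%:E =
   \int[m2]_(x in H) (expR (- (c * x)))%:E)%E.
Hypothesis lap_fin : forall c, 0 < c ->
  (\int[m1]_(x in H) (expR (- (c * x)))%:E < +oo)%E.

Let measurable_rexp c (D : set R) : measurable_fun D (fun x => expR (- (c * x))).
Proof.
exact: (measurable_expRN c (X := id)).
Qed.

Let measurable_exp c (D : set R) : measurable_fun D (fun x => (expR (- (c * x)))%:E).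
Proof. by apply/measurable_EFinP; exact: measurable_rexp. Qed.

Let int_weight_fin m n k c : (\int[m]_(x in H) (expR (- (c * x)))%:E < +oo)%E ->
  (\int[m]_(x in H) (laplace_weight n k c x)%:E)%E \is a fin_num.
Proof.
move=> fc; rewrite ge0_fin_numE; last first.
  by apply: integral_ge0 => x /= Hx; rewrite lee_fin laplace_weight_ge0.
apply: le_lt_trans fc; apply: ge0_le_integral => //.
- by move=> x /= Hx; rewrite lee_fin laplace_weight_ge0.
- by apply/measurable_EFinP; exact: measurable_laplace_weight.
- exact: measurable_exp.
- by move=> x /= Hx; rewrite lee_fin laplace_weight_le.
Qed.

Let int_weightS m n k c :
  (\int[m]_(x in H) (laplace_weight n k c x)%:E =
   \int[m]_(x in H) (laplace_weight n k.+1 c x)%:E +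
   \int[m]_(x in H) (laplace_weight n k (c + n%:R) x)%:E)%E.
Proof.
rewrite -ge0_integralD//.
- by apply: eq_integral => x _; rewrite -EFinD laplace_weightS.
- by move=> x /= Hx; rewrite lee_fin laplace_weight_ge0.
- by apply/measurable_EFinP; exact: measurable_laplace_weight.
- by move=> x /= Hx; rewrite lee_fin laplace_weight_ge0.
- by apply/measurable_EFinP; exact: measurable_laplace_weight.
Qed.

Let eq_int_weight n k c : 0 < c ->
  (\int[m1]_(x in H) (laplace_weight n k c x)%:E =
   \int[m2]_(x in H) (laplace_weight n k c x)%:E)%E.
Proof.
elim: k c => [|k IH] c c0.
  have E m : (\int[m]_(x in H) (laplace_weight n 0 c x)%:E =
              \int[m]_(x in H) (expR (- (c * x)))%:E)%E.
    by apply: eq_integral => x _; rewrite /laplace_weight expr0 mulr1.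
  by rewrite !E; exact: lap_eq.
have cn : 0 < c + n%:R by rewrite ltr_wpDr.
have := IH _ c0; rewrite (int_weightS m1 n k c) (int_weightS m2 n k c) -(IH _ cn).
by apply: fin_num_addeI; apply: int_weight_fin; exact: lap_fin.
Qed.

Let int_ray c b : 0 < c -> 0 <= b ->
  (\int[m1]_(x in H) (expR (- (c * x)) * (b < x)%R%:R)%:E =
   \int[m2]_(x in H) (expR (- (c * x)) * (b < x)%R%:R)%:E)%E.
Proof.
move=> c0 b0.
pose k n := Num.truncn (n%:R * expR (n%:R * b)).
have cv m : (\int[m]_(x in H) (expR (- (c * x)))%:E < +oo)%E ->
  (\int[m]_(x in H) (laplace_weight n (k n) c x)%:E)%E @[n --> \oo] -->
  (\int[m]_(x in H) (expR (- (c * x)) * (b < x)%R%:R)%:E)%E.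
  move=> fc.
  have [] := @dominated_convergence _ _ _ m H mH
    (fun n x => (laplace_weight n (k n) c x)%:E)
    (fun x => (expR (- (c * x)) * (b < x)%R%:R)%:E)
    (fun x => (expR (- (c * x)))%:E) => //.
  - by move=> n; apply/measurable_EFinP; exact: measurable_laplace_weight.
  - apply/measurable_EFinP; apply: measurable_funM; first exact: measurable_rexp.
    apply: measurable_funTS.
    rewrite (_ : (fun x => _) = \1_(`]b, +oo[%classic : set R)).
      by apply: measurable_indic; exact: measurable_itv.
    by apply/funext => x; rewrite indicE mem_setE in_itv/= andbT.
  - apply: aeW => x Hx; apply: cvg_EFin; first exact: nearW.
    exact: cvg_laplace_weight.
  - apply/integrableP; split; first exact: measurable_exp.
    apply: le_lt_trans fc; rewrite le_eqVlt; apply/orP; left; apply/eqP.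
    apply: eq_integral => x _.
    by rewrite gee0_abs ?lee_fin ?expR_ge0.
  - apply: aeW => x n Hx; rewrite gee0_abs ?lee_fin; last exact: laplace_weight_ge0.
    exact: laplace_weight_le.
have fin2 : (\int[m2]_(x in H) (expR (- (c * x)))%:E < +oo)%E.
  by rewrite -lap_eq// lap_fin.
apply: cvge_eq_lim (cv m1 (lap_fin c0)) (cv m2 fin2) => n.
exact: eq_int_weight.
Qed.

Let int_all_ray c b : 0 < c ->
  (\int[m1]_(x in H) (expR (- (c * x)) * (b < x)%R%:R)%:E =
   \int[m2]_(x in H) (expR (- (c * x)) * (b < x)%R%:R)%:E)%E.
Proof.
move=> c0; have [b0|b0] := leP 0 b; first exact: int_ray.
have E m : (\int[m]_(x in H) (expR (- (c * x)) * (b < x)%R%:R)%:E =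
            \int[m]_(x in H) (expR (- (c * x)))%:E)%E.
  apply: eq_integral => x; rewrite inE => /= Hx.
  by rewrite (lt_le_trans b0 Hx) mulr1.
by rewrite !E; exact: lap_eq.
Qed.

Let measurable_ray c b (D : set R) :
  measurable_fun D (fun x => (expR (- (c * x)) * (b < x)%R%:R)%:E).
Proof.
apply/measurable_EFinP; apply: measurable_funM; first exact: measurable_rexp.
apply: measurable_funTS.
rewrite (_ : (fun x => _) = \1_(`]b, +oo[%classic : set R)).
  by apply: measurable_indic; exact: measurable_itv.
by apply/funext => x; rewrite indicE mem_setE in_itv/= andbT.
Qed.

Let measurable_weighted_itv c a b (D : set R) :
  measurable_fun D (fun x => (expR (- (c * x)) * (a < x <= b)%R%:R)%:E).
Proof.
apply/measurable_EFinP; apply: measurable_funM; first exact: measurable_rexp.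
apply: measurable_funTS.
rewrite (_ : (fun x => _) = \1_(`]a, b]%classic : set R)).
  by apply: measurable_indic; exact: measurable_itv.
by apply/funext => x; rewrite indicE mem_setE in_itv/=.
Qed.

Let weighted_ge0 (c x : R) (b : bool) : (0 <= (expR (- (c * x)) * b%:R)%:E)%E.
Proof. by rewrite lee_fin mulr_ge0 ?expR_ge0. Qed.

Let int_itv c a b : 0 < c -> a <= b ->
  (\int[m1]_(x in H) (expR (- (c * x)) * (a < x <= b)%R%:R)%:E =
   \int[m2]_(x in H) (expR (- (c * x)) * (a < x <= b)%R%:R)%:E)%E.
Proof.
move=> c0 ab.
have E m : (\int[m]_(x in H) (expR (- (c * x)) * (a < x)%R%:R)%:E =
  \int[m]_(x in H) (expR (- (c * x)) * (a < x <= b)%R%:R)%:E +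
  \int[m]_(x in H) (expR (- (c * x)) * (b < x)%R%:R)%:E)%E.
  rewrite -ge0_integralD//; do 1?[exact: measurable_weighted_itv|
    exact: measurable_ray|by move=> x _; exact: weighted_ge0].
  apply: eq_integral => x _; rewrite -EFinD -mulrDr -natrD; congr (_ * _%:R)%:E.
  have [bx|xb] := ltP b x; first by rewrite (le_lt_trans ab bx).
  by rewrite andbT addn0.
have fin : (\int[m1]_(x in H) (expR (- (c * x)) * (b < x)%R%:R)%:E)%E
    \is a fin_num.
  rewrite ge0_fin_numE; last by apply: integral_ge0 => x _; exact: weighted_ge0.
  apply: le_lt_trans (lap_fin c0); apply: ge0_le_integral => //.
  - exact: measurable_ray.
  - exact: measurable_exp.
  - by move=> x _; rewrite lee_fin ler_piMr ?expR_ge0//; case: (_ < _).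
have := int_all_ray a c0; rewrite !E -(int_all_ray b c0).
exact: fin_num_addeI.
Qed.

Let measure_itv a b : a <= b -> m1 (`]a, b] `&` H) = m2 (`]a, b] `&` H).
Proof.
move=> ab.
have cv m : (\int[m]_(x in H)
      (expR (- (n.+1%:R^-1 * x)) * (a < x <= b)%R%:R)%:E)%E @[n --> \oo] -->
    m (`]a, b] `&` H).
  have -> : m (`]a, b] `&` H) = (\int[m]_(x in H) ((a < x <= b)%R%:R)%:E)%E.
    rewrite -integral_indic//.
    apply: eq_integral => x _.
    by rewrite indicE mem_setE in_itv/=.
  apply: cvg_integral_nondecreasing => //.
  - by move=> n; exact: measurable_weighted_itv.
  - move=> x /= Hx n p np; rewrite lee_fin ler_wpM2r// ler_expR lerN2.
    by rewrite ler_wpM2r// lef_pV2 ?posrE// ler_nat.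
  - move=> x Hx; apply: cvg_EFin; first exact: nearW.
    have e1 : expR (- (n.+1%:R^-1 * x)) @[n --> \oo] --> (1 : R).
      rewrite -[X in _ --> X]expR0.
      apply: cvg_expR; rewrite -oppr0 -[X in _ --> - X](mul0r x); apply: cvgN.
      by apply: cvgM; [exact: cvg_harmonic|exact: cvg_cst].
    rewrite -[X in _ --> X]mul1r.
    by apply: (cvgM e1); exact: cvg_cst.
by apply: cvge_eq_lim (cv m1) (cv m2) => n; exact: int_itv.
Qed.

(** The weights determine the integral of [expR (- (c * x))] over every
    interval; letting [c] decrease to 0 gives the measure of the interval, by
    monotone convergence, even if the total masses are infinite. *)
Lemma laplace_unique (A : set R) : measurable A -> m1 (A `&` H) = m2 (A `&` H).
Proof.
move=> mA.
pose n1 : {measure set (measurableTypeR R) -> \bar R} := mrestr m1 mH.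
pose n2 : {measure set (measurableTypeR R) -> \bar R} := mrestr m2 mH.
rewrite -[LHS]/(n1 A) -[RHS]/(n2 A).
have mE : @measurable _ (measurableTypeR R) = <<s @ocitv R >> by [].
have cover : \bigcup_k `](- k%:R), (k%:R : R)]%classic = setT by exact: bigcup_itvT.
apply: (@measure_unique _ R (measurableTypeR R) (@ocitv R)
  (fun k : nat => `](- k%:R), (k%:R : R)]%classic) mE (@ocitvI R) _ cover n1 n2) => //.
- by move=> k; exact: is_ocitv.
- move=> _ [[a b] _ <-]; rewrite /n1 /n2 /= /mrestr.
  have [ab|ba] := leP a b; first exact: measure_itv.
  by rewrite set_itv_ge ?set0I ?measure0// bnd_simp -leNgt ltW.
- move=> k; rewrite /n1 /= /mrestr.
  have -> : m1 (`](- k%:R), k%:R] `&` H) =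
      (\int[m1]_(x in H) ((- k%:R < x <= k%:R)%R%:R)%:E)%E.
    rewrite -integral_indic//.
    by apply: eq_integral => x _; rewrite indicE mem_setE in_itv/=.
  have k0 : (0 < expR k%:R :> R) by exact: expR_gt0.
  apply: (@le_lt_trans _ _ (\int[m1]_(x in H) ((expR k%:R)%:E * (expR (- (1 * x)))%:E))%E).
    apply: ge0_le_integral => //.
    - have := @measurable_weighted_itv 0 (- k%:R) k%:R H.
      apply: eq_measurable_fun => x _; congr (_%:E).
      by rewrite mul0r oppr0 expR0 mul1r.
    - apply/measurable_funeM; exact: measurable_exp.
    - move=> x _; rewrite lee_fin -expRD mul1r.
      case: (boolP (_ < x <= _)) => [/andP[_ xk]|_]; last exact: expR_ge0.
      by rewrite -[leLHS]expR0 ler_expR subr_ge0.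
  rewrite ge0_integralZl//; [|exact: measurable_exp].
    by rewrite lte_mul_pinfty ?lee_fin ?ltW// lap_fin.
Qed.

End laplace_uniqueness.

Lemma integral_mrestr d (T : measurableType d) (R : realType)
    (mu : {measure set T -> \bar R}) (D : set T) (mD : measurable D)
    (f : T -> \bar R) :
  measurable_fun setT f -> (forall x, 0 <= f x)%E ->
  (\int[mrestr mu mD]_x f x = \int[mu]_(x in D) f x)%E.
Proof.
move=> mf f0; have mDC : measurable (~` D) by exact: measurableC.
rewrite -(setUv D) ge0_integral_setU//; last 2 first.
- by rewrite setUv.
- by rewrite disj_set2E setICr.
rewrite [X in (_ + X)%E](_ : _ = 0%E) ?adde0.
  by apply: eq_measure_integral => A mA AD; rewrite /= /mrestr setIidl.
rewrite (eq_measure_integral mzero) ?integral_measure_zero// => A mA AD.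
rewrite /= /mrestr (_ : A `&` D = set0) ?measure0//.
by apply/seteqP; split => // x [/AD].
Qed.

Section laplace_transfer.
Context {R : realType} d1 d2 (X1 : measurableType d1) (X2 : measurableType d2).
Context (mu1 : {measure set X1 -> \bar R}) (mu2 : {measure set X2 -> \bar R}).
Context (D1 : set X1) (D2 : set X2) (g1 : X1 -> R) (g2 : X2 -> R).
Hypotheses (mD1 : measurable D1) (mD2 : measurable D2).
Hypotheses (mg1 : measurable_fun setT g1) (mg2 : measurable_fun setT g2).
Hypothesis g1_ge0 : forall x, D1 x -> 0 <= g1 x.
Hypothesis g2_ge0 : forall x, D2 x -> 0 <= g2 x.
Hypothesis lap_eq : forall c : R, 0 < c ->
  (\int[mu1]_(x in D1) (expR (- (c * g1 x)))%:E =
   \int[mu2]_(x in D2) (expR (- (c * g2 x)))%:E)%E.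
Hypothesis lap_fin : forall c : R, 0 < c ->
  (\int[mu1]_(x in D1) (expR (- (c * g1 x)))%:E < +oo)%E.

(** Restricting to [D] before taking the image under [g] yields a measure
    carried by the half-line, to which Laplace uniqueness applies. *)
Lemma integral_law d (X : measurableType d) (mu : {measure set X -> \bar R})
    (D : set X) (mD : measurable D) (g : {mfun X >-> measurableTypeR R})
    (f : R -> \bar R) : measurable_fun setT f -> (forall x, 0 <= f x)%E ->
    (forall x, D x -> 0 <= g x) ->
  (\int[pushforward (mrestr mu mD) g]_(y in [set y : R | (0 <= y)%R]) f y =
   \int[mu]_(x in D) f (g x))%E.
Proof.
move=> mf f0 g0.
have mH : measurable [set y : R | 0 <= y].
  rewrite (_ : [set y : R | 0 <= y] = `[0, +oo[%classic) //.
  by apply/seteqP; split => y; rewrite /= in_itv /= andbT.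
rewrite ge0_integral_pushforward//; last exact: measurable_funTS.
rewrite integral_mkcond integral_mrestr//.
- apply: eq_integral => x; rewrite inE => Dx.
  by rewrite patchE mem_set//=; exact: g0.
- apply/(measurable_restrictT _ _).1 => //.
    by rewrite -[_ @^-1` _]setTI; exact: (measurable_funP g).
  apply: measurable_funTS; exact: measurableT_comp.
- by move=> x; rewrite patchE; case: ifP => _ /=; [exact: f0|].
Qed.

Lemma eq_integral_laplace (f : R -> \bar R) :
  measurable_fun setT f -> (forall x, 0 <= f x)%E ->
  (\int[mu1]_(x in D1) f (g1 x) = \int[mu2]_(x in D2) f (g2 x))%E.
Proof.
move=> mf f0.
have mg1' : measurable_fun setT (g1 : X1 -> measurableTypeR R) by exact: mg1.
have mg2' : measurable_fun setT (g2 : X2 -> measurableTypeR R) by exact: mg2.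
pose h1 : {mfun X1 >-> measurableTypeR R} :=
  HB.pack (g1 : X1 -> measurableTypeR R)
    (isMeasurableFun.Build _ _ _ (measurableTypeR R) g1 mg1').
pose h2 : {mfun X2 >-> measurableTypeR R} :=
  HB.pack (g2 : X2 -> measurableTypeR R)
    (isMeasurableFun.Build _ _ _ (measurableTypeR R) g2 mg2').
have mexp c : measurable_fun setT (fun x : R => (expR (- (c * x)))%:E).
  exact: (measurable_EFin_expRN c (X := id)).
rewrite -(@integral_law _ _ _ _ mD1 h1)// -(@integral_law _ _ _ _ mD2 h2)//.
apply: eq_measure_integral => A mA AH; rewrite -(setIidl AH).
apply: laplace_unique => // c c0.
- rewrite (@integral_law _ _ _ _ mD1 h1)// (@integral_law _ _ _ _ mD2 h2)//.
  exact: lap_eq.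
- by rewrite (@integral_law _ _ _ _ mD1 h1)//; exact: lap_fin.
Qed.

End laplace_transfer.

(** * Independence of the past and the future increments *)

Section past_future.
Context {R : realType} d (T : measurableType d) (P : probability T R).
Context (V : {RV P >-> R}) (J : R -> {RV P >-> R}).
Hypothesis J0 : forall w, J 0 w = 0.
Hypothesis Jind : independent_increments J.
Hypothesis VJ : independent_systems P (sigma_RV V) (sigma_process J).
Context (t : nat -> R) (k : nat).
Hypotheses (t0 : t 0%N = 0) (t_nd : forall i, t i <= t i.+1).

Let incr i w := J (t i.+1) w - J (t i) w.

(** Only rectangles in the initial value and the first [k] increments: they
    form a pi-system on which independence of the next increment is a product
    rule, and generate the sigma-algebra of the past. *)
Definition past : set_system T := [set E | exists (B0 : set R) (B : nat -> set R),
  [/\ measurable B0, forall i, measurable (B i) &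
      E = V @^-1` B0 `&` \bigcap_(i in `I_k) (incr i @^-1` B i)]].

Let t_ge0 i : 0 <= t i.
Proof. by elim: i => [|i IH]; [rewrite t0|exact: le_trans (t_nd i)]. Qed.

Let measurable_incr i : measurable_fun setT (incr i).
Proof. exact: measurable_funB. Qed.

Lemma past_measurable : past `<=` measurable.
Proof.
move=> _ [B0 [B [mB0 mB ->]]]; apply: measurableI.
  exact: measurable_funPTI.
apply: bigcap_measurableType => i _.
by rewrite -[_ @^-1` _]setTI; exact: measurable_incr.
Qed.

Lemma past_setI : setI_closed past.
Proof.
move=> _ _ [A0 [A [mA0 mA ->]]] [B0 [B [mB0 mB ->]]].
exists (A0 `&` B0), (fun i => A i `&` B i); split.
- exact: measurableI.
- by move=> i; exact: measurableI.
- by rewrite setIACA -bigcapI.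
Qed.

Lemma past_setT : past setT.
Proof.
exists setT, (fun=> setT); split => //.
by apply/seteqP; split => // w _; split.
Qed.

Let Jproc (s : R) (A : set R) : 0 <= s -> measurable A ->
  sigma_process J (J s @^-1` A).
Proof.
move=> s0 mA; apply: sub_sigma_algebra.
exists s; first by rewrite /= in_itv /= s0.
by exists A => //; rewrite setTI.
Qed.

Let measurable_Jproc (s : R) : 0 <= s ->
  measurable_fun setT (J s : g_sigma_algebraType
    (\bigcup_(t in `[0, +oo[) sigma_RV (J t)) -> R).
Proof. by move=> s0 _ A mA; rewrite setTI; exact: Jproc. Qed.

Let incr_proc (u s : R) (A : set R) : 0 <= u -> 0 <= s -> measurable A ->
  sigma_process J ((fun w => J s w - J u w) @^-1` A).
Proof.
move=> u0 s0 mA.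
have := measurable_funB (measurable_Jproc s0) (measurable_Jproc u0).
by move=> /(_ measurableT A mA); rewrite setTI.
Qed.

(** The increment after [t k] extends the first [k] ones to a single family of
    independent increments, and [V] is independent of the whole family. *)
Lemma past_indep (s : R) (E : set T) (C : set R) : t k <= s -> past E ->
  measurable C ->
  (P (E `&` (fun w => (J s w - J (t k) w)%R) @^-1` C) =
   P E * P ((fun w => (J s w - J (t k) w)%R) @^-1` C))%E.
Proof.
move=> ts [B0 [B [mB0 mB ->]]] mC.
(* The first k times of the grid followed by s, constant from there on. *)
pose u i := if (i <= k)%N then t i else s.
have u_nd i : u i <= u i.+1.
  rewrite /u; case: (leqP i.+1 k) => [ik|ki]; first by rewrite (ltnW ik).
  by case: leqP => // ik; apply: le_trans ts; rewrite (_ : i = k)//; apply/eqP; rewrite eqn_leq ik.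
have u0 : 0 <= u 0%N by rewrite /u leq0n t0.
have Hind := @Jind k.+1 u u0 u_nd.
pose Ev C' := \bigcap_(i in `I_k) (incr i @^-1` B i) `&`
  (fun w => (J s w - J (t k) w)%R) @^-1` C'.
have PI C' : measurable C' -> P (Ev C') =
    (\prod_(i < k) P (incr i @^-1` B i) *
     P ((fun w => (J s w - J (t k) w)%R) @^-1` C'))%E.
  move=> mC'.
  pose A (i : 'I_k.+1) := if (i < k)%N then B i else C'.
  have mA i : measurable (A i) by rewrite /A; case: ifP.
  have := Hind A mA; rewrite big_ord_recr/=.
  have E1 : (fun w => J (u k.+1) w - J (u k) w) =
      (fun w => (J s w - J (t k) w)%R).
    by rewrite /u leqnn ltnn.
  have E2 (i : nat) : (i < k)%N ->
      (fun w => J (u i.+1) w - J (u i) w) = incr i.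
    by move=> ik; rewrite /u ik (ltnW ik).
  have Amax : A ord_max = C' by rewrite /A/= ltnn.
  have Ai (i : 'I_k) : A (widen_ord (leqnSn k) i) = B i by rewrite /A/= ltn_ord.
  rewrite Amax E1; under [in RHS]eq_bigr => i _ do rewrite Ai E2//.
  have E1w w : J (u k.+1) w - J (u k) w = J s w - J (t k) w.
    by have /(congr1 (fun h => h w)) := E1.
  have E2w i w : (i < k)%N -> J (u i.+1) w - J (u i) w = incr i w.
    by move=> /E2/(congr1 (fun h => h w)).
  move=> <-; congr (P _); apply/seteqP; split => w /=.
    move=> [H1 H2] i _; rewrite /A /=.
    case: ltnP => ik; first by rewrite E2w//; exact: H1.
    have -> : (i : nat) = k by apply/eqP; rewrite eqn_leq ik -ltnS ltn_ord.
    by rewrite E1w.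
  move=> H; split => [i /= ik|].
    have ik1 : (i < k.+1)%N by exact: ltnW.
    by have := H (Ordinal ik1) I; rewrite /A/= ik E2w.
  by have := H ord_max I; rewrite Amax/= E1w.
have ge0s : 0 <= s by exact: le_trans (t_ge0 k) ts.
have procI C' : measurable C' -> sigma_process J (Ev C').
  move=> mC'.
  pose G := g_sigma_algebraType (\bigcup_(t in `[0, +oo[) sigma_RV (J t)).
  suff : measurable (Ev C' : set G) by [].
  apply: measurableI; last exact: incr_proc.
  by apply: bigcap_measurableType => i _; exact: incr_proc.
have sV : sigma_RV V (V @^-1` B0) by exists B0 => //; rewrite setTI.
have IT : Ev setT = \bigcap_(i in `I_k) (incr i @^-1` B i).
  by rewrite /Ev preimage_setT setIT.
rewrite -setIA -/(Ev C) VJ//; last exact: procI.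
rewrite -IT [in RHS]VJ//; last exact: procI.
rewrite !PI// preimage_setT probability_setT mule1.
by rewrite muleA.
Qed.

(** As functions of [E], both sides are finite measures that agree on the
    pi-system of rectangles. *)
Lemma past_indep_sigma (s : R) (E : set T) (C : set R) : t k <= s ->
  <<s past >> E -> measurable C ->
  (P (E `&` (fun w => (J s w - J (t k) w)%R) @^-1` C) =
   P E * P ((fun w => (J s w - J (t k) w)%R) @^-1` C))%E.
Proof.
move=> ts sE mC.
set D := (fun w => (J s w - J (t k) w)%R) @^-1` C.
have mD : measurable D.
  by rewrite /D -[_ @^-1` _]setTI; apply: measurable_funB.
pose r : {nonneg R} := NngNum (fine_ge0 (measure_ge0 P D)).
pose p1 : {measure set T -> \bar R} := mrestr P mD.
pose p2 : {measure set T -> \bar R} := mscale r P.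
suff : p1 E = p2 E.
  rewrite /p1 /p2 /= /mrestr /mscale /= => ->.
  by rewrite fineK ?fin_num_measure// muleC.
apply: (@g_sigma_algebra_measure_unique _ R T past _ (fun=> setT)) => //.
- exact: past_measurable.
- by move=> _; exact: past_setT.
- by rewrite bigcup_const.
- exact: past_setI.
- move=> A pA; rewrite /p1 /p2 /= /mrestr /mscale /= past_indep//.
  by rewrite fineK ?fin_num_measure// muleC.
- move=> _; rewrite /p1 /= /mrestr setTI.
  by rewrite -ge0_fin_numE// fin_num_measure.
Qed.

Local Notation pastT := (g_sigma_algebraType past).

Lemma integral_past_future (s : R) (Y : T -> R) (g : R -> \bar R) : t k <= s ->
  measurable_fun setT (Y : pastT -> R) -> (forall w, 0 <= Y w) ->
  measurable_fun setT g -> (forall x, 0 <= g x)%E ->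
  (\int[P]_w ((Y w)%:E * g (J s w - J (t k) w)%R) =
   \int[P]_w (Y w)%:E * \int[P]_w g (J s w - J (t k) w)%R)%E.
Proof.
move=> ts mY Y0 mg g0.
have mY' : measurable_fun setT (Y : T -> R).
  move=> _ A mA; rewrite setTI.
  have := mY measurableT A mA; rewrite setTI => h.
  apply: (smallest_sub _ _ h); last exact: past_measurable.
  exact: sigma_algebra_measurable.
under eq_integral => w _ do rewrite -[(Y w)%:E]gee0_abs ?lee_fin//.
under [in RHS]eq_integral => w _ do rewrite -[(Y w)%:E]gee0_abs ?lee_fin//.
apply: (@integral_indepM _ _ _ _ Y (fun w => (J s w - J (t k) w)%R)
  (fun x => `|x%:E|)%E) => //.
- exact: measurable_funB.
- move=> A B mA mB; apply: past_indep_sigma => //.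
  by have := mY measurableT A mA; rewrite setTI.
- by apply: measurableT_comp.
Qed.

Lemma measurable_past_V : measurable_fun setT (V : pastT -> R).
Proof.
move=> _ A mA; rewrite setTI; apply: sub_sigma_algebra.
exists A, (fun=> setT); split => //.
by apply/seteqP; split => [w ?|w [] //]; split.
Qed.

Lemma measurable_past_J i : (i <= k)%N -> measurable_fun setT (J (t i) : pastT -> R).
Proof.
elim: i => [_|i IH ik].
  have E : J (t 0%N) = cst 0 :> (T -> R) by apply/funext => w; rewrite t0 J0.
  by rewrite E; exact: measurable_cst.
have E : J (t i.+1) = (fun w => J (t i) w + incr i w) :> (T -> R).
  by apply/funext => w; rewrite /incr addrC subrK.
rewrite E; apply: measurable_funD; first exact: IH (ltnW ik).
move=> _ A mA; rewrite setTI; apply: sub_sigma_algebra.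
exists setT, (fun j => if j == i then A else setT); split => //.
  by move=> j; case: ifP.
rewrite preimage_setT setTI; apply/seteqP; split => w /=.
  by move=> Aw j _; case: eqP => // ->.
by move=> /(_ i ik); rewrite eqxx.
Qed.

End past_future.

(** * Exponential moments of a process with stationary independent increments *)

Section levy_laplace.
Context {R : realType} d (T : measurableType d) (P : probability T R).
Context (V : {RV P >-> R}) (J : R -> {RV P >-> R}).
Hypothesis J0 : forall w, J 0 w = 0.
Hypothesis Jind : independent_increments J.
Hypothesis Jsta : stationary_increments J.
Hypothesis VJ : independent_systems P (sigma_RV V) (sigma_process J).
Hypothesis Jrc : forall w s, 0 <= s -> J u w @[u --> s^'+] --> J s w.

Lemma integral_stationary (s h : R) (g : R -> \bar R) : 0 <= s -> 0 <= h ->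
  measurable_fun setT g -> (forall x, 0 <= g x)%E ->
  (\int[P]_w g (J (s + h) w - J s w)%R = \int[P]_w g (J h w))%E.
Proof.
move=> s0 h0 mg g0.
have mX : measurable_fun setT (fun w => J (s + h) w - J s w).
  exact: measurable_funB.
pose X : {RV P >-> R} := HB.pack (fun w => J (s + h) w - J s w)
  (isMeasurableFun.Build _ _ _ _ _ mX).
transitivity (\int[distribution P X]_x g x)%E.
  by rewrite ge0_integral_distribution.
transitivity (\int[distribution P (J h)]_x g x)%E; last first.
  by rewrite ge0_integral_distribution.
by apply: eq_measure_integral => A mA _; exact: Jsta.
Qed.

Context (a p : R).
Hypothesis L1 : (\int[P]_w (expR (- (a * J 1 w)))%:E = (expR p)%:E)%E.

Let L s := (\int[P]_w (expR (- (a * J s w)))%:E)%E.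

Let LD s h : 0 <= s -> 0 <= h -> L (s + h) = (L s * L h)%E.
Proof.
move=> s0 h0; pose t (i : nat) := if i == 0%N then 0 else s.
have t_nd i : t i <= t i.+1 by rewrite /t /=; case: eqP.
pose g (x : R) := (expR (- (a * x)))%:E.
have mg : measurable_fun setT g by exact: measurable_EFin_expRN.
have g0 x : (0 <= g x)%E by rewrite lee_fin expR_ge0.
have := @integral_past_future _ _ _ P V J Jind VJ t 1%N erefl t_nd (s + h)
  (fun w => expR (- (a * J s w))) g.
rewrite /t/= lerDl => /(_ h0) H.
rewrite /L -(@integral_stationary s h g)// -H//; last first.
- have mJs : measurable_fun setT (J s : g_sigma_algebraType (past V J t 1) -> R).
    exact: (@measurable_past_J _ _ _ P V J J0 t 1%N erefl 1%N).
  exact: (measurable_expRN a mJs).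
apply: eq_integral => w _; rewrite /g -EFinM -expRD; congr (expR _)%:E.
by ring.
Qed.

Let L_gt0 s : (0 < L s)%E.
Proof.
by apply: gt0_integral; [exact: measurable_EFin_expRN|move=> w; rewrite lte_fin expR_gt0].
Qed.

Let L_nat n : L n%:R = (expR (p * n%:R))%:E.
Proof.
elim: n => [|n IH].
  rewrite mulr0 expR0 /L.
  under eq_integral => w _ do rewrite J0 mulr0 oppr0 expR0.
  by rewrite integral_cst//= probability_setT mule1.
by rewrite -natr1 LD// IH [L 1]L1 -EFinM -expRD mulrDr mulr1.
Qed.

(** The value at an integer above [s] is finite and has [L s] as a factor. *)
Let L_fin s : 0 <= s -> L s \is a fin_num.
Proof.
move=> s0; rewrite ge0_fin_numE; last exact: ltW.
rewrite ltey; apply/eqP => Loo.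
pose n := (Num.truncn s).+1.
have sn : s <= n%:R by exact/ltW/truncnS_gt.
have := L_nat n; rewrite -(subrKC s n%:R) LD ?subr_ge0// Loo.
by rewrite gt0_mulye.
Qed.

Let l s := fine (L s).

Let LE s : 0 <= s -> L s = (l s)%:E.
Proof. by move=> s0; rewrite /l fineK// L_fin. Qed.

Let l_gt0 s : 0 <= s -> 0 < l s.
Proof. by move=> s0; rewrite -lte_fin -LE. Qed.

Let lD s h : 0 <= s -> 0 <= h -> l (s + h) = l s * l h.
Proof.
by move=> s0 h0; apply: EFin_inj; rewrite -LE ?addr_ge0// LD// !LE// -EFinM.
Qed.

Let l_nat n : l n%:R = expR (p * n%:R).
Proof. by rewrite /l L_nat. Qed.

Let lM s n : 0 <= s -> l (n%:R * s) = l s ^+ n.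
Proof.
move=> s0; elim: n => [|n IH]; first by rewrite mul0r expr0 (l_nat 0) mulr0 expR0.
by rewrite -natr1 mulrDl mul1r lD ?mulr_ge0// IH exprSr.
Qed.

Let l_rat j n : l (j%:R / n.+1%:R) = expR (p * (j%:R / n.+1%:R)).
Proof.
have q0 : 0 <= j%:R / n.+1%:R :> R by rewrite divr_ge0.
have n0 : n.+1%:R != 0 :> R by rewrite pnatr_eq0.
have e1 : l (j%:R / n.+1%:R) ^+ n.+1 = expR (p * (j%:R / n.+1%:R)) ^+ n.+1.
  rewrite -lM// -expRM_natl mulrC divfK// l_nat.
  by congr expR; field.
by apply: (pexpIrn (n := n.+1)) => //; rewrite nnegrE ?expR_ge0// ltW// l_gt0.
Qed.

Let l_le s : 0 <= s -> l s <= expR (p * s).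
Proof.
move=> s0; rewrite -lee_fin -LE//.
pose q n : R := (Num.truncn (s * n.+1%:R)).+1%:R / n.+1%:R.
have n0 n : (0 : R) < n.+1%:R by [].
have sq n : s < q n by rewrite /q ltr_pdivlMr// truncnS_gt.
have qs n : q n <= s + n.+1%:R^-1.
  rewrite /q -natr1 mulrDl mul1r lerD2r ler_pdivrMr//.
  by have /truncn_itv/andP[] : 0 <= s * n.+1%:R by rewrite mulr_ge0.
have q_cvg : q n @[n --> \oo] --> s.
  apply: (@squeeze_cvgr _ _ _ _ (fun=> s) (fun n => s + n.+1%:R^-1)).
  - by apply: nearW => n; rewrite ltW//= qs.
  - exact: cvg_cst.
  - rewrite -[X in _ --> X]addr0; apply: cvgD; first exact: cvg_cst.
    exact: cvg_harmonic.
apply: (@fatou_cvg _ _ _ P (fun n w => (expR (- (a * J (q n) w)))%:E) _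
  (fun n => (expR (p * q n))%:E)).
- by move=> n; exact: measurable_EFin_expRN.
- by move=> n w; rewrite lee_fin expR_ge0.
- move=> w; apply: cvg_EFin; first exact: nearW.
  apply: cvg_expR; apply: cvgN; apply: cvgM; first exact: cvg_cst.
  by have /cvg_at_rightP := @Jrc w s s0; apply.
- move=> n; rewrite -/(L (q n)) LE ?(le_trans s0 (ltW (sq n)))//.
  by rewrite lee_fin l_rat.
- apply: cvg_EFin; first exact: nearW.
  by apply: cvg_expR; apply: cvgM => //; exact: cvg_cst.
Qed.

(** [E expR (- a J(s))] is multiplicative in [s], hence equal to
    [expR (p s)] for rational [s].  Right-continuity and Fatou's lemma give
    [<=] for every [s]; since the values at [s] and [n - s] multiply to the
    value at the integer [n], neither of the two inequalities is strict. *)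
Lemma levy_laplace s : 0 <= s ->
  (\int[P]_w (expR (- (a * J s w)))%:E = (expR (p * s))%:E)%E.
Proof.
move=> s0; rewrite -/(L s) LE//; congr (_%:E); apply/eqP.
rewrite eq_le l_le//=.
pose n := (Num.truncn s).+1.
have sn : 0 <= n%:R - s by rewrite subr_ge0; exact/ltW/truncnS_gt.
have := l_nat n; rewrite -{1}(subrKC s n%:R) lD// => e.
have := l_le sn; rewrite -(ler_pM2l (l_gt0 s0)) e.
rewrite -[X in _ <= l s * expR X](_ : p * n%:R - p * s = _); last by ring.
by rewrite expRD expRN mulrCA -[leLHS]mulr1 ler_pM2l ?expR_gt0// ler_pdivlMr ?expR_gt0// mul1r.
Qed.

Lemma levy_laplace_incr s h : 0 <= s -> 0 <= h ->
  (\int[P]_w (expR (- (a * (J (s + h) w - J s w))))%:E = (expR (p * h))%:E)%E.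
Proof.
move=> s0 h0.
rewrite (@integral_stationary s h (fun x => (expR (- (a * x)))%:E))//.
- exact: levy_laplace.
- exact: measurable_EFin_expRN.
Qed.

End levy_laplace.

(** * Stopping on a dyadic grid *)

Section grid.
Context {R : realType}.

Definition grid (m j : nat) : R := j%:R / 2 ^+ m.

Lemma grid0 m : grid m 0 = 0. Proof. by rewrite /grid mul0r. Qed.

Lemma grid_ge0 m j : 0 <= grid m j.
Proof. by rewrite divr_ge0// ltW. Qed.

Lemma gridS m j : grid m j.+1 = grid m j + 2 ^- m.
Proof. by rewrite /grid -natr1 mulrDl mul1r. Qed.

Lemma ler_grid m i j : (grid m i <= grid m j) = (i <= j)%N.
Proof. by rewrite ler_pM2r ?invr_gt0// ler_nat. Qed.

Lemma ltr_grid m i j : (grid m i < grid m j) = (i < j)%N.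
Proof. by rewrite ltr_pM2r ?invr_gt0// ltr_nat. Qed.

Lemma grid_refine m j : grid m.+1 (2 * j)%N = grid m j.
Proof. by rewrite /grid natrM exprS -mulf_div divff ?mul1r// pnatr_eq0. Qed.

Lemma grid_nat m n : grid m (n * 2 ^ m)%N = n%:R.
Proof. by rewrite /grid natrM natrX mulfK// gt_eqF. Qed.

Definition grid_floor m (s : R) : nat := Num.truncn (s * 2 ^+ m).

Lemma grid_floor_le m s : 0 <= s -> grid m (grid_floor m s) <= s.
Proof.
move=> s0; rewrite ler_pdivrMr//.
by have /truncn_itv/andP[] : 0 <= s * 2 ^+ m by rewrite mulr_ge0// ltW.
Qed.

Lemma lt_grid_floorS m s : s < grid m (grid_floor m s).+1.
Proof. by rewrite ltr_pdivlMr// truncnS_gt. Qed.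

Lemma grid_step_le1 m : 2 ^- m <= 1 :> R.
Proof. by rewrite invf_le1// exprn_ege1// ler1n. Qed.

Lemma grid_step_gt0 m : 0 < 2 ^- m :> R. Proof. by rewrite invr_gt0. Qed.

Lemma cvg_grid_step : (2 ^- m : R) @[m --> \oo] --> 0.
Proof.
rewrite (_ : (fun m : nat => _) = (fun m : nat => (2^-1 : R) ^+ m)); last first.
  by apply/funext => m; rewrite exprVn.
by apply: cvg_expr; rewrite gtr0_norm ?invr_gt0// invf_lt1// ltr1n.
Qed.

End grid.

Section surplus.
Context {R : realType} {T : Type}.
Implicit Types (V : T -> R) (J : R -> T -> R).

(** The time is clamped at 0 so that the paths are regular on the whole real
    line and joint measurability in time and outcome needs no sign
    condition. *)
Definition surplus V J (t : R) (w : T) : R := V w + J (Num.max 0 t) w.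

Definition survive_grid V J (m k : nat) : set T :=
  [set w | forall j, (j <= k)%N -> 0 <= surplus V J (grid m j) w].

(** Testing dyadic times only makes this event measurable; for paths without
    negative jumps it amounts to nonnegativity at all times from 0 to [s]. *)
Definition survive V J (s : R) : set T :=
  [set w | forall m j, grid m j <= s -> 0 <= surplus V J (grid m j) w].

Lemma surplusE V J t w : 0 <= t -> surplus V J t w = V w + J t w.
Proof. by move=> t0; rewrite /surplus max_r. Qed.

End surplus.

(** Here [al i] stands for the mass alive after [i] steps, [rr i] for the mass
    that leaves during step [i], and [q] for the growth factor of a step. *)
Lemma telescope_step (R : realType) (q : R) (al rr : nat -> R) k :
  (forall i, q * al i = al i.+1 + rr i) ->
  al 0%N + (q - 1) * \sum_(i < k) al i = al k + \sum_(i < k) rr i.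
Proof.
move=> step; elim: k => [|k IH]; first by rewrite !big_ord0 mulr0.
rewrite !big_ord_recr/= mulrDr addrA IH mulrBl step mul1r.
by ring.
Qed.

Lemma telescope_bound (R : realType) (q b : R) (al rr : nat -> R) k :
  (forall i, q * al i = al i.+1 + rr i) -> (forall i, 0 <= al i <= 1) ->
  0 <= q - 1 <= b -> \sum_(i < k) rr i <= 1 + k%:R * b.
Proof.
move=> step al01 /andP[q0 qb].
have := telescope_step k step.
have /andP[a0 a1] := al01 0%N; have /andP[b0 b1] := al01 k.
have s0 : 0 <= \sum_(i < k) al i.
  by apply: sumr_ge0 => i _; have /andP[] := al01 i.
have s1 : \sum_(i < k) al i <= k%:R.
  rewrite -[k in k%:R]card_ord -sum1_card natr_sum.
  by apply: ler_sum => i _; have /andP[] := al01 i.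
have := ler_pM q0 s0 qb s1; rewrite [b * _]mulrC; lra.
Qed.

Section ereal_telescope.
Context {R : realType} (q b : R) (aa r : nat -> \bar R).
Hypotheses (aa0 : forall i, (0 <= aa i)%E) (aa1 : forall i, (aa i <= 1)%E).
Hypothesis r0 : forall i, (0 <= r i)%E.
Hypothesis step : forall i, (q%:E * aa i = aa i.+1 + r i)%E.

Let realization : exists al rr : nat -> R,
  [/\ forall k, aa k = (al k)%:E, forall k, r k = (rr k)%:E,
      forall k, 0 <= al k <= 1 & forall k, q * al k = al k.+1 + rr k].
Proof.
have aaE k : aa k = (fine (aa k))%:E.
  by rewrite fineK// ge0_fin_numE// (le_lt_trans (aa1 k))// ltry.
have rE k : r k = (fine (r k))%:E.
  rewrite fineK// ge0_fin_numE//; apply: (@le_lt_trans _ _ (q%:E * aa k)%E).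
    by rewrite step leeDr.
  by rewrite aaE -EFinM ltry.
exists (fine \o aa), (fine \o r); split => // k.
- by rewrite -!lee_fin /= -aaE aa0 aa1.
- by apply: EFin_inj; rewrite EFinM EFinD /= -!aaE -rE.
Qed.

Lemma etelescope_step k :
  (aa 0%N + (q - 1)%:E * \sum_(i < k) aa i = aa k + \sum_(i < k) r i)%E.
Proof.
have [al [rr [aaE rE al01 st]]] := realization.
under eq_bigr => i _ do rewrite aaE.
under [in RHS]eq_bigr => i _ do rewrite rE.
rewrite !aaE !sumEFin -EFinM -!EFinD; congr (_%:E).
exact: telescope_step.
Qed.

Lemma etelescope_bound k : 0 <= q - 1 <= b ->
  (\sum_(i < k) r i <= (1 + k%:R * b)%:E)%E.
Proof.
move=> qb; have [al [rr [aaE rE al01 st]]] := realization.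
under eq_bigr => i _ do rewrite rE.
by rewrite sumEFin lee_fin; exact: (telescope_bound _ st).
Qed.

End ereal_telescope.

Lemma expR_step_bound (R : realType) (p : R) m : 0 < p ->
  0 <= expR (p * 2 ^- m) - 1 <= p * expR p * 2 ^- m.
Proof.
move=> p0; set x := p * 2 ^- m.
have x0 : 0 <= x by rewrite mulr_ge0 ?ltW// grid_step_gt0.
have xp : x <= p by apply: ler_piMr; [exact: ltW|exact: grid_step_le1].
rewrite subr_ge0 -[X in X <= expR x]expR0 ler_expR x0/=.
apply: (@le_trans _ _ (x * expR x)).
  have h := expR_ge1Dx (- x); rewrite -(ler_pM2r (expR_gt0 x)) in h.
  move: h; rewrite -expRD addNr expR0; lra.
by rewrite [leRHS]mulrAC -/x ler_wpM2l// ler_expR.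
Qed.

Section exit.
Context {R : realType} d (T : measurableType d) (P : probability T R).
Context (V : {RV P >-> R}) (J : R -> {RV P >-> R}).
Hypothesis J0 : forall w, J 0 w = 0.
Hypothesis Jind : independent_increments J.
Hypothesis Jsta : stationary_increments J.
Hypothesis VJ : independent_systems P (sigma_RV V) (sigma_process J).
Hypothesis Jrc : forall w s, 0 <= s -> J u w @[u --> s^'+] --> J s w.

Local Notation W := (surplus V J).
Local Notation A := (survive_grid V J).

Lemma measurable_surplus t : measurable_fun setT (W t).
Proof. exact: measurable_funD. Qed.

Let nonnegE t : [set w | 0 <= W t w] = W t @^-1` `[0, +oo[.
Proof. by apply/seteqP; split => w /=; rewrite in_itv/= andbT. Qed.

Lemma measurable_surplus_ge0 t : measurable [set w | 0 <= W t w].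
Proof. by rewrite nonnegE -[_ @^-1` _]setTI; exact: measurable_surplus. Qed.

Let survive_gridE m k :
  A m k = \bigcap_(j in `I_k.+1) [set w | 0 <= W (grid m j) w].
Proof. by apply/seteqP; split => w h j /= jk; exact: h. Qed.

Lemma measurable_survive_grid m k : measurable (A m k).
Proof.
rewrite survive_gridE; apply: bigcap_measurableType => j _.
exact: measurable_surplus_ge0.
Qed.

Lemma survive_gridS m k : A m k.+1 `<=` A m k.
Proof. by move=> w h j jk; apply: h; exact: leqW. Qed.

Lemma survive_grid_ge0 m k w : A m k w -> 0 <= W (grid m k) w.
Proof. exact. Qed.

Lemma survive_grid0 m : A m 0 = [set w | 0 <= V w].
Proof.
have W0 w : W (grid m 0) w = V w by rewrite grid0 surplusE// J0 addr0.
apply/seteqP; split => w /=; first by move=> /(_ 0%N isT); rewrite W0.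
by move=> V0 j; rewrite leqn0 => /eqP ->; rewrite W0.
Qed.

Section exponential_functional.
Context (a p : R) (a_gt0 : 0 < a) (p_gt0 : 0 < p).
Hypothesis L1 : (\int[P]_w (expR (- (a * J 1 w)))%:E = (expR p)%:E)%E.

Local Notation e := (fun t w => expR (- (a * W t w))).

Lemma measurable_exp_surplus t (B : set T) : measurable_fun B (e t).
Proof.
apply: measurable_expRN; apply: measurable_funTS; exact: measurable_surplus.
Qed.

Definition alive_mass m k : \bar R := (\int[P]_(w in A m k) (e (grid m k) w)%:E)%E.

(** The event [A m k] and the surplus at time [grid m k] belong to the past of
    that time; the increment up to [s] is independent of it and contributes
    the factor [expR (p * (s - grid m k))]. *)
Lemma integral_survive_grid m k s : grid m k <= s ->
  (\int[P]_(w in A m k) (e s w)%:E =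
   (expR (p * (s - grid m k)))%:E * alive_mass m k)%E.
Proof.
move=> ks.
have s0 : 0 <= s by apply: le_trans ks; exact: grid_ge0.
pose pastT := g_sigma_algebraType (past V J (grid m) k).
have t_nd i : grid m i <= grid m i.+1 :> R by rewrite ler_grid.
have mWp j : (j <= k)%N -> measurable_fun setT (W (grid m j) : pastT -> R).
  move=> jk.
  have -> : W (grid m j) = (fun w => V w + J (grid m j) w).
    by apply/funext => w; rewrite surplusE// grid_ge0.
  apply: measurable_funD; first exact: measurable_past_V.
  by apply: measurable_past_J => //; exact: grid0.
have mAp : measurable (A m k : set pastT).
  rewrite survive_gridE; apply: bigcap_measurableType => j /= jk.
  by rewrite nonnegE -[_ @^-1` _]setTI; exact: mWp.
pose Y w := e (grid m k) w * \1_(A m k) w.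
have mY : measurable_fun setT (Y : pastT -> R).
  apply: measurable_funM; last exact: measurable_indic.
  have mWk := mWp k (leqnn k); exact: (measurable_expRN a mWk).
pose g (x : R) := (expR (- (a * x)))%:E.
have mg : measurable_fun setT g by exact: measurable_EFin_expRN.
have g0 x : (0 <= g x)%E by rewrite lee_fin expR_ge0.
have Y0 w : 0 <= Y w by rewrite mulr_ge0 ?expR_ge0.
have := @integral_past_future _ _ _ P V J Jind VJ (grid m) k (grid0 m) t_nd
  s Y g ks mY Y0 mg g0.
have := @levy_laplace_incr _ _ _ P V J J0 Jind Jsta VJ Jrc a p L1 (grid m k)
  (s - grid m k) (grid_ge0 m k).
rewrite subr_ge0 => /(_ ks); rewrite subrKC => ->.
have -> : (\int[P]_w (Y w)%:E = alive_mass m k)%E.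
  rewrite /alive_mass [RHS]integral_mkcond; apply: eq_integral => w _.
  rewrite patchE /Y indicE; case: ifP => _; first by rewrite mulr1.
  by rewrite mulr0.
rewrite muleC => <-.
rewrite integral_mkcond; apply: eq_integral => w _.
rewrite patchE /Y indicE; case: ifP => _; last by rewrite mulr0 mul0e.
rewrite mulr1 /g -EFinM -expRD; congr (expR _)%:E.
rewrite !surplusE ?grid_ge0//; ring.
Qed.

Lemma alive_mass_ge0 m k : (0 <= alive_mass m k)%E.
Proof. by apply: integral_ge0 => w _; rewrite lee_fin expR_ge0. Qed.

Lemma alive_mass_le1 m k : (alive_mass m k <= 1)%E.
Proof.
apply: (@le_trans _ _ (\int[P]_(w in A m k) (1 : R)%:E)%E).
  apply: ge0_le_integral_EFin => //.
  - exact: measurable_survive_grid.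
  - exact: measurable_exp_surplus.
  - move=> w /survive_grid_ge0 Aw; rewrite -[leRHS]expR0 ler_expR oppr_le0.
    by rewrite mulr_ge0 // ltW.
rewrite integral_cst ?mul1e; last exact: measurable_survive_grid.
by apply: probability_le1; exact: measurable_survive_grid.
Qed.

Definition exit_mass m k : \bar R := (\int[P]_(w in A m k `\` A m k.+1) (e (grid m k.+1) w)%:E)%E.

Lemma exit_mass_ge0 m k : (0 <= exit_mass m k)%E.
Proof. by apply: integral_ge0 => w _; rewrite lee_fin expR_ge0. Qed.

Let measurable_exit m k : measurable (A m k `\` A m k.+1).
Proof. by apply: measurableD; exact: measurable_survive_grid. Qed.

Let one_step m k :
  ((expR (p * 2 ^- m))%:E * alive_mass m k = alive_mass m k.+1 + exit_mass m k)%E.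
Proof.
have -> : 2 ^- m = grid m k.+1 - grid m k :> R by rewrite gridS addrAC subrr add0r.
rewrite -integral_survive_grid ?ler_grid//.
rewrite -{1}(setDUK (@survive_gridS m k)) ge0_integral_setU//.
- exact: measurable_survive_grid.
- apply/measurable_EFinP; exact: measurable_exp_surplus.
- by rewrite disj_set2E setDIK.
Qed.

(** Optional stopping at the first grid time where the surplus is negative. *)
Lemma discrete_martingale m k :
  (alive_mass m 0 + (expR (p * 2 ^- m) - 1)%:E * \sum_(i < k) alive_mass m i =
   alive_mass m k + \sum_(i < k) exit_mass m i)%E.
Proof.
apply: (@etelescope_step _ _ (alive_mass m) (exit_mass m));
  [exact: alive_mass_ge0|exact: alive_mass_le1|exact: exit_mass_ge0|exact: one_step].
Qed.

(** On a fixed time span [k * 2 ^- m] is constant, so that the bound is uniform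
    in [m].  Used for the exponent [2 * a], it bounds second moments. *)
Lemma sum_exit_le m k :
  (\sum_(i < k) exit_mass m i <= (1 + k%:R * (p * expR p * 2 ^- m))%:E)%E.
Proof.
apply: (@etelescope_bound _ (expR (p * 2 ^- m)) _ (alive_mass m) (exit_mass m));
  [exact: alive_mass_ge0|exact: alive_mass_le1|exact: exit_mass_ge0|exact: one_step|].
exact: expR_step_bound.
Qed.

End exponential_functional.
End exit.

(** * The undershoot vanishes as the grid is refined *)

Lemma within_continuous_seq (R : realType) (f : R -> R) (u : nat -> R) (x : R) :
  {within `[0, +oo[, continuous f} -> (forall n, 0 <= u n) -> 0 <= x ->
  u n @[n --> \oo] --> x -> f (u n) @[n --> \oo] --> f x.
Proof.
move=> /subspace_continuousP fc u0 x0 ux.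
have := fc x; rewrite /= in_itv/= x0 => /(_ isT) fx.
apply: cvg_trans fx => B /= [e e0 he].
have h : \forall n \near \oo, ball x e (u n) := ux _ (nbhsx_ballx x e e0).
apply: (filterS _ h) => n /= un; apply: he; first exact: un.
by rewrite set_itvE; exact: u0.
Qed.

Section exit_path.
Context {R : realType} {T : Type} (V : T -> R) (J S X : R -> T -> R).
Hypothesis J0 : forall w, J 0 w = 0.
Hypothesis JSX : forall t w, 0 <= t -> J t w = S t w + X t w.
Hypothesis S_nd : forall w s t, 0 <= s -> s <= t -> S s w <= S t w.
Hypothesis X_cont : forall w, {within `[0, +oo[, continuous (X ^~ w)}.

Local Notation W := (surplus V J).
Local Notation A := (survive_grid V J).
Local Notation D := (survive V J).

(** Only the continuous component can bring the surplus down. *)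
Lemma surplus_incr_ge s t w : 0 <= s -> s <= t -> W s w + (X t w - X s w) <= W t w.
Proof.
move=> s0 st; have t0 := le_trans s0 st.
rewrite !surplusE// !JSX//; have := S_nd w s0 st; lra.
Qed.

Lemma survive_grid_le m i k : (i <= k)%N -> A m k `<=` A m i.
Proof. by move=> ik w Aw j ji; apply: Aw; exact: leq_trans ik. Qed.

Definition exit_cell m i : set T := A m i `\` A m i.+1.

Lemma exit_cell_lt0 m i w : exit_cell m i w -> W (grid m i.+1) w < 0.
Proof.
move=> [Ai nAi]; rewrite ltNge; apply/negP => W0; apply: nAi => j.
by rewrite leq_eqVlt => /predU1P[->//|]; rewrite ltnS; exact: Ai.
Qed.

Lemma exit_cell_uniq m i j w : exit_cell m i w -> exit_cell m j w -> i = j.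
Proof.
move=> Bi Bj; apply/eqP; rewrite eqn_leq; apply/andP; split; rewrite leqNgt.
  by apply/negP => ji; apply: Bj.2; apply: survive_grid_le Bi.1.
by apply/negP => ij; apply: Bi.2; apply: survive_grid_le Bj.1.
Qed.

Lemma exit_cell_exists m k w : A m 0 w -> ~ A m k w ->
  exists2 i, (i < k)%N & exit_cell m i w.
Proof.
move=> A0; elim: k => [//|k IH] nA.
have [Ak|nAk] := pselect (A m k w); first by exists k.
by have [i ik Bi] := IH nAk; exists i => //; exact: ltnW.
Qed.

(** The exponential of the surplus at its first negative grid time, if that
    time comes within [k] steps, and 0 otherwise; the form of a sum permits
    termwise integration. *)
Definition exit_value (a : R) m k w : R :=
  \sum_(i < k) expR (- (a * W (grid m i.+1) w)) * \1_(exit_cell m i) w.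

Lemma exit_valueE a m k i w : (i < k)%N -> exit_cell m i w ->
  exit_value a m k w = expR (- (a * W (grid m i.+1) w)).
Proof.
move=> ik Bi; rewrite /exit_value (bigD1 (Ordinal ik))//= indicE mem_set// mulr1.
rewrite big1 ?addr0// => j ji; rewrite indicE memNset ?mulr0// => Bj.
by move/eqP: ji; apply; apply: val_inj => /=; exact: exit_cell_uniq Bj Bi.
Qed.

Lemma exit_value0 a m k w : (forall i, (i < k)%N -> ~ exit_cell m i w) ->
  exit_value a m k w = 0.
Proof.
by move=> h; rewrite /exit_value big1// => i _; rewrite indicE memNset ?mulr0//; exact: h.
Qed.

(** At most one term of the sum is nonzero. *)
Lemma exit_value_sqr a m k w : exit_value a m k w ^+ 2 = exit_value (2 * a) m k w.
Proof.
have [[i [ik Bi]]|h] := pselect (exists i, (i < k)%N /\ exit_cell m i w).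
  rewrite !(exit_valueE _ ik Bi) expr2 -expRD; congr expR; ring.
have h' i : (i < k)%N -> ~ exit_cell m i w by move=> ik Bi; apply: h; exists i.
by rewrite !exit_value0// expr0n.
Qed.

Lemma exit_value_ge0 a m k w : 0 <= exit_value a m k w.
Proof. by apply: sumr_ge0 => i _; rewrite mulr_ge0 ?expR_ge0. Qed.

Lemma survive_sub_grid m k s : grid m k <= s -> D s `<=` A m k.
Proof. by move=> ks w Dw j jk; apply: Dw; apply: le_trans ks; rewrite ler_grid. Qed.

Lemma grid_refine_add m d j : grid (m + d) (j * 2 ^ d)%N = grid m j :> R.
Proof.
elim: d => [|d IH]; first by rewrite addn0 expn0 muln1.
by rewrite addnS expnS mulnCA grid_refine.
Qed.

(** The first negative grid time [tau d] decreases when the grid is refined,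
    and one step before, at [sig d], the surplus is nonnegative.  The two times
    have a common limit, at which [X] is continuous, and
    [W (tau d) >= X (tau d) - X (sig d)] by [surplus_incr_ge]. *)
Lemma cvg_exit_value a n w : 0 <= V w -> ~ D n%:R w ->
  exit_value a m (n * 2 ^ m) w @[m --> \oo] --> (1 : R).
Proof.
move=> V0 nD.
have [m0 [j0 [j0n W0]]] : exists m0 j0, (grid m0 j0 : R) <= n%:R /\ W (grid m0 j0) w < 0.
  apply: contrapT => h; apply: nD => m j mj; rewrite leNgt; apply/negP => W0.
  by apply: h; exists m, j.
have A0 m : A m 0 w.
  by move=> j; rewrite leqn0 => /eqP ->; rewrite grid0 surplusE// J0 addr0.
have exits d : exists i, (i < n * 2 ^ (m0 + d))%N /\ exit_cell (m0 + d) i w.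
  have nA : ~ A (m0 + d) (n * 2 ^ (m0 + d)) w.
    move=> /(_ (j0 * 2 ^ d)%N); rewrite -(@ler_grid R (m0 + d)) grid_refine_add.
    by rewrite grid_nat => /(_ j0n); rewrite leNgt W0.
  by have [i ik Bi] := exit_cell_exists (A0 _) nA; exists i.
have [i_ Hi] := choice exits.
pose tau d := grid (m0 + d) (i_ d).+1 : R.
pose sig d := grid (m0 + d) (i_ d) : R.
have tau0 d : 0 <= tau d by exact: grid_ge0.
have sig0 d : 0 <= sig d by exact: grid_ge0.
have Wtau d : W (tau d) w < 0 by exact: exit_cell_lt0 (Hi d).2.
have Wsig d : 0 <= W (sig d) w by exact: (Hi d).2.1.
have tau_ni : nonincreasing_seq tau.
  apply/nonincreasing_seqP => d.
  rewrite /tau -(@grid_refine R (m0 + d)) addnS ler_grid ltnNge; apply/negP => le2.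
  have := (Hi d.+1).2.1; rewrite addnS => /(_ _ le2).
  by rewrite grid_refine leNgt Wtau.
have tau_cvg : cvgn tau.
  by apply: nonincreasing_is_cvgn => //; exists 0 => _ [d _ <-].
have lim0 : 0 <= limn tau by apply: limr_ge => //; exact: nearW.
have sig_cvg : sig d @[d --> \oo] --> limn tau.
  have -> : sig = (fun d => tau d - 2 ^- (m0 + d)).
    by apply/funext => d; rewrite /sig /tau gridS addrK.
  rewrite -[X in _ --> X]subr0; apply: cvgB; first exact: tau_cvg.
  have := @cvg_grid_step R; rewrite -(cvg_shiftn m0) /=.
  by under eq_fun do rewrite addnC.
have Xtau : X (tau d) w @[d --> \oo] --> X (limn tau) w.
  exact: (within_continuous_seq (@X_cont w) tau0 lim0 tau_cvg).
have Xsig : X (sig d) w @[d --> \oo] --> X (limn tau) w.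
  exact: (within_continuous_seq (@X_cont w) sig0 lim0 sig_cvg).
have W_cvg : W (tau d) w @[d --> \oo] --> 0.
  apply: (@squeeze_cvgr _ _ _ _ (fun d => X (tau d) w - X (sig d) w) (fun=> 0)).
  - apply: nearW => d; rewrite (ltW (Wtau d)) andbT.
    have st : sig d <= tau d by rewrite ler_grid.
    by have := surplus_incr_ge w (sig0 d) st; have := Wsig d; lra.
  - by rewrite -(subrr (X (limn tau) w)); exact: cvgB.
  - exact: cvg_cst.
rewrite -(cvg_shiftn m0).
rewrite (_ : (fun d => _) = (fun d => expR (- (a * W (tau d) w)))); last first.
  by apply/funext => d; rewrite addnC (exit_valueE _ (Hi d).1 (Hi d).2).
rewrite -expR0; apply: cvg_expR; rewrite -oppr0; apply: cvgN.
by rewrite -(mulr0 a); apply: cvgM => //; exact: cvg_cst.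
Qed.

Lemma cvg_exit_value_indic a n w :
  exit_value a m (n * 2 ^ m) w @[m --> \oo] -->
  (\1_([set w | 0 <= V w] `\` D n%:R) w : R).
Proof.
have [[V0 nD]|h] := pselect (([set w | 0 <= V w] `\` D n%:R) w).
  by rewrite indicE mem_set//; exact: cvg_exit_value.
rewrite indicE memNset//.
rewrite (_ : (fun m => _) = fun=> 0); first exact: cvg_cst.
apply/funext => m; apply: exit_value0 => i ik Bi; apply: h; split => /=.
  have := Bi.1 0%N isT; rewrite grid0 surplusE// J0 addr0//.
move=> Dn; apply: Bi.2; apply: survive_sub_grid Dn.
by rewrite -(grid_nat m n) ler_grid.
Qed.

End exit_path.

(** * Joint measurability and the sojourn before exit, level by level *)

Lemma integral_scaled_expR (R : realType) (c x y : R) : x < y ->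
  (\int[lebesgue_measure]_(s in `[x, y]) (c * expR (c * (s - x)))%:E =
   (expR (c * (y - x)) - 1)%:E)%E.
Proof.
move=> xy; pose F (s : R) := expR (c * (s - x)).
have dF (s : R) : is_derive s 1 F (c * expR (c * (s - x))).
  have h : is_derive s 1 (fun s : R => c * (s - x)) c.
    have -> : (fun s : R => c * (s - x)) = c *: (fun s : R => s - x).
      by apply/funext => t.
    apply: is_derive_eq; by rewrite subr0 /GRing.scale /= mulr1.
  have := @is_derive1_comp R expR (fun s : R => c * (s - x)) s _ _ _ h.
  by move=> H; apply: is_derive_eq; rewrite mulrC.
have cF : continuous F.
  by move=> s; apply/differentiable_continuous/derivable1_diffP; have [] := dF s.
rewrite (@continuous_FTC2 R (fun s => c * expR (c * (s - x))) F)//.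
- by rewrite /F subrr mulr0 expR0 EFinB.
- apply: continuous_subspaceT => s; apply: cvgM; first exact: cvg_cst.
  exact: cF.
- split.
  + by move=> s _; have [] := dF s.
  + by apply: cvg_at_right_filter; exact: cF.
  + by apply: cvg_at_left_filter; exact: cF.
- by move=> s _; rewrite derive1E; have [_ ->] := dF s.
Qed.

(** The times [q n t] take countably many values and approach [Num.max 0 t]
    strictly from the right. *)
Lemma measurable_right_continuous (R : realType) d (T : measurableType d)
    (Y : R -> T -> R) :
  (forall t, measurable_fun setT (Y t)) ->
  (forall w t, 0 <= t -> Y u w @[u --> t^'+] --> Y t w) ->
  measurable_fun setT (fun z : T * measurableTypeR R => Y (Num.max 0 z.2) z.1).
Proof.
move=> mY Yrc.
pose tr n (t : R) := Num.truncn (t * n.+1%:R).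
pose q n t := (tr n t).+1%:R / n.+1%:R : R.
have n0 n : (0 : R) < n.+1%:R by [].
have qlt n t : Num.max 0 t < q n t.
  by rewrite gt_max divr_gt0//= /q ltr_pdivlMr// truncnS_gt.
have qle n t : q n t <= Num.max 0 t + n.+1%:R^-1.
  rewrite /q -natr1 mulrDl mul1r lerD2r ler_pdivrMr// /tr.
  have [t0|t0] := leP 0 t.
    by have /truncn_itv/andP[] : 0 <= t * n.+1%:R by rewrite mulr_ge0.
  rewrite mul0r (_ : Num.truncn _ = 0%N)//; apply/eqP; rewrite -leqn0.
  by rewrite truncn_le_nat; apply: lt_trans ltr01; rewrite pmulr_llt0.
have q_cvg t : q n t @[n --> \oo] --> Num.max 0 t.
  apply: (@squeeze_cvgr _ _ _ _ (fun=> Num.max 0 t) (fun n => Num.max 0 t + n.+1%:R^-1)).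
  - by apply: nearW => n; rewrite ltW//= qle.
  - exact: cvg_cst.
  - rewrite -[X in _ --> X]addr0; apply: cvgD; first exact: cvg_cst.
    exact: cvg_harmonic.
apply: (@measurable_fun_cvg _ _ _ _ (fun n (z : T * measurableTypeR R) => Y (q n z.2) z.1)); last first.
  move=> [w t] _ /=.
  have t0 : 0 <= Num.max 0 t by rewrite le_max lexx.
  by have /cvg_at_rightP := Yrc w _ t0; apply.
move=> n _ A mA; rewrite setTI.
pose B j : set (measurableTypeR R) := [set t | tr n t = j].
have mB j : measurable (B j).
  have mle i : measurable [set t : measurableTypeR R | (tr n t <= i)%N].
    rewrite (_ : [set t | _] = `]-oo, i.+1%:R / n.+1%:R[%classic); first exact: measurable_itv.
    by apply/seteqP; split => t /=; rewrite in_itv/= truncn_le_nat ltr_pdivlMr.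
  case: j => [|j].
    rewrite (_ : B 0%N = [set t : measurableTypeR R | (tr n t <= 0)%N])//.
    by apply/seteqP; split => t /=; rewrite leqn0 => /eqP.
  rewrite (_ : B j.+1 = [set t : measurableTypeR R | (tr n t <= j.+1)%N] `\`
    [set t : measurableTypeR R | (tr n t <= j)%N]); first exact: measurableD.
  apply/seteqP; split => t /=; rewrite /B /=; first by move=> ->; rewrite ltnn.
  move=> [h1 /negP]; rewrite -ltnNge => h2.
  by apply/eqP; rewrite eqn_leq h1.
rewrite (_ : _ @^-1` A =
  \bigcup_j ((Y (j.+1%:R / n.+1%:R) @^-1` A) `*` B j)); last first.
  apply/seteqP; split => [[w t] /= h|[w t] [j _ [/= h1 h2]]].
    by exists (tr n t) => //; split.
  by rewrite /q h2.
apply: bigcupT_measurable => j; apply: measurableX => //.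
by rewrite -[_ @^-1` A]setTI; exact: mY.
Qed.

Section sojourn.
Context {R : realType} d (T : measurableType d) (P : probability T R).
Context (V : {RV P >-> R}) (J : R -> {RV P >-> R}) (S X : R -> T -> R).
Hypothesis J0 : forall w, J 0 w = 0.
Hypothesis Jind : independent_increments J.
Hypothesis Jsta : stationary_increments J.
Hypothesis VJ : independent_systems P (sigma_RV V) (sigma_process J).
Hypothesis Jrc : forall w s, 0 <= s -> J u w @[u --> s^'+] --> J s w.
Hypothesis JSX : forall t w, 0 <= t -> J t w = S t w + X t w.
Hypothesis S_nd : forall w s t, 0 <= s -> s <= t -> S s w <= S t w.
Hypothesis X_cont : forall w, {within `[0, +oo[, continuous (X ^~ w)}.

Local Notation W := (surplus V J).
Local Notation A := (survive_grid V J).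
Local Notation D := (survive V J).
Local Notation mu := (@lebesgue_measure R).

(** Constant in [s] on each cell of the grid of level [m], and decreasing to
    [survive] as [m] grows. *)
Definition stay m (s : R) : set T :=
  [set w | forall j, grid m j <= s -> 0 <= W (grid m j) w].

Lemma stayE m k s : grid m k <= s -> s < grid m k.+1 -> stay m s = A m k.
Proof.
move=> ks sk; apply/seteqP; split => w h j.
  by move=> jk; apply: h; apply: le_trans ks; rewrite ler_grid.
move=> js; apply: h; have := le_lt_trans js sk.
by rewrite ltr_grid ltnS.
Qed.

Lemma staySm m s : stay m.+1 s `<=` stay m s.
Proof.
by move=> w h j js; rewrite -grid_refine; apply: h; rewrite grid_refine.
Qed.

Lemma survive_bigcap s : D s = \bigcap_m stay m s.
Proof.
by apply/seteqP; split => w h m; [move=> _ j|move=> j]; [exact: h|exact: h].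
Qed.

Lemma measurable_surplus_prod :
  measurable_fun setT (fun z : T * measurableTypeR R => W z.2 z.1).
Proof.
apply: measurable_funD; first exact: (measurableT_comp (f := V)).
by apply: (@measurable_right_continuous R _ T J) => // w t t0; exact: Jrc.
Qed.

Lemma measurable_stay_prod m :
  measurable [set z : T * measurableTypeR R | stay m z.2 z.1].
Proof.
rewrite (_ : [set z | _] = \bigcap_j (setT `*` [set s : measurableTypeR R | s < grid m j]
   `|` [set w | 0 <= W (grid m j) w] `*` setT)); last first.
  apply/seteqP; split => [[w s] /= h j _|[w s] h j js].
    have [js|sj] := leP (grid m j) s; first by right; split => //=; exact: h.
    by left.
  by have [[_ /=]|[]//] := h j I; rewrite ltNge js.
apply: bigcapT_measurable => j; apply: measurableU; apply: measurableX => //.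
  rewrite (_ : [set s | _] = `]-oo, grid m j[%classic); first exact: measurable_itv.
  by apply/seteqP; split => t /=; rewrite in_itv.
exact: measurable_surplus_ge0.
Qed.

Lemma measurable_survive_prod :
  measurable [set z : T * measurableTypeR R | D z.2 z.1].
Proof.
rewrite (_ : [set z | _] =
  \bigcap_m [set z : T * measurableTypeR R | stay m z.2 z.1]); last first.
  by apply/seteqP; split => [[w s] /= h m _|[w s] h m]; [move=> j; exact: h|exact: h].
by apply: bigcapT_measurable => m; exact: measurable_stay_prod.
Qed.

Lemma measurable_stay m s : measurable (stay m s).
Proof.
rewrite (_ : stay m s = ysection [set z : T * measurableTypeR R | stay m z.2 z.1] s).
  by apply: measurable_ysection; exact: measurable_stay_prod.
by apply/seteqP; split => w; rewrite /ysection /= inE.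
Qed.

Lemma measurable_survive s : measurable (D s).
Proof.
by rewrite survive_bigcap; apply: bigcapT_measurable => m; exact: measurable_stay.
Qed.

Section laplace.
Context (a p : R) (a_gt0 : 0 < a) (p_gt0 : 0 < p).
Hypothesis L1 : (\int[P]_w (expR (- (a * J 1 w)))%:E = (expR p)%:E)%E.

Local Notation e := (fun t w => expR (- (a * W t w))).
Local Notation alive := (@alive_mass R d T P V J a).
Local Notation exit_m := (@exit_mass R d T P V J a).

Definition stay_mass m s : \bar R := (\int[P]_(w in stay m s) (e s w)%:E)%E.
Definition survive_mass s : \bar R := (\int[P]_(w in D s) (e s w)%:E)%E.

Lemma stay_mass_ge0 m s : (0 <= stay_mass m s)%E.
Proof. by apply: integral_ge0 => w _; rewrite lee_fin expR_ge0. Qed.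

Lemma survive_mass_ge0 s : (0 <= survive_mass s)%E.
Proof. by apply: integral_ge0 => w _; rewrite lee_fin expR_ge0. Qed.

Let section_mass (E : set (T * measurableTypeR R)) s :
  (\int[P]_(w in [set w | E (w, s)]) (e s w)%:E =
   \int[P]_w (e s w * \1_E (w, s))%:E)%E.
Proof.
rewrite integral_mkcond; apply: eq_integral => w _.
rewrite patchE indicE; have [Ew|nEw] := pselect (E (w, s)).
  by rewrite !mem_set//= mulr1.
by rewrite !memNset//= mulr0.
Qed.

Lemma measurable_weighted_indic (E : set (T * measurableTypeR R)) : measurable E ->
  measurable_fun setT (fun z : T * measurableTypeR R =>
    (expR (- (a * W z.2 z.1)) * \1_E z)%:E).
Proof.
move=> mE; apply/measurable_EFinP; apply: measurable_funM; last exact: measurable_indic.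
by apply: measurable_expRN; exact: measurable_surplus_prod.
Qed.

Let measurable_section_mass (E : set (T * measurableTypeR R)) : measurable E ->
  measurable_fun (setT : set (measurableTypeR R))
    (fun s => \int[P]_(w in [set w | E (w, s)]) (e s w)%:E)%E.
Proof.
move=> mE.
rewrite (_ : (fun s => _) =
  fubini_G P (fun z : T * measurableTypeR R => (e z.2 z.1 * \1_E z)%:E)).
  apply: measurable_fun_fubini_tonelli_G => //.
  exact: measurable_weighted_indic.
by apply/funext => s; rewrite section_mass.
Qed.

Lemma measurable_stay_mass m (B : set (measurableTypeR R)) :
  measurable_fun B (stay_mass m).
Proof.
apply: measurable_funTS.
exact: (measurable_section_mass (measurable_stay_prod m)).
Qed.

Lemma measurable_survive_mass (B : set (measurableTypeR R)) :
  measurable_fun B survive_mass.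
Proof.
apply: measurable_funTS.
exact: (measurable_section_mass measurable_survive_prod).
Qed.

Lemma stay_massE m k s : grid m k <= s -> s < grid m k.+1 ->
  (stay_mass m s = (expR (p * (s - grid m k)))%:E * alive m k)%E.
Proof.
move=> ks sk; rewrite /stay_mass (stayE ks sk).
exact: (integral_survive_grid J0 Jind Jsta VJ Jrc L1 ks).
Qed.

Lemma stay_mass_le m s : 0 <= s -> (stay_mass m s <= (expR p)%:E)%E.
Proof.
move=> s0; rewrite (stay_massE (grid_floor_le m s0) (lt_grid_floorS m s)).
rewrite -[leRHS]mule1; apply: lee_pmul.
- by rewrite lee_fin expR_ge0.
- exact: alive_mass_ge0.
- rewrite lee_fin ler_expR ler_piMr ?(ltW p_gt0)//.
  apply: le_trans (@grid_step_le1 R m).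
  rewrite lerBlDl -gridS; exact/ltW/lt_grid_floorS.
- exact: alive_mass_le1.
Qed.

(** Along a cell the mass grows as [expR (p * (s - grid m k))]; integrated over
    the cell and multiplied by [p], this is [expR (p * 2 ^- m) - 1], the
    factor in [discrete_martingale]. *)
Lemma integral_stay_mass m k :
  (p%:E * \int[mu]_(s in `[0%R, grid m k[) stay_mass m s =
   (expR (p * 2 ^- m) - 1)%:E * \sum_(i < k) alive m i)%E.
Proof.
elim: k => [|k IH].
  rewrite grid0 big_ord0 mule0 set_itv_ge ?integral_set0 ?mule0//.
  by rewrite bnd_simp ltxx.
have split_itv : `[0%R, grid m k.+1[%classic =
    `[0%R, grid m k[%classic `|` `[grid m k, grid m k.+1[%classic :> set R.
  by rewrite (@itv_bndbnd_setU _ _ _ (BLeft (grid m k))) ?bnd_simp ?grid_ge0// ler_grid.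
rewrite split_itv ge0_integral_setU//=; last 3 first.
- exact: measurable_stay_mass.
- by move=> s _; exact: stay_mass_ge0.
- apply/disj_setPS => s [/=]; rewrite !in_itv/= => /andP[_ sk] /andP[ks _].
  by have := lt_le_trans sk ks; rewrite ltxx.
rewrite ge0_muleDr; [|by apply: integral_ge0 => s _; exact: stay_mass_ge0..].
rewrite big_ord_recr/= IH [in RHS]ge0_muleDr; last 2 first.
- by apply: sume_ge0 => i _; exact: alive_mass_ge0.
- exact: alive_mass_ge0.
congr (_ + _)%E.
rewrite -ge0_integralZl//; last 3 first.
- exact: measurable_stay_mass.
- by move=> s _; exact: stay_mass_ge0.
- by rewrite lee_fin ltW.
rewrite (eq_integral (fun s : measurableTypeR R => alive m k * (p * expR (p * (s - grid m k)))%:E)%E);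
  last first.
  move=> s; rewrite inE/= in_itv/= => /andP[ks sk].
  by rewrite (stay_massE ks sk) muleA -EFinM muleC.
have mexp : measurable_fun (setT : set (measurableTypeR R))
    (fun s : R => (p * expR (p * (s - grid m k)))%:E).
  apply/measurable_EFinP; apply: measurable_funM => //.
  apply: measurableT_comp; first exact: measurable_expR.
  by apply: measurable_funM => //; apply: measurable_funB.
rewrite ge0_integralZl//; last 3 first.
- exact: measurable_funTS.
- by move=> s _; rewrite lee_fin mulr_ge0 ?expR_ge0// ltW.
- exact: alive_mass_ge0.
rewrite integral_itv_bndo_bndc; last exact: measurable_funTS.
rewrite integral_scaled_expR ?ltr_grid// muleC.
by rewrite gridS addrAC subrr add0r.
Qed.

Lemma sojourn_grid m k :
  (alive m 0 + p%:E * \int[mu]_(s in `[0%R, grid m k[) stay_mass m s =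
   alive m k + \sum_(i < k) exit_m m i)%E.
Proof. by rewrite integral_stay_mass; exact: discrete_martingale. Qed.

Let stay_mass_fin m s : 0 <= s -> (stay_mass m s < +oo)%E.
Proof. by move=> s0; apply: le_lt_trans (stay_mass_le m s0) _; rewrite ltry. Qed.

Lemma cvg_stay_mass s : 0 <= s -> stay_mass m s @[m --> \oo] --> survive_mass s.
Proof.
move=> s0; rewrite /survive_mass survive_bigcap.
apply: cvg_integral_decreasing.
- by move=> m; exact: measurable_stay.
- by move=> m; exact: staySm.
- exact: measurable_exp_surplus.
- by move=> w; rewrite expR_ge0.
- exact: stay_mass_fin.
Qed.

Lemma cvg_integral_stay_mass n :
  (\int[mu]_(s in `[0%R, n%:R[) stay_mass m s)%E @[m --> \oo] -->
  (\int[mu]_(s in `[0%R, n%:R[) survive_mass s)%E.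
Proof.
have mI : measurable (`[0%R, n%:R[%classic : set (measurableTypeR R)).
  exact: measurable_itv.
have [] := @dominated_convergence _ _ _ mu _ mI stay_mass survive_mass
  (fun=> (expR p)%:E) => //.
- by move=> m; exact: measurable_stay_mass.
- exact: measurable_survive_mass.
- by apply: aeW => s; rewrite /= in_itv/= => /andP[s0 _]; exact: cvg_stay_mass.
- apply/integrableP; split => //.
  rewrite integral_cst// lte_mul_pinfty ?lee_fin//.
  by rewrite /= lebesgue_measure_itv/=; case: ifP; rewrite ?ltry.
- apply: aeW => s m; rewrite /= in_itv/= => /andP[s0 _].
  by rewrite gee0_abs ?stay_mass_le//; exact: stay_mass_ge0.
Qed.

End laplace.
End sojourn.

(** * The sojourn identity in continuous time *)

Section green.
Context {R : realType} d (T : measurableType d) (P : probability T R).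
Context (V : {RV P >-> R}) (J : R -> {RV P >-> R}) (S X : R -> T -> R).
Hypothesis J0 : forall w, J 0 w = 0.
Hypothesis Jind : independent_increments J.
Hypothesis Jsta : stationary_increments J.
Hypothesis VJ : independent_systems P (sigma_RV V) (sigma_process J).
Hypothesis Jrc : forall w s, 0 <= s -> J u w @[u --> s^'+] --> J s w.
Hypothesis JSX : forall t w, 0 <= t -> J t w = S t w + X t w.
Hypothesis S_nd : forall w s t, 0 <= s -> s <= t -> S s w <= S t w.
Hypothesis X_cont : forall w, {within `[0, +oo[, continuous (X ^~ w)}.

Local Notation W := (surplus V J).
Local Notation D := (survive V J).
Local Notation mu := (@lebesgue_measure R).
Local Notation Vnneg := [set w | 0 <= V w].

Lemma measurable_Vnneg : measurable Vnneg.
Proof. by rewrite -(@survive_grid0 _ _ _ _ V J J0 0%N); exact: measurable_survive_grid. Qed.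

Section laplace.
Context (a p p2 : R) (a_gt0 : 0 < a) (p_gt0 : 0 < p) (p2_gt0 : 0 < p2).
Hypothesis L1 : (\int[P]_w (expR (- (a * J 1 w)))%:E = (expR p)%:E)%E.
Hypothesis L2 : (\int[P]_w (expR (- (2 * a * J 1 w)))%:E = (expR p2)%:E)%E.

Local Notation alive := (@alive_mass R d T P V J a).
Local Notation survive_mass := (@survive_mass R d T P V J a).
Local Notation stay_mass := (@stay_mass R d T P V J a).

Lemma measurable_exit_value b m k : measurable_fun setT (exit_value V J b m k).
Proof.
apply: measurable_sum => i; apply: measurable_funM; first exact: measurable_exp_surplus.
by apply: measurable_indic; apply: measurableD; exact: measurable_survive_grid.
Qed.

Lemma sum_exit_mass b m k :
  (\sum_(i < k) @exit_mass R d T P V J b m i =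
   \int[P]_w (exit_value V J b m k w)%:E)%E.
Proof.
have mcell i : measurable (exit_cell V J m i).
  by apply: measurableD; exact: measurable_survive_grid.
rewrite /exit_value; under eq_integral => w _ do rewrite -sumEFin.
rewrite ge0_integral_sum//; last first.
  move=> i; apply/measurable_EFinP; apply: measurable_funM.
    exact: measurable_exp_surplus.
  exact: measurable_indic.
apply: eq_bigr => i _; rewrite /exit_mass [LHS]integral_mkcond.
apply: eq_integral => w _; rewrite patchE indicE; case: ifP => _.
  by rewrite mulr1.
by rewrite mulr0.
Qed.

(** The exit values tend to the indicator of an exit before time [n]; their
    squares are the exit values for [2 * a], whose means are bounded by
    [sum_exit_le]. *)
Lemma cvg_sum_exit n :
  (\sum_(i < n * 2 ^ m) @exit_mass R d T P V J a m i)%E @[m --> \oo] -->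
  P (Vnneg `\` D n%:R).
Proof.
have mE : measurable (Vnneg `\` D n%:R).
  by apply: measurableD; [exact: measurable_Vnneg|exact: measurable_survive].
have -> : P (Vnneg `\` D n%:R) = (\int[P]_w (\1_(Vnneg `\` D n%:R) w)%:E)%E.
  by rewrite integral_indic// setIT.
under eq_fun do rewrite sum_exit_mass.
apply: (@cvg_integral_L2 _ _ _ P _ _ (1 + n%:R * (p2 * expR p2))).
- by move=> m; exact: measurable_exit_value.
- exact: measurable_indic.
- by move=> m w; exact: exit_value_ge0.
- by move=> w; rewrite indicE; case: (_ \in _); rewrite ?ler01 ?lexx.
- by move=> w; exact: (cvg_exit_value_indic J0 JSX S_nd X_cont).
- move=> m; under eq_integral => w _ do rewrite exit_value_sqr.
  rewrite -sum_exit_mass.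
  have a2_gt0 : 0 < 2 * a by rewrite mulr_gt0.
  apply: le_trans (sum_exit_le J0 Jind Jsta VJ Jrc a2_gt0 p2_gt0 L2 m _) _.
  have cancel_step (x y z : R) : y != 0 -> x * y * (z * y^-1) = x * z.
    by move=> y0; field.
  by rewrite lee_fin lerD2l natrM natrX cancel_step// gt_eqF// exprn_gt0.
Qed.

Definition initial_mass : \bar R := (\int[P]_(w in Vnneg) (expR (- (a * V w)))%:E)%E.

Lemma alive_mass0 m : alive m 0 = initial_mass.
Proof.
rewrite /alive_mass (survive_grid0 V J0); apply: eq_integral => w _.
by rewrite grid0 surplusE// J0 addr0.
Qed.

Lemma alive_mass_nat m n : alive m (n * 2 ^ m) = stay_mass m n%:R.
Proof.
by rewrite /alive_mass /stay_mass (@stayE _ _ _ _ V J m (n * 2 ^ m)) ?grid_nat// gridS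
  grid_nat ltrDl grid_step_gt0.
Qed.

(** The limit of [sojourn_grid] under refinement of the grid: in the limit the
    path leaves the half-line at 0, where the exponential is 1. *)
Lemma sojourn_identity n :
  (initial_mass + p%:E * \int[mu]_(s in `[0%R, n%:R[) survive_mass s =
   survive_mass n%:R + P (Vnneg `\` D n%:R))%E.
Proof.
have n0 : 0 <= n%:R :> R by [].
have cl := cvg_integral_stay_mass (n := n) J0 Jind Jsta VJ Jrc a_gt0 p_gt0 L1.
have cs := cvg_stay_mass J0 Jind Jsta VJ Jrc a_gt0 p_gt0 L1 n0.
have eq m : (initial_mass + p%:E * \int[mu]_(s in `[0%R, n%:R[) stay_mass m s =
    stay_mass m n%:R + \sum_(i < n * 2 ^ m) @exit_mass R d T P V J a m i)%E.
  rewrite -(alive_mass0 m) -alive_mass_nat -(grid_nat m n).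
  exact: (sojourn_grid J0 Jind Jsta VJ Jrc a_gt0 p_gt0 L1).
have init0 : (0 <= initial_mass)%E.
  by apply: integral_ge0 => w _; rewrite lee_fin expR_ge0.
have int0 : (0 <= \int[mu]_(s in `[0%R, n%:R[) survive_mass s)%E.
  by apply: integral_ge0 => s _; exact: survive_mass_ge0.
apply: cvge_eq_lim eq _ _.
- apply: cvgeD; last by apply: cvgeZl.
    by apply: ge0_adde_def; rewrite inE// mule_ge0 ?lee_fin// ltW.
  exact: cvg_cst.
- apply: cvgeD; last exact: cvg_sum_exit.
    by apply: ge0_adde_def; rewrite inE// survive_mass_ge0.
  exact: cs.
Qed.

Let cvg_survive s : 0 <= s -> stay_mass m s @[m --> \oo] --> survive_mass s.
Proof. exact: (cvg_stay_mass J0 Jind Jsta VJ Jrc a_gt0 p_gt0 L1). Qed.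

Let stay_mass_growth m s t : 0 <= s -> s <= t ->
  (stay_mass m t <= (expR (p * (t - s)))%:E * stay_mass m s)%E.
Proof.
move=> s0 st; pose k := grid_floor m s.
have ks : grid m k <= s by exact: grid_floor_le.
have sk : s < grid m k.+1 by exact: lt_grid_floorS.
rewrite (stay_massE J0 Jind Jsta VJ Jrc L1 ks sk) muleA -EFinM -expRD -mulrDr.
rewrite addrA subrK -(integral_survive_grid J0 Jind Jsta VJ Jrc L1 (le_trans ks st)).
apply: ge0_subset_integral.
- exact: measurable_stay.
- exact: measurable_survive_grid.
- apply/measurable_EFinP; exact: measurable_exp_surplus.
- by move=> w _; rewrite lee_fin expR_ge0.
- move=> w h j jk; apply: h; apply: le_trans st; apply: le_trans ks.
  by rewrite ler_grid.
Qed.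

Lemma survive_mass_growth s t : 0 <= s -> s <= t ->
  (survive_mass t <= (expR (p * (t - s)))%:E * survive_mass s)%E.
Proof.
move=> s0 st; have t0 := le_trans s0 st.
have ct := cvg_survive t0.
have cs : ((expR (p * (t - s)))%:E * stay_mass m s)%E @[m --> \oo] -->
    ((expR (p * (t - s)))%:E * survive_mass s)%E.
  by apply: cvgeZl => //; exact: cvg_survive.
rewrite -(cvg_lim _ ct)// -(cvg_lim _ cs)//; apply: lee_lim.
- by apply/cvg_ex; exists (survive_mass t).
- by apply/cvg_ex; eexists; exact: cs.
- by apply: nearW => m; exact: stay_mass_growth.
Qed.

Lemma survive_mass_nat_le1 n : (survive_mass n%:R <= 1)%E.
Proof.
apply: (@le_trans _ _ (alive 0 (n * 2 ^ 0))); last exact: alive_mass_le1.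
rewrite alive_mass_nat /stay_mass; apply: ge0_subset_integral.
- exact: measurable_survive.
- exact: measurable_stay.
- apply/measurable_EFinP; exact: measurable_exp_surplus.
- by move=> w _; rewrite lee_fin expR_ge0.
- by move=> w h j; exact: h.
Qed.

Let I_ n := (\int[mu]_(s in `[0%R, n%:R[) survive_mass s)%E.
Let Ioo := (\int[mu]_(s in `[0%R, +oo[) survive_mass s)%E.

Let I_ge0 n : (0 <= I_ n)%E.
Proof. by apply: integral_ge0 => s _; exact: survive_mass_ge0. Qed.

Let cvg_I : I_ n @[n --> \oo] --> Ioo.
Proof.
rewrite /I_ /Ioo.
rewrite (_ : `[0, +oo[%classic = \bigcup_n `[0, n%:R[%classic :> set (measurableTypeR R)); last first.
  apply/seteqP; split => [s|s [n _]]; rewrite /= !in_itv/=.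
    rewrite andbT => s0; exists (Num.truncn s).+1 => //=.
    by rewrite in_itv/= s0 truncnS_gt.
  by move=> /andP[-> _].
apply: ge0_nondecreasing_set_cvg_integral.
- move=> n m nm; apply/subsetPset => s /=; rewrite !in_itv/= => /andP[-> sn].
  by rewrite (lt_le_trans sn)// ler_nat.
- by move=> n; exact: measurable_itv.
- by move=> n; exact: measurable_survive_mass.
- by move=> n s _; exact: survive_mass_ge0.
Qed.

Let initial_mass_ge0 : (0 <= initial_mass)%E.
Proof. by apply: integral_ge0 => w _; rewrite lee_fin expR_ge0. Qed.

Let mVD n : measurable (Vnneg `\` D n%:R).
Proof. by apply: measurableD; [exact: measurable_Vnneg|exact: measurable_survive]. Qed.

Let I_le n : (p%:E * I_ n <= 2%:E)%E.
Proof.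
apply: (@le_trans _ _ (initial_mass + p%:E * I_ n)%E); first by rewrite leeDr.
rewrite sojourn_identity (_ : 2 = 1 + 1)// EFinD; apply: leeD.
  exact: survive_mass_nat_le1.
by apply: probability_le1; exact: mVD.
Qed.

Let Ioo_fin : Ioo \is a fin_num.
Proof.
rewrite ge0_fin_numE; last by apply: integral_ge0 => s _; exact: survive_mass_ge0.
have : (p%:E * Ioo <= 2%:E)%E.
  have c : (p%:E * I_ n)%E @[n --> \oo] --> (p%:E * Ioo)%E by exact: cvgeZl.
  rewrite -(cvg_lim _ c)//.
  apply: lime_le; first by apply/cvg_ex; eexists; exact: c.
  by apply: nearW => n; exact: I_le.
rewrite ltey => h; apply/eqP => Ieq; move: h.
by rewrite Ieq gt0_muley ?lte_fin.
Qed.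

Let I_fin n : I_ n \is a fin_num.
Proof.
rewrite ge0_fin_numE//; apply: (@le_lt_trans _ _ Ioo).
  apply: ge0_subset_integral => //.
  - exact: measurable_survive_mass.
  - by move=> s _; exact: survive_mass_ge0.
  - by move=> s /=; rewrite !in_itv/= => /andP[-> _].
by rewrite -ge0_fin_numE//; apply: integral_ge0 => s _; exact: survive_mass_ge0.
Qed.

Let I_step n : (survive_mass n.+1%:R <= (expR p)%:E * (I_ n.+1 - I_ n))%E.
Proof.
have nn1 : n%:R <= n.+1%:R :> R by rewrite ler_nat.
have split_itv : `[0%R, n.+1%:R[%classic =
    `[0%R, n%:R[%classic `|` `[n%:R, n.+1%:R[%classic :> set R.
  by rewrite (@itv_bndbnd_setU _ _ _ (BLeft n%:R)) ?bnd_simp.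
have -> : I_ n.+1 = (I_ n + \int[mu]_(s in `[n%:R, n.+1%:R[) survive_mass s)%E.
  rewrite /I_ split_itv ge0_integral_setU//=.
  - exact: measurable_survive_mass.
  - by move=> s _; exact: survive_mass_ge0.
  - apply/disj_setPS => s [/=]; rewrite !in_itv/= => /andP[_ sk] /andP[ks _].
    by have := lt_le_trans sk ks; rewrite ltxx.
rewrite [(I_ n + _)%E]addeC addeK//.
rewrite -ge0_integralZl//; last 2 first.
- exact: measurable_survive_mass.
- by move=> s _; exact: survive_mass_ge0.
apply: (@le_trans _ _ (\int[mu]_(s in `[n%:R, n.+1%:R[) survive_mass n.+1%:R)%E).
  rewrite integral_cst//= lebesgue_measure_itv/= lte_fin ltr_nat ltnSn -EFinB.
  by rewrite -natrB// subSnn mule1.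
apply: ge0_le_integral => //.
- by move=> s _; exact: survive_mass_ge0.
- by apply: measurable_funeM; exact: measurable_survive_mass.
- move=> s /=; rewrite in_itv/= => /andP[ns sn].
  apply: le_trans (survive_mass_growth (le_trans (ler0n _ n) ns) (ltW sn)) _.
  apply: lee_wpmul2r; first exact: survive_mass_ge0.
  rewrite lee_fin ler_expR ler_piMr ?(ltW p_gt0)//.
  by rewrite lerBlDr -natr1 addrC lerD2l.
Qed.

(** The mass at time [n + 1] is at most [expR p] times its integral over the
    preceding unit interval, and the integral over the half-line converges. *)
Let survive_mass_cvg0 : survive_mass n%:R @[n --> \oo] --> (0%R%:E : \bar R).
Proof.
have bounds : \forall n \near \oo, (0 <= survive_mass n.+1%:R <=
    (expR p)%:E * (I_ n.+1 - I_ n))%E.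
  by apply: nearW => n; rewrite survive_mass_ge0 I_step.
have shifted : survive_mass n.+1%:R @[n --> \oo] --> (0%R%:E : \bar R); last first.
  by rewrite -cvg_shiftS; exact: shifted.
apply: (squeeze_cvge bounds).
- exact: cvg_cst.
- rewrite -[X in _ --> X](mule0 (expR p)%:E); apply: cvgeZl => //.
  rewrite -[X in _ --> X](subee Ioo_fin); apply: cvgeB.
  + exact: fin_num_adde_defr.
  + by have := cvg_I; rewrite -cvg_shiftS.
  + exact: cvg_I.
Qed.

Lemma sojourn_identity_oo :
  (initial_mass + p%:E * \int[mu]_(s in `[0%R, +oo[) survive_mass s =
   P (Vnneg `\` \bigcap_n D n%:R))%E.
Proof.
rewrite -[RHS]add0e; apply: cvge_eq_lim sojourn_identity _ _.
- apply: cvgeD; [|exact: cvg_cst|by apply: cvgeZl => //; exact: cvg_I].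
  by apply: ge0_adde_def; rewrite inE// mule_ge0 ?lee_fin ?(ltW p_gt0)//;
    apply: integral_ge0 => s _; exact: survive_mass_ge0.
- apply: cvgeD; first exact: fin_num_adde_defr.
    exact: survive_mass_cvg0.
  rewrite (_ : Vnneg `\` _ = \bigcup_n (Vnneg `\` D n%:R)); last first.
    by rewrite setDE setC_bigcap setI_bigcupr.
  apply: nondecreasing_cvg_mu.
  + by move=> n; exact: mVD.
  + by apply: bigcupT_measurable => n; exact: mVD.
  + move=> n m nm; apply/subsetPset => w [V0 nD]; split => // Dm; apply: nD.
    by move=> i j ij; apply: Dm; apply: le_trans ij _; rewrite ler_nat.
Qed.

End laplace.

Hypothesis L : forall b, 0 < b ->
  exists2 q, 0 < q & (\int[P]_w (expR (- (b * J 1 w)))%:E = (expR q)%:E)%E.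

(** By [sojourn_identity_oo] the probability of an exit is at least
    [initial_mass a], which increases to [P Vnneg] as [a] decreases to 0. *)
Lemma exit_almost_surely : P (Vnneg `\` \bigcap_n D n%:R) = P Vnneg.
Proof.
have mVD : measurable (Vnneg `\` \bigcap_n D n%:R).
  apply: measurableD; first exact: measurable_Vnneg.
  by apply: bigcapT_measurable => n; exact: measurable_survive.
apply/eqP; rewrite eq_le; apply/andP; split.
  by apply: le_measure; rewrite ?inE//; exact: measurable_Vnneg.
have le n : (initial_mass n.+1%:R^-1 <= P (Vnneg `\` \bigcap_n D n%:R))%E.
  have b0 : 0 < n.+1%:R^-1 :> R by [].
  have b2 : 0 < 2 * n.+1%:R^-1 :> R by rewrite mulr_gt0.
  have [p p0 L1] := L b0; have [p2 p20 L2] := L b2.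
  rewrite -(sojourn_identity_oo b0 p0 p20 L1 L2) leeDl// mule_ge0//.
    by rewrite lee_fin ltW.
  by apply: integral_ge0 => s _; exact: survive_mass_ge0.
have c : initial_mass n.+1%:R^-1 @[n --> \oo] --> P Vnneg.
  have -> : P Vnneg = (\int[P]_(w in Vnneg) (1 : R)%:E)%E.
    by rewrite integral_cst ?mul1e//; exact: measurable_Vnneg.
  apply: cvg_integral_nondecreasing.
  - exact: measurable_Vnneg.
  - move=> n; apply/measurable_EFinP; apply: measurable_expRN.
    exact: measurable_funTS.
  - by move=> n w _; rewrite lee_fin expR_ge0.
  - move=> w /= V0 n m nm; rewrite lee_fin ler_expR lerN2 ler_wpM2r//.
    by rewrite lef_pV2 ?posrE// ler_nat.
  - move=> w _; apply: cvg_EFin; first exact: nearW.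
    have e1 : expR (- (n.+1%:R^-1 * V w)) @[n --> \oo] --> (1 : R).
      rewrite -[X in _ --> X]expR0; apply: cvg_expR.
      rewrite -oppr0 -[X in _ --> - X](mul0r (V w)); apply: cvgN.
      by apply: cvgM; [exact: cvg_harmonic|exact: cvg_cst].
    exact: e1.
rewrite -(cvg_lim _ c)//; apply: lime_le.
  by apply/cvg_ex; exists (P Vnneg).
exact: nearW.
Qed.

(** The identity of Kella and Whitt for the process killed at its first passage
    below 0.  The sign of [V] is not restricted, so that it can be applied to
    [V - eps]. *)
Lemma killed_laplace (a p : R) : 0 < a -> 0 < p ->
  (\int[P]_w (expR (- (a * J 1 w)))%:E = (expR p)%:E)%E ->
  (\int[P]_(w in Vnneg) (expR (- (a * V w)))%:E +
   p%:E * \int[mu]_(s in `[0%R, +oo[) \int[P]_(w in D s) (expR (- (a * W s w)))%:E =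
   P Vnneg)%E.
Proof.
move=> a0 p0 L1; have [|p2 p20 L2] := @L (2 * a); first by rewrite mulr_gt0.
by rewrite -exit_almost_surely -(sojourn_identity_oo a0 p0 p20 L1 L2).
Qed.

End green.

(** * Survival and the hitting time of zero *)

Lemma cvg_grid_floor (R : realType) (s : R) : 0 <= s ->
  grid m (grid_floor m s) @[m --> \oo] --> s.
Proof.
move=> s0; apply: (@squeeze_cvgr _ _ _ _ (fun m => s - 2 ^- m) (fun=> s)).
- apply: nearW => m; rewrite grid_floor_le// andbT lerBlDr -gridS.
  exact/ltW/lt_grid_floorS.
- rewrite -[X in _ --> X]subr0; apply: cvgB; first exact: cvg_cst.
  exact: cvg_grid_step.
- exact: cvg_cst.
Qed.

Section first_passage.
Context {R : realType} {T : Type} (V : T -> R) (J S X : R -> T -> R).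
Hypothesis J0 : forall w, J 0 w = 0.
Hypothesis Jrc : forall w (s : R), 0 <= s -> J u w @[u --> s^'+] --> J s w.
Hypothesis JSX : forall (t : R) w, 0 <= t -> J t w = S t w + X t w.
Hypothesis S_nd : forall w (s t : R), 0 <= s -> s <= t -> S s w <= S t w.
Hypothesis X_cont : forall w, {within `[0, +oo[, continuous (X ^~ w)}.

Local Notation W := (surplus V J).

(** The nondecreasing component can only jump upwards. *)
Lemma surplus_left_limit_ge0 (u : nat -> R) s w :
  (forall n, 0 <= u n <= s) -> u n @[n --> \oo] --> s ->
  (forall n, 0 <= W (u n) w) -> 0 <= W s w.
Proof.
move=> us cu Wu.
have u0 n : 0 <= u n by have /andP[] := us n.
have s0 : 0 <= s by have /andP[/le_trans] := us 0%N; apply.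
have cX : X s w - X (u n) w @[n --> \oo] --> (0 : R).
  rewrite -(subrr (X s w)); apply: cvgB; first exact: cvg_cst.
  exact: (within_continuous_seq (@X_cont w) u0 s0 cu).
rewrite -(cvg_lim _ cX)//; apply: limr_le; first by apply/cvg_ex; exists 0.
apply: nearW => n; have /andP[_ uns] := us n.
by have := surplus_incr_ge V JSX S_nd w (u0 n) uns; have := Wu n; lra.
Qed.

Lemma survive_ge0 s t w : 0 <= s -> s <= t -> survive V J t w -> 0 <= W s w.
Proof.
move=> s0 st Dt.
apply: (@surplus_left_limit_ge0 (fun m => grid m (grid_floor m s))).
- by move=> m; rewrite grid_ge0 grid_floor_le.
- exact: cvg_grid_floor.
- by move=> m; apply: Dt; apply: le_trans st; exact: grid_floor_le.
Qed.

Lemma surplus_right_cvg s w : 0 <= s -> W u w @[u --> s^'+] --> W s w.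
Proof.
move=> s0; have E : \forall u \near s^'+, V w + J u w = W u w.
  near=> u; rewrite surplusE//; apply: (le_trans s0); apply: ltW.
  by near: u; exact: nbhs_right_gt.
rewrite surplusE//.
apply: cvg_trans (_ : V w + J u w @[u --> s^'+] --> V w + J s w).
  exact: near_eq_cvg.
by apply: cvgD; [exact: cvg_cst|exact: Jrc].
Unshelve. all: by end_near. Qed.

End first_passage.

Section hitting.
Context {R : realType} {T : Type} (V : T -> R) (J S X : R -> T -> R).
Hypothesis J0 : forall w, J 0 w = 0.
Hypothesis Jrc : forall w (s : R), 0 <= s -> J u w @[u --> s^'+] --> J s w.
Hypothesis JSX : forall (t : R) w, 0 <= t -> J t w = S t w + X t w.
Hypothesis S_nd : forall w (s t : R), 0 <= s -> s <= t -> S s w <= S t w.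
Hypothesis X_cont : forall w, {within `[0, +oo[, continuous (X ^~ w)}.

Local Notation W := (surplus V J).
Local Notation tau := (hitting_time0 (fun t w => V w + J t w)).

(** Survival from the lower initial value keeps the surplus above [eps] up to
    [t], and right-continuity keeps it positive shortly after [t]. *)
Lemma survive_lt_hitting (eps t : R) w : 0 < eps -> 0 <= t ->
  survive (fun w => V w - eps) J t w -> (t%:E < tau w)%E.
Proof.
move=> e0 t0 Dt.
have We s : surplus (fun w => V w - eps) J s w = W s w - eps.
  by rewrite /surplus addrAC.
have W_ge s : 0 <= s -> s <= t -> eps <= W s w.
  move=> s0 st; rewrite -subr_ge0 -We.
  exact: (survive_ge0 JSX S_nd X_cont s0 st Dt).
have Wt : 0 < W t w by apply: lt_le_trans (W_ge t t0 (lexx t)).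
have := surplus_right_cvg (V := V) Jrc (w := w) t0.
move=> /cvgr_gt/(_ _ Wt) [e /= e1 he].
apply: (@lt_le_trans _ _ (t + e)%:E); first by rewrite lte_fin ltrDl.
apply: le_ereal_inf_tmp => _ [s [s0 Ws] <-]; rewrite lee_fin leNgt; apply/negP => ste.
have Ws0 : W s w = 0 by rewrite surplusE.
have [st|ts] := leP s t; first by have := W_ge s s0 st; rewrite Ws0 leNgt e0.
have := he s; rewrite /ball /= ltr0_norm ?subr_lt0// opprB ltrBlDl ste Ws0 ltxx.
by move=> /(_ isT ts).
Qed.

(** If the surplus were negative at a dyadic time [g <= t], it would vanish at
    the supremum [s0] of the times before [g] at which it is nonnegative:
    [W s0 >= 0] because there are no negative jumps, and [W s0 <= 0] by
    right-continuity. *)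
Lemma lt_hitting_survive (t : R) w : 0 < V w -> (t%:E < tau w)%E ->
  survive V J t w.
Proof.
move=> V0 ttau m j; set g := grid m j => gt; rewrite leNgt; apply/negP => Wg.
have g0 : 0 <= g by exact: grid_ge0.
pose E : set R := [set s | 0 <= s <= g /\ 0 <= W s w].
have E0 : E 0.
  by split; rewrite ?lexx// surplusE// J0 addr0 ltW.
have Eub : ubound E g by move=> s [/andP[]].
have supE : has_sup E by split; [exists 0|exists g].
pose s0 := sup E.
have s00 : 0 <= s0 by apply: ub_le_sup => //; exists g.
have s0g : s0 <= g by apply: ge_sup => //; exists 0.
have Ws0 : 0 <= W s0 w.
  have ex n : exists s, E s /\ s0 - n.+1%:R^-1 < s.
    have n0 : (0 : R) < n.+1%:R^-1 by [].
    by have [s Es] := sup_adherent n0 supE; exists s.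
  have [u hu] := choice ex.
  apply: (@surplus_left_limit_ge0 _ _ V J S X JSX S_nd X_cont u).
  - move=> n; have [[/andP[-> _] _] _] := hu n; apply: ub_le_sup.
      by exists g.
    by have [] := hu n.
  - apply: (@squeeze_cvgr _ _ _ _ (fun n => s0 - n.+1%:R^-1) (fun=> s0)).
    + apply: nearW => n; have [En sn] := hu n; rewrite (ltW sn)/=.
      by apply: ub_le_sup => //; exists g.
    + rewrite -[X in _ --> X]subr0; apply: cvgB; first exact: cvg_cst.
      exact: cvg_harmonic.
    + exact: cvg_cst.
  - by move=> n; have [[_ ->]] := hu n.
have s0_lt : s0 < g.
  rewrite lt_neqAle s0g andbT; apply/eqP => eg.
  by move: Wg; rewrite -eg ltNge Ws0.
have W_neg u : s0 < u -> u <= g -> W u w < 0.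
  move=> su ug; rewrite ltNge; apply/negP => Wu.
  have Eu : E u by split => //; rewrite (le_trans s00 (ltW su)).
  by have := ub_le_sup (ex_intro _ g Eub) Eu; rewrite leNgt su.
have Ws0_le : W s0 w <= 0.
  pose u n := s0 + (g - s0) * n.+1%:R^-1.
  have cu : u n @[n --> \oo] --> s0.
    rewrite -[X in _ --> X]addr0 -(mulr0 (g - s0)).
    apply: cvgD; first exact: cvg_cst.
    by apply: cvgM; [exact: cvg_cst|exact: cvg_harmonic].
  have u_gt n : s0 < u n by rewrite ltrDl mulr_gt0 ?subr_gt0.
  have u_le n : u n <= g.
    rewrite /u -lerBrDl ler_piMr ?subr_ge0//.
    by rewrite invf_le1// ler1n.
  have /cvg_at_rightP/(_ u (conj u_gt cu)) cW := surplus_right_cvg (V := V) Jrc (w := w) s00.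
  rewrite -(cvg_lim _ cW)//; apply: limr_le; first by apply/cvg_ex; exists (W s0 w).
  by apply: nearW => n; apply/ltW/W_neg.
have Wz : V w + J s0 w = 0.
  by rewrite -surplusE//; apply/eqP; rewrite eq_le Ws0_le.
have : (tau w <= s0%:E)%E by apply: ereal_inf_lbound; exists s0.
move=> /(lt_le_trans ttau); rewrite lte_fin => ts0.
by have := lt_le_trans ts0 (le_trans s0g gt); rewrite ltxx.
Qed.

End hitting.

(** * The occupation measure before the hitting time *)

Section occupation.
Context {R : realType} d (T : measurableType d) (P : probability T R).
Context (J : R -> {RV P >-> R}) (S X : R -> T -> R).
Hypothesis J0 : forall w, J 0 w = 0.
Hypothesis Jind : independent_increments J.
Hypothesis Jsta : stationary_increments J.
Hypothesis Jrc : forall w (s : R), 0 <= s -> J u w @[u --> s^'+] --> J s w.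
Hypothesis JSX : forall (t : R) w, 0 <= t -> J t w = S t w + X t w.
Hypothesis S_nd : forall w (s t : R), 0 <= s -> s <= t -> S s w <= S t w.
Hypothesis X_cont : forall w, {within `[0, +oo[, continuous (X ^~ w)}.
Hypothesis L : forall b : R, 0 < b ->
  exists2 q : R, 0 < q & (\int[P]_w (expR (- (b * J 1 w)))%:E = (expR q)%:E)%E.

Local Notation mu := (@lebesgue_measure R).

Definition survival_region (V : T -> R) : set (T * measurableTypeR R) :=
  [set z | 0 <= z.2 /\ survive V J z.2 z.1].

Section fixed_start.
Context (V : {RV P >-> R}).
Hypothesis VJ : independent_systems P (sigma_RV V) (sigma_process J).

Lemma measurable_survival_region : measurable (survival_region V).
Proof.
rewrite (_ : survival_region V =
  (setT `*` (`[0, +oo[%classic : set (measurableTypeR R))) `&`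
  [set z : T * measurableTypeR R | survive V J z.2 z.1]); last first.
  apply/seteqP; split => -[w s] /=; rewrite in_itv/= andbT; first by case.
  by move=> [[_ s0] Ds].
apply: measurableI; last exact: measurable_survive_prod.
by apply: measurableX => //; exact: measurable_itv.
Qed.

Lemma killed_occupation_laplace (c p : R) : 0 < c -> 0 < p ->
  (\int[P]_w (expR (- (c * J 1 w)))%:E = (expR p)%:E)%E ->
  (\int[P]_(w in [set w | (0 <= V w)%R]) (expR (- (c * V w)))%:E +
   p%:E * \int[P \x mu]_(z in survival_region V) (expR (- (c * surplus V J z.2 z.1)))%:E =
   P [set w | (0 <= V w)%R])%E.
Proof.
move=> c0 p0 L1.
rewrite -(killed_laplace J0 Jind Jsta VJ Jrc JSX S_nd X_cont L c0 p0 L1).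
congr (_ + _ * _)%E.
rewrite (@integral_prod_ysection _ _ _ P (survival_region V)
  (fun z => expR (- (c * surplus V J z.2 z.1))))//.
- apply: eq_integral => s; rewrite inE/= in_itv/= andbT => s0.
  congr integral; apply/seteqP; split => w /=; first by case.
  by split.
- exact: measurable_survival_region.
- by apply: measurable_expRN; exact: measurable_surplus_prod.
- by move=> z [].
Qed.

End fixed_start.

Section positive_start.
Context (V : {RV P >-> R}).
Hypothesis VJ : independent_systems P (sigma_RV V) (sigma_process J).
Hypothesis V_gt0 : {ae P, forall w, 0 < V w}.

(** Together with [survival_region V], this encloses the set of pairs [(w, t)]
    with [t] before the hitting time; unlike that set, both are visibly
    measurable. *)
Definition lower_region : set (T * measurableTypeR R) :=
  \bigcup_n survival_region (fun w => V w - n.+1%:R^-1).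

Let measurable_ray (b : bool) (x : R) :
  measurable (V @^-1` [set` Interval (BSide b x) +oo%O]).
Proof. exact: measurable_funPTI. Qed.

Let ge_set x : [set w | x <= V w] = V @^-1` `[x, +oo[.
Proof. by apply/seteqP; split => w /=; rewrite in_itv/= andbT. Qed.

Let gt_set x : [set w | x < V w] = V @^-1` `]x, +oo[.
Proof. by apply/seteqP; split => w /=; rewrite in_itv/= andbT. Qed.

Let mge x : measurable [set w | x <= V w]. Proof. by rewrite ge_set. Qed.
Let mgt x : measurable [set w | x < V w]. Proof. by rewrite gt_set. Qed.

Let P_le0 : P (~` [set w | 0 < V w]) = 0%E.
Proof.
have [N [mN PN0 HN]] := V_gt0.
apply/eqP; rewrite eq_le measure_ge0 andbT -PN0.
by apply: le_measure; rewrite ?inE//; exact: measurableC.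
Qed.

Let P_gt0 : P [set w | 0 < V w] = 1%E.
Proof.
have := probability_setC P (measurableC (mgt 0)).
by rewrite setCK P_le0 sube0.
Qed.

Let P_ge0 : P [set w | 0 <= V w] = 1%E.
Proof.
apply/eqP; rewrite eq_le probability_le1//= -P_gt0.
by apply: le_measure; rewrite ?inE// => w /= /ltW.
Qed.

Let mexpV c (B : set T) : measurable_fun B (fun w => (expR (- (c * V w)))%:E).
Proof.
by apply/measurable_EFinP; apply: measurable_expRN; exact: measurable_funTS.
Qed.

Let int_gt0 c : (\int[P]_(w in [set w | (0 < V w)%R]) (expR (- (c * V w)))%:E =
  \int[P]_w (expR (- (c * V w)))%:E)%E.
Proof.
rewrite -[in RHS](setUv [set w | 0 < V w]) ge0_integral_setU//.
- rewrite [X in (_ + X)%E](_ : _ = 0%E) ?adde0//.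
  by apply: null_set_integral => //; exact: measurableC.
- exact: measurableC.
- by rewrite disj_set2E setICr.
Qed.

Let int_ge0 c : (\int[P]_(w in [set w | (0 <= V w)%R]) (expR (- (c * V w)))%:E =
  \int[P]_w (expR (- (c * V w)))%:E)%E.
Proof.
apply/eqP; rewrite eq_le; apply/andP; split.
  by apply: ge0_subset_integral => // w _; rewrite lee_fin expR_ge0.
rewrite -int_gt0; apply: ge0_subset_integral => //.
by move=> w /= /ltW.
Qed.

Lemma upper_occupation_laplace (c p : R) : 0 < c -> 0 < p ->
  (\int[P]_w (expR (- (c * J 1 w)))%:E = (expR p)%:E)%E ->
  (\int[P]_w (expR (- (c * V w)))%:E +
   p%:E * \int[P \x mu]_(z in survival_region V) (expR (- (c * surplus V J z.2 z.1)))%:E =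
   1)%E.
Proof.
by move=> c0 p0 L1; rewrite -int_ge0 killed_occupation_laplace// P_ge0.
Qed.

(** [killed_occupation_laplace] for [V - eps], multiplied by
    [expR (- (c * eps))] to undo the shift of the surplus. *)
Let shifted_occupation_laplace (eps c p : R) : 0 < c -> 0 < p ->
  (\int[P]_w (expR (- (c * J 1 w)))%:E = (expR p)%:E)%E ->
  (\int[P]_(w in [set w | (eps <= V w)%R]) (expR (- (c * V w)))%:E +
   p%:E * \int[P \x mu]_(z in survival_region (fun w => (V w - eps)%R))
     (expR (- (c * surplus V J z.2 z.1)))%:E =
   (expR (- (c * eps)))%:E * P [set w | (eps <= V w)%R])%E.
Proof.
move=> c0 p0 L1.
have mV' : measurable_fun setT (fun w => V w - eps) by exact: measurable_funB.
pose V' : {RV P >-> R} := HB.pack (fun w => V w - eps)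
  (isMeasurableFun.Build _ _ _ _ _ mV').
have V'J : independent_systems P (sigma_RV V') (sigma_process J).
  move=> A B [C mC <-] sB; apply: VJ => //.
  exists ((fun x => x - eps) @^-1` C); last by [].
  by rewrite -[_ @^-1` _]setTI; apply: measurable_funB.
have E1 : [set w | 0 <= V' w] = [set w | eps <= V w].
  by apply/seteqP; split => w /=; rewrite subr_ge0.
have ce w : expR (- (c * V w)) = expR (- (c * eps)) * expR (- (c * V' w)).
  by rewrite -expRD; congr expR; rewrite /=; ring.
have cW z : expR (- (c * surplus V J z.2 z.1)) =
    expR (- (c * eps)) * expR (- (c * surplus V' J z.2 z.1)).
  by rewrite -expRD; congr expR; rewrite /surplus /=; ring.
under eq_integral => w _ do rewrite ce.
under [X in (_ + _ * X)%E]eq_integral => z _ do rewrite cW.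
rewrite ge0_integralZl_EFin_EFin; [|exact: mge|
  by apply: measurable_expRN; exact: measurable_funTS|
  by move=> w _; exact: expR_ge0|exact: expR_ge0].
rewrite ge0_integralZl_EFin_EFin; [|exact: (measurable_survival_region V')|
  by apply: measurable_expRN; apply: measurable_funTS;
     exact: (measurable_surplus_prod V' Jrc)|
  by move=> z _; exact: expR_ge0|exact: expR_ge0].
rewrite muleCA -ge0_muleDr; last 2 first.
- by apply: integral_ge0 => w _; rewrite lee_fin expR_ge0.
- by rewrite mule_ge0 ?lee_fin ?(ltW p0)//; apply: integral_ge0 => z _; rewrite lee_fin expR_ge0.
by rewrite -E1 (killed_occupation_laplace V'J c0 p0 L1).
Qed.

Lemma measurable_lower_region : measurable lower_region.
Proof.
apply: bigcupT_measurable => n.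
have mV' : measurable_fun setT (fun w => V w - n.+1%:R^-1) by exact: measurable_funB.
exact: (measurable_survival_region (HB.pack (fun w => V w - n.+1%:R^-1)
  (isMeasurableFun.Build _ _ _ _ _ mV') : {RV P >-> R})).
Qed.

Lemma lower_occupation_laplace (c p : R) : 0 < c -> 0 < p ->
  (\int[P]_w (expR (- (c * J 1 w)))%:E = (expR p)%:E)%E ->
  (\int[P]_w (expR (- (c * V w)))%:E +
   p%:E * \int[P \x mu]_(z in lower_region) (expR (- (c * surplus V J z.2 z.1)))%:E =
   1)%E.
Proof.
move=> c0 p0 L1.
have Vcup : [set w | 0 < V w] = \bigcup_n [set w | n.+1%:R^-1 <= V w].
  apply/seteqP; split => [w /= Vw|w [n _ /=]]; last by apply: lt_le_trans.
  exists (Num.truncn (V w)^-1) => //=.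
  rewrite invf_ple ?posrE//; exact/ltW/truncnS_gt.
have inv_le n m : (n <= m)%N -> m.+1%:R^-1 <= n.+1%:R^-1 :> R.
  by move=> nm; rewrite lef_pV2 ?posrE// ler_nat.
have V_nd : nondecreasing_seq (fun n => [set w | n.+1%:R^-1 <= V w] : set T).
  by move=> n m nm; apply/subsetPset => w /=; apply: le_trans; exact: inv_le.
apply: cvge_eq_lim (fun n => shifted_occupation_laplace n.+1%:R^-1 c0 p0 L1) _ _.
- apply: cvgeD; last apply: cvgeZl => //.
  + apply: ge0_adde_def; rewrite inE.
      by apply: integral_ge0 => w _; rewrite lee_fin expR_ge0.
    by rewrite mule_ge0 ?lee_fin ?(ltW p0)//; apply: integral_ge0 => z _; rewrite lee_fin expR_ge0.
  + rewrite -int_gt0 Vcup; exact: ge0_nondecreasing_set_cvg_integral.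
  + apply: ge0_nondecreasing_set_cvg_integral.
    * move=> n m nm; apply/subsetPset => -[w s] [/= s0 Ds]; split => //= i j ij.
      apply: le_trans (Ds i j ij) _.
      by rewrite /surplus lerD2r lerD2l lerN2 inv_le.
    * move=> n; have mV' : measurable_fun setT (fun w => V w - n.+1%:R^-1) by exact: measurable_funB.
      exact: (measurable_survival_region (HB.pack (fun w => V w - n.+1%:R^-1)
        (isMeasurableFun.Build _ _ _ _ _ mV') : {RV P >-> R})).
    * move=> n; apply/measurable_EFinP; apply: measurable_expRN.
      by apply: measurable_funTS; exact: measurable_surplus_prod.
    * by move=> n z _; rewrite lee_fin expR_ge0.
- rewrite -[X in _ --> X]mul1e; apply: cvgeM => //.
  + apply: cvg_EFin; first exact: nearW.
    have e1 : expR (- (c * n.+1%:R^-1)) @[n --> \oo] --> (1 : R).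
      rewrite -[X in _ --> X]expR0; apply: cvg_expR.
      rewrite -oppr0 -[X in _ --> - X](mulr0 c); apply: cvgN.
      by apply: cvgM; [exact: cvg_cst|exact: cvg_harmonic].
    exact: e1.
  + rewrite -P_gt0 Vcup; apply: nondecreasing_cvg_mu => //.
    exact: bigcupT_measurable.
Qed.

End positive_start.
End occupation.

(** * The exponent near the origin *)

Section laplace_exponent.
Context {R : realType} d (T : measurableType d) (P : probability T R).
Context (Y : {RV P >-> R}) (phi : R -> R) (rho : R).
Hypothesis EY : ('E_P[Y] = rho%:E)%E.
Hypothesis phiE : forall b : R, 0 <= b -> laplace_exponent P Y b = (phi b)%:E.

Lemma laplace_of_exponent b : 0 <= b ->
  (\int[P]_w (expR (- (b * Y w)))%:E = (expR (- phi b))%:E)%E.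
Proof.
move=> b0; have := phiE b0; rewrite /laplace_exponent /laplace_transform unlock.
set I := (\int[P]_w _)%E => h.
have I0 : (0 <= I)%E by apply: integral_ge0 => w _; rewrite lee_fin expR_ge0.
have : lne I = (- phi b)%:E by rewrite EFinN -h oppeK.
move=> /(congr1 (@expeR R)); rewrite lneK//.
by rewrite in_itv/= I0 leey.
Qed.

Let mY : measurable_fun setT (EFin \o Y).
Proof. exact/measurable_EFinP. Qed.

Let iY : P.-integrable setT (EFin \o Y).
Proof.
apply/integrableP; split => //.
rewrite (integral_fin_num_abs P measurableT (f := Y))//.
by move: EY; rewrite unlock => ->.
Qed.

Let IY : (\int[P]_w (Y w)%:E = rho%:E)%E.
Proof. by move: EY; rewrite unlock. Qed.

Let iexp b : 0 <= b -> P.-integrable setT (fun w => (expR (- (b * Y w)))%:E).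
Proof.
move=> b0; apply/integrableP; split; first exact: measurable_EFin_expRN.
under eq_integral => w _ do rewrite gee0_abs ?lee_fin ?expR_ge0//.
by rewrite laplace_of_exponent// ltry.
Qed.

(** Integrate [1 - b y <= expR (- b y)]. *)
Lemma laplace_exponent_lt0 b : rho < 0 -> 0 < b -> phi b < 0.
Proof.
move=> rho0 b0; rewrite -oppr_gt0 -expR_gt1 -lte_fin.
rewrite -(laplace_of_exponent (ltW b0)).
have i1 : P.-integrable setT (fun w => (- b)%:E * (Y w)%:E)%E by exact: integrableZl.
have i2 : P.-integrable setT (fun=> (1 : R)%:E) by exact: finite_measure_integrable_cst.
apply: (@lt_le_trans _ _ (\int[P]_w ((1 : R)%:E + (- b)%:E * (Y w)%:E))%E).
  rewrite integralD// integral_cst//= probability_setT mule1 integralZl// IY.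
  by rewrite -EFinM -EFinD lte_fin ltrDl mulNr -mulrN mulr_gt0 ?oppr_gt0.
apply: le_integral => //.
- exact: integrableD.
- exact: iexp (ltW b0).
- move=> w _; rewrite -EFinM -EFinD lee_fin mulNr.
  exact: expR_ge1Dx.
Qed.

Let expR_quotient (u x : R) : 0 < u ->
  - x <= (expR (- (u * x)) - 1) / u <= - x * expR (- (u * x)).
Proof.
move=> u0; have h1 := expR_ge1Dx (- (u * x)).
have h2 := expR_ge1Dx (u * x).
rewrite ler_pdivlMr// ler_pdivrMr//; apply/andP; split; first lra.
rewrite -(ler_pM2r (expR_gt0 (- (u * x)))) expRxMexpNx_1 in h2.
move: h2; rewrite mulrDl mul1r; lra.
Qed.

Let cvg_expR_quotient (u : nat -> R) x : (forall n, 0 < u n) ->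
  u n @[n --> \oo] --> 0 -> (expR (- (u n * x)) - 1) / u n @[n --> \oo] --> - x.
Proof.
move=> u0 cu.
apply: (@squeeze_cvgr _ _ _ _ (fun=> - x) (fun n => - x * expR (- (u n * x)))).
- by apply: nearW => n; exact: expR_quotient.
- exact: cvg_cst.
- rewrite -[X in _ --> X]mulr1; apply: cvgM; first exact: cvg_cst.
  rewrite -expR0; apply: cvg_expR; rewrite -oppr0; apply: cvgN.
  by rewrite -(mul0r x); apply: cvgM => //; exact: cvg_cst.
Qed.

(** For [u <= 1] the difference quotient at [y] is at most [`|y|] when
    [y >= 0] and at most [`|y| * expR (- y) <= expR (- 2 y)] when [y < 0];
    the second bound is integrable because all exponential moments of
    negative order are finite. *)
Let cvg_laplace_quotient (u : nat -> R) : (forall n, 0 < u n <= 1) ->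
  u n @[n --> \oo] --> 0 ->
  (expR (- phi (u n)) - 1) / u n @[n --> \oo] --> - rho.
Proof.
move=> u01 cu; have u0 n : 0 < u n by have /andP[] := u01 n.
pose q n w : R := (expR (- (u n * Y w)) - 1) / u n.
have Iq n : (\int[P]_w (q n w)%:E = ((expR (- phi (u n)) - 1) / u n)%:E)%E.
  rewrite /q; under eq_integral => w _ do rewrite mulrC EFinM EFinB.
  have i1 := iexp (ltW (u0 n)).
  have i2 : P.-integrable setT (fun=> (1 : R)%:E) by exact: finite_measure_integrable_cst.
  rewrite integralZl//; last exact: integrableB.
  rewrite integralB// (laplace_of_exponent (ltW (u0 n))).
  by rewrite integral_cst//= probability_setT mule1 -EFinB -EFinM mulrC.
have mq n : measurable_fun setT (q n).
  apply: measurable_funM => //; apply: measurable_funB => //.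
  exact: measurable_expRN.
have i2 : P.-integrable setT (fun w => `|(Y w)%:E| + (expR (- (2 * Y w)))%:E)%E.
  by apply: integrableD => //; [exact: integrable_abse|exact: iexp].
have [] := @dominated_convergence _ _ _ P setT measurableT (fun n w => (q n w)%:E)
  (fun w => (- Y w)%:E) (fun w => `|(Y w)%:E| + (expR (- (2 * Y w)))%:E)%E => //.
- by move=> n; exact/measurable_EFinP.
- by apply/measurable_EFinP; exact: measurableT_comp.
- apply: aeW => w _; apply: cvg_EFin; first exact: nearW.
  exact: cvg_expR_quotient.
- apply: aeW => w n _; rewrite -EFinD lee_fin.
  have /andP[] := expR_quotient (Y w) (u0 n); rewrite -/(q n w) => h1 h2.
  have /andP[_ un1] := u01 n.
  have [Y0|Y0] := leP 0 (Y w).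
    have e1 : expR (- (u n * Y w)) <= 1 by rewrite expR_le1 oppr_le0 mulr_ge0// ltW.
    have q0 : q n w <= 0.
      by rewrite /q pmulr_lle0 ?invr_gt0// subr_le0.
    rewrite ler0_norm// ger0_norm//; have := expR_ge0 (- (2 * Y w)); lra.
  have q0 : 0 <= q n w by apply: le_trans h1; rewrite oppr_ge0 ltW.
  rewrite ger0_norm//; apply: le_trans h2 _.
  apply: (@le_trans _ _ (expR (- Y w) * expR (- Y w))).
    apply: ler_pM; rewrite ?expR_ge0 ?oppr_ge0 ?(ltW Y0)//.
      by have := expR_ge1Dx (- Y w); lra.
    by rewrite ler_expR -mulrN ler_piMl// oppr_ge0 ltW.
  rewrite -expRD (_ : - Y w + - Y w = - (2 * Y w)); last by ring.
  by rewrite lerDr.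
move=> _ _ h.
have h2 : (fun n => ((expR (- phi (u n)) - 1) / u n)%:E) @ \oo --> (- rho)%:E.
  have -> : ((- rho)%:E = \int[P]_w (- Y w)%:E)%E.
    under eq_integral => w _ do rewrite EFinN -mulN1e.
    by rewrite (@integralZl _ _ _ P setT measurableT (EFin \o Y) iY (-1)) IY mulN1e.
  by rewrite (funext (fun n => esym (Iq n))).
by have /fine_cvgP[] := h2.
Qed.

Lemma exponent0 : phi 0 = 0.
Proof.
have := laplace_of_exponent (lexx 0).
under eq_integral => w _ do rewrite mul0r oppr0 expR0.
rewrite integral_cst//= probability_setT mule1 => -[] /esym h.
by apply/eqP; rewrite -oppr_eq0; apply/eqP/expR_inj; rewrite expR0.
Qed.

(** The slope of [expR (- phi u)] at 0 is [- rho]; the bounds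
    [(expR t - 1) * expR (- t) <= t <= expR t - 1] with [t = - phi u] turn it
    into the slope of [- phi]. *)
Lemma right_derivative_exponent : right_derivative_at0 phi = rho.
Proof.
rewrite /right_derivative_at0; apply/cvg_lim => //; apply/cvg_at_rightP => u0 [u0_gt cu0].
pose u n := Num.min (u0 n) 1.
have u01 n : 0 < u n <= 1 by rewrite lt_min u0_gt ltr01 ge_min lexx orbT.
have u_gt n : 0 < u n by have /andP[] := u01 n.
have uE : \forall n \near \oo, u n = u0 n.
  have lt1 : \forall n \near \oo, u0 n < 1 by exact: (cvgr_lt _ cu0).
  by apply: filterS lt1 => n un; apply/min_idPl/ltW.
have cu : u n @[n --> \oo] --> 0.
  by apply: cvg_trans cu0; apply: near_eq_cvg; apply: filterS uE => n ->.
have cq := cvg_laplace_quotient u01 cu.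
have cL : expR (phi (u n)) @[n --> \oo] --> (1 : R).
  have c1 : expR (- phi (u n)) @[n --> \oo] --> (1 : R).
    have -> : (fun n => expR (- phi (u n))) =
        (fun n => 1 + u n * ((expR (- phi (u n)) - 1) / u n)).
      by apply/funext => n; rewrite mulrC divfK ?gt_eqF// addrC subrK.
    rewrite -[X in _ --> X]addr0; apply: cvgD; first exact: cvg_cst.
    by rewrite -(mul0r (- rho)); exact: cvgM.
  have -> : (fun n => expR (phi (u n))) = (fun n => (expR (- phi (u n)))^-1).
    by apply/funext => n; rewrite expRN invrK.
  by rewrite -[X in _ --> X]invr1; apply: cvgV.
suff c2 : - phi (u n) / u n @[n --> \oo] --> - rho.
  have c3 : (u n)^-1 * (phi (u n) - phi 0) @[n --> \oo] --> rho.
    rewrite -[X in _ --> X]opprK.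
    have -> : (fun n => (u n)^-1 * (phi (u n) - phi 0)) = (fun n => - (- phi (u n) / u n)).
      by apply/funext => n; rewrite exponent0 subr0 mulNr opprK mulrC.
    exact: cvgN.
  apply: cvg_trans c3; apply: near_eq_cvg; apply: filterS uE => n /= ->.
  by [].
apply: (@squeeze_cvgr _ _ _ _
  (fun n => ((expR (- phi (u n)) - 1) / u n) * expR (phi (u n)))
  (fun n => (expR (- phi (u n)) - 1) / u n)).
- apply: nearW => n; apply/andP; split.
    rewrite mulrAC ler_pM2r ?invr_gt0// mulrBl mul1r -expRD addNr expR0.
    have := expR_ge1Dx (phi (u n)); lra.
  rewrite ler_pM2r ?invr_gt0//; have := expR_ge1Dx (- phi (u n)); lra.
- by rewrite -[X in _ --> X]mulr1; exact: cvgM.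
- exact: cq.
Qed.

End laplace_exponent.

(** * Mean of the excess variable as an integral over a region *)

Lemma independent_triple_pair {R : realType} d (T : measurableType d)
    (P : probability T R) (V U zeta : {RV P >-> R}) :
  independent_RVs P (fun i => tnth [tuple V; U; zeta] i) ->
  forall A B : set R, measurable A -> measurable B ->
  (P (zeta @^-1` A `&` U @^-1` B) = P (zeta @^-1` A) * P (U @^-1` B))%E.
Proof.
move=> ind A B mA mB.
pose C (i : 'I_3) := if i == 0 :> nat then setT else if i == 1%N :> nat then B else A.
have mC i : measurable (C i) by rewrite /C; case: ifP => // _; case: ifP.
have := ind C mC; rewrite !big_ord_recl big_ord0 /C /= !(tnth_nth V) /=.
rewrite preimage_setT probability_setT mul1e mule1 muleC => <-.
congr (P _); apply/seteqP; split => w /=.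
  by move=> [wA wB] [[|[|[|//]]] i3] _; rewrite !(tnth_nth V).
move=> h; split.
  by have := h (@Ordinal 3 2 isT) I; rewrite !(tnth_nth V).
by have := h (@Ordinal 3 1 isT) I; rewrite !(tnth_nth V).
Qed.

Section stationary_excess.
Context {R : realType} d (T : measurableType d) (P : probability T R).
Context (V U zeta : {RV P >-> R}) (k : R).
Hypothesis k_gt0 : 0 < k.
Local Notation mu := (@lebesgue_measure R).
Local Notation GV := (distribution P V).

Let Omega : set T := [set w | 0 <= zeta w /\ 0 <= U w].

Let mOmega : measurable Omega.
Proof.
have h (Z : {RV P >-> R}) : measurable [set w | 0 <= Z w].
  rewrite (_ : [set w | _] = Z @^-1` `[0, +oo[); first exact: measurable_funPTI.
  by apply/seteqP; split => w /=; rewrite in_itv/= andbT.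
by rewrite (_ : Omega = [set w | 0 <= zeta w] `&` [set w | 0 <= U w])//;
  exact: measurableI.
Qed.

(** The initial value is read on the first factor, and [zeta] and [U] on the
    second one, which makes them independent of it by construction. *)
Definition start_law : set (R * T) -> \bar R := (GV \x P)%E.

HB.instance Definition _ := Measure.on start_law.

Let start_lawT : start_law setT = 1%E.
Proof.
rewrite -setXTT [LHS]product_measure1E// -[RHS]mule1.
by rewrite -{1}(probability_setT GV) -(probability_setT P).
Qed.

HB.instance Definition _ :=
  Measure_isProbability.Build _ _ _ start_law start_lawT.

(** The factor [k * x] of the mean excess is turned into the length of the
    fibre over [x]; in this way the weighted mean of [h (zeta + x * U)] becomes
    the integral of [h] composed with a single function over a region, as
    Laplace uniqueness requires. *)
Definition excess_region : set ((R * T) * measurableTypeR R) :=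
  [set z | [/\ 0 <= z.1.1, Omega z.1.2 & 0 <= z.2 < k * z.1.1]].

Definition excess_value (z : (R * T) * measurableTypeR R) : R :=
  zeta z.1.2 + z.1.1 * U z.1.2.

Let measurable_value : measurable_fun setT (fun z : R * T => zeta z.2 + z.1 * U z.2).
Proof.
apply: measurable_funD; first exact: measurableT_comp.
by apply: measurable_funM; [exact: measurable_fst|exact: measurableT_comp].
Qed.

Lemma measurable_excess_value : measurable_fun setT excess_value.
Proof. exact: (measurableT_comp measurable_value). Qed.

Let start_set : set (R * T) := `[0, +oo[%classic `*` Omega.

Let mstart : measurable start_set.
Proof. exact: measurableX. Qed.

Lemma measurable_excess_region : measurable excess_region.
Proof.
rewrite (_ : excess_region = (start_set `*` `[0, +oo[%classic) `&`
   [set z : (R * T) * measurableTypeR R | z.2 < k * z.1.1]); last first.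
  apply/seteqP; split => -[[x w] y]; rewrite /start_set /= !in_itv/= !andbT.
    by move=> [? ? /andP[]].
  by move=> [[[? ?] ?] ?]; split => //; apply/andP; split.
apply: measurableI; first exact: measurableX.
rewrite (_ : [set z | _] =
   (fun z : (R * T) * measurableTypeR R => k * z.1.1 - z.2) @^-1` `]0, +oo[); last first.
  by apply/seteqP; split => -[x y] /=; rewrite in_itv/= andbT subr_gt0.
rewrite -[_ @^-1` _]setTI; apply: measurable_funB => //.
by apply: measurable_funM => //; exact: (measurableT_comp measurable_fst measurable_fst).
Qed.

Lemma excess_value_ge0 z : excess_region z -> 0 <= excess_value z.
Proof. by move=> [x0 [z0 u0] _]; rewrite addr_ge0 ?mulr_ge0. Qed.

Definition mean_excess (h : R -> R) (x : R) : \bar R :=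
  (\int[P]_(w in Omega) (h (zeta w + x * U w))%:E)%E.

Lemma measurable_mean_excess (h : R -> R) : measurable_fun setT h ->
  (forall y, 0 <= h y) -> measurable_fun (setT : set R) (mean_excess h).
Proof.
move=> mh h0.
pose F (z : R * T) := (h (zeta z.2 + z.1 * U z.2) * \1_Omega z.2)%:E.
have mF : measurable_fun setT F.
  apply/measurable_EFinP; apply: measurable_funM.
    exact: (measurableT_comp mh measurable_value).
  by apply: measurableT_comp => //; exact: measurable_indic.
have F0 z : (0 <= F z)%E by rewrite lee_fin mulr_ge0.
rewrite (_ : mean_excess h = fubini_F P F).
  exact: measurable_fun_fubini_tonelli_F.
apply/funext => x; rewrite /mean_excess /fubini_F [LHS]integral_mkcond.
apply: eq_integral => w _; rewrite patchE /F indicE.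
by case: ifP => _; rewrite ?mulr1 ?mulr0.
Qed.


Lemma integral_excess_region (h : R -> R) : measurable_fun setT h ->
  (forall y, 0 <= h y) ->
  (\int[start_law \x mu]_(z in excess_region) (h (excess_value z))%:E =
   \int[GV]_(x in `[0%R, +oo[) ((k * x)%:E * mean_excess h x))%E.
Proof.
move=> mh h0.
have hv0 z : 0 <= h (excess_value z) by [].
rewrite (@integral_prod_xsection _ _ _ start_law _ _ measurable_excess_region
  (measurableT_comp mh measurable_excess_value) hv0).
pose F (u : R * T) := (h (zeta u.2 + u.1 * U u.2) * (k * u.1) * \1_start_set u)%:E.
have -> : (\int[start_law]_u \int[mu]_(s in [set s | excess_region (u, s)])
    (h (excess_value (u, s)))%:E = \int[GV \x P]_u F u)%E.
  apply: eq_integral => -[x w] _; rewrite /F /excess_value /=.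
  have [[/= x0 Ow]|nS] := pselect (start_set (x, w)).
    move: x0; rewrite in_itv/= andbT => x0.
    rewrite indicE mem_set; last by split => //=; rewrite in_itv/= x0.
    rewrite (_ : [set s | _] = `[0, k * x[%classic); last first.
      by apply/seteqP; split => s /=; rewrite in_itv/=; [case|split].
    rewrite integral_cst//= lebesgue_measure_itv/= lte_fin mulr1 sube0.
    have [->|xn0] := eqVneq x 0; first by rewrite mulr0 ltxx mulr0 mule0.
    have xgt : 0 < x by rewrite lt_def xn0.
    by rewrite mulr_gt0.
  rewrite indicE memNset//= mulr0 (_ : [set s | _] = set0) ?integral_set0//.
  apply/seteqP; split => s //= [x0 Ow _]; apply: nS; split => //=.
  by rewrite in_itv/= x0.
have mF : measurable_fun setT F.
  apply/measurable_EFinP; apply: measurable_funM; last exact: measurable_indic.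
  apply: measurable_funM; first exact: (measurableT_comp mh measurable_value).
  by apply: measurable_funM => //; exact: measurable_fst.
have F0 z : (0 <= F z)%E.
  rewrite lee_fin /F indicE; have [|] := boolP (z \in start_set); last by rewrite mulr0.
  rewrite inE => -[/=]; rewrite in_itv/= andbT => z0 _.
  by rewrite mulr1 mulr_ge0// mulr_ge0// ltW.
rewrite (fubini_tonelli1 F mF F0) [RHS]integral_mkcond; apply: eq_integral => x _.
rewrite /fubini_F patchE; case: ifPn => [|/negP x0].
  rewrite inE/= in_itv/= andbT => x0.
  rewrite /mean_excess -ge0_integralZl//; last 3 first.
  - apply/measurable_EFinP; apply: measurableT_comp => //; apply: measurable_funTS.
    by apply: measurable_funD => //; exact: measurable_funM.
  - by move=> w _; rewrite lee_fin.
  - by rewrite lee_fin mulr_ge0// ltW.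
  rewrite [RHS]integral_mkcond; apply: eq_integral => w _.
  rewrite patchE /F indicE; have [Ow|nOw] := pselect (Omega w).
    rewrite !mem_set//=; last by split => //=; rewrite in_itv/= x0.
    by rewrite mulr1 mulrC EFinM.
  by rewrite !memNset ?mulr0//= => -[].
apply: integral0_eq => w _; rewrite /F indicE memNset ?mulr0// => -[/= h1 _].
by apply: x0; rewrite inE.
Qed.

Hypothesis V_gt0 : {ae P, forall w, 0 < V w}.
Hypothesis U_ge0 : {ae P, forall w, 0 <= U w}.
Hypothesis zeta_ge0 : {ae P, forall w, 0 <= zeta w}.
Hypothesis indep : independent_RVs P (fun i => tnth [tuple V; U; zeta] i).
Hypothesis U_uniform : forall A : set R, measurable A ->
  distribution P U A = uniform_prob (@ltr01 R) A.

Lemma null_excess_omitted : P (~` Omega) = 0%E.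
Proof.
apply: measure_negligible; first exact: measurableC.
apply: filterS2 zeta_ge0 U_ge0 => w zw Uw; exact: (conj zw Uw).
Qed.

Lemma uniform_laplace a : 0 <= a ->
  (a%:E * \int[P]_w (expR (- (a * U w)))%:E = (1 - expR (- a))%:E)%E.
Proof.
move=> a0; have mf : measurable_fun setT (fun y : R => (expR (- (a * y)))%:E).
  by apply: measurable_EFin_expRN.
have mU : measurable_fun setT (U : T -> measurableTypeR R).
  by move=> mT Y mY; exact: (measurable_funP U mT Y mY).
have -> : (\int[P]_w (expR (- (a * U w)))%:E =
    \int[uniform_prob (@ltr01 R)]_y (expR (- (a * y)))%:E)%E.
  rewrite -[LHS](@ge0_integral_pushforward _ _ _ _ _ _ mU P setT
    (fun y => (expR (- (a * y)))%:E))//.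
  by apply: eq_measure_integral => A mA _; exact: U_uniform.
rewrite integral_uniform// subr0 invr1 mul1e -ge0_integralZl//; last exact: measurable_funTS.
have h := @integral_scaled_expR R (- a) 0 1 (@ltr01 R).
rewrite -[LHS]oppeK -integral_ge0N; last by move=> y _; rewrite -EFinM lee_fin mulr_ge0// expR_ge0.
transitivity (- (expR (- a * (1 - 0)) - 1)%:E)%E; last first.
  by rewrite subr0 mulr1 -EFinN opprB.
rewrite -h; congr (- _)%E; apply: eq_integral => y _.
by rewrite -EFinM -EFinN subr0 mulNr mulNr.
Qed.

Lemma mean_excess_full (h : R -> R) x : measurable_fun setT h ->
  (forall y, 0 <= h y) ->
  mean_excess h x = (\int[P]_w (h (zeta w + x * U w))%:E)%E.
Proof.
move=> mh h0.
rewrite [RHS](ge0_negligible_integral (measurableC mOmega))//; last 3 first.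
- apply/measurable_EFinP; apply: measurableT_comp => //.
  by apply: measurable_funD => //; exact: measurable_funM.
- by move=> w _; rewrite lee_fin.
- exact: null_excess_omitted.
by rewrite /mean_excess setTD setCK.
Qed.

Lemma mean_excess_laplace c x : 0 < c -> 0 <= x ->
  ((c * x)%:E * mean_excess (fun y => expR (- (c * y))) x =
   \int[P]_w (expR (- (c * zeta w)))%:E * (1 - expR (- (c * x)))%:E)%E.
Proof.
move=> c0 x0.
rewrite mean_excess_full; last 2 first.
- exact: measurable_expRN.
- by move=> y; exact: expR_ge0.
have E w : (expR (- (c * (zeta w + x * U w))))%:E =
    ((expR (- (c * zeta w)))%:E * (expR (- (c * x * U w)))%:E)%E.
  by rewrite -EFinM -expRD mulrDr opprD mulrA.
under eq_integral => w _ do rewrite E.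
rewrite (@integral_indepM _ _ _ P zeta U (fun y => (expR (- (c * y)))%:E)
  (fun y => (expR (- (c * x * y)))%:E)).
- by rewrite muleCA uniform_laplace// mulr_ge0// ltW.
- by [].
- by [].
- exact: independent_triple_pair indep.
- exact: measurable_EFin_expRN.
- exact: measurable_EFin_expRN.
- by move=> y; rewrite lee_fin expR_ge0.
- by move=> y; rewrite lee_fin expR_ge0.
Qed.

(** Since [c x E expR (- c x U) = 1 - expR (- c x)], the transform of [zeta]
    cancels the constants and leaves [1 - E expR (- c V)] for the second
    term. *)
Lemma excess_laplace c p : 0 < c -> 0 < p ->
  (\int[P]_w (expR (- (c * zeta w)))%:E = (c / (k * p))%:E)%E ->
  (\int[P]_w (expR (- (c * V w)))%:E +
   p%:E * \int[start_law \x mu]_(z in excess_region)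
     (expR (- (c * excess_value z)))%:E = 1)%E.
Proof.
move=> c0 p0 L.
have mh : measurable_fun setT (fun y : R => expR (- (c * y))) by exact: measurable_expRN.
have GV0 : GV (~` `[0%R, +oo[) = 0%E.
  apply: measure_negligible; first exact: measurableC.
  have : P (~` [set w | 0 <= V w]) = 0%E.
    apply: measure_negligible.
      apply: measurableC.
      rewrite (_ : [set w | _] = V @^-1` `[0, +oo[); first exact: measurable_funPTI.
      by apply/seteqP; split => w /=; rewrite in_itv/= andbT.
    by apply: filterS V_gt0 => w; exact: ltW.
  move=> PV; apply/negligibleP; first exact: measurableC.
  rewrite -PV; congr (P _); apply/seteqP; split => w /=; by rewrite in_itv/= andbT.
rewrite -(@ge0_integral_distribution _ _ _ _ _ P V (fun y => (expR (- (c * y)))%:E)); last 2 first.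
- exact/measurable_EFinP.
- by move=> y; rewrite lee_fin expR_ge0.
rewrite (ge0_negligible_integral (measurableC (measurable_itv `[0%R, +oo[)) measurableT)//;
  do ?[exact/measurable_EFinP | by move=> y _; rewrite lee_fin expR_ge0].
rewrite setTD setCK (@integral_excess_region (fun y => expR (- (c * y))))//.
have M0 x : (0 <= mean_excess (fun y => expR (- (c * y))) x)%E.
  by apply: integral_ge0 => w _; rewrite lee_fin expR_ge0.
have mM : measurable_fun (`[0, +oo[ : set R) (fun x =>
    ((k * x)%:E * mean_excess (fun y => expR (- (c * y))) x)%E).
  apply: emeasurable_funM; first by apply/measurable_EFinP; exact: measurable_funM.
  by apply: measurable_funTS; apply: measurable_mean_excess => // y; exact: expR_ge0.
have kM0 x : [set` `[0%R, +oo[] x ->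
    (0 <= (k * x)%:E * mean_excess (fun y => expR (- (c * y))) x)%E.
  rewrite /= in_itv/= andbT => x0; rewrite mule_ge0// lee_fin mulr_ge0//.
  exact: ltW.
have p0' : (0 <= p%:E)%E by rewrite lee_fin ltW.
rewrite -ge0_integralZl//.
rewrite [X in (_ + X)%E](eq_integral (fun x => (1 - expR (- (c * x)))%:E)); last first.
  move=> x; rewrite inE/= in_itv/= andbT => x0.
  have kp0 : k * p != 0 by rewrite mulf_neq0// gt_eqF.
  rewrite muleA -EFinM (_ : p * (k * x) = k * p / c * (c * x)); last first.
    by field; rewrite gt_eqF.
  rewrite EFinM -muleA mean_excess_laplace// L -!EFinM; congr EFin.
  by field; rewrite !gt_eqF.
have e1 x : [set` `[0%R, +oo[] x -> (0 <= (1 - expR (- (c * x)))%:E)%E.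
  rewrite /= in_itv/= andbT => x0; rewrite lee_fin subr_ge0 expR_le1 oppr_le0.
  by rewrite mulr_ge0// ltW.
have me : measurable_fun (`[0, +oo[ : set R) (fun x => expR (- (c * x))).
  exact: measurable_funTS.
have m1e : measurable_fun (`[0, +oo[ : set R) (fun x => (1 - expR (- (c * x)))%:E).
  by apply/measurable_EFinP; exact: measurable_funB.
rewrite -ge0_integralD//; last exact/measurable_EFinP.
under eq_integral => x _ do rewrite -EFinD addrC subrK.
rewrite integral_cst//= mul1e.
have := probability_setC GV (measurableC (measurable_itv `[0%R, +oo[)).
by rewrite setCK [X in (_ - X)%E]GV0 sube0.
Qed.

End stationary_excess.

(** * The mean area *)

Section mean_area.
Context {R : realType} d (T : measurableType d) (P : probability T R).
Context (J : R -> {RV P >-> R}) (S X : R -> T -> R).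
Hypothesis J0 : forall w, J 0 w = 0.
Hypothesis Jind : independent_increments J.
Hypothesis Jsta : stationary_increments J.
Hypothesis Jrc : forall w (s : R), 0 <= s -> J u w @[u --> s^'+] --> J s w.
Hypothesis JSX : forall (t : R) w, 0 <= t -> J t w = S t w + X t w.
Hypothesis S_nd : forall w (s t : R), 0 <= s -> s <= t -> S s w <= S t w.
Hypothesis X_cont : forall w, {within `[0, +oo[, continuous (X ^~ w)}.
Context (phi : R -> R) (rho : R).
Hypothesis phiE : forall b, 0 <= b -> laplace_exponent P (J 1) b = (phi b)%:E.
Hypothesis EJ : ('E_P[J 1] = rho%:E)%E.
Hypothesis rho_lt0 : rho < 0.
Context (V U zeta : {RV P >-> R}).
Hypothesis V_gt0 : {ae P, forall w, 0 < V w}.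
Hypothesis V_J : independent_systems P (sigma_RV V) (sigma_process J).
Hypothesis U_ge0 : {ae P, forall w, 0 <= U w}.
Hypothesis zeta_ge0 : {ae P, forall w, 0 <= zeta w}.
Hypothesis indep : independent_RVs P (fun i => tnth [tuple V; U; zeta] i).
Hypothesis U_uniform : forall A : set R, measurable A ->
  distribution P U A = uniform_prob (@ltr01 R) A.
Hypothesis zeta_psi : forall b : R, 0 < b ->
  (\int[P]_w (expR (- (b * zeta w)))%:E = (b * rho / phi b)%:E)%E.

Local Notation mu := (@lebesgue_measure R).
Local Notation GV := (distribution P V).
Local Notation k := (- rho^-1).
Local Notation W z := (surplus V J z.2 z.1).
Local Notation tau := (hitting_time0 (fun t w => V w + J t w)).

Let k_gt0 : 0 < k. Proof. by rewrite oppr_gt0 invr_lt0. Qed.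

Let phi_lt0 b : 0 < b -> phi b < 0. Proof. exact: laplace_exponent_lt0 EJ phiE _ rho_lt0. Qed.

Let L1 b : 0 < b -> (\int[P]_w (expR (- (b * J 1 w)))%:E = (expR (- phi b))%:E)%E.
Proof. by move=> b0; exact: laplace_of_exponent phiE _ (ltW b0). Qed.

Let L b : 0 < b ->
  exists2 q, 0 < q & (\int[P]_w (expR (- (b * J 1 w)))%:E = (expR q)%:E)%E.
Proof. by move=> b0; exists (- phi b); rewrite ?oppr_gt0 ?phi_lt0 ?L1. Qed.

Let mW : measurable_fun setT (fun z : T * measurableTypeR R => W z).
Proof. exact: measurable_surplus_prod. Qed.

(** The Laplace transforms of the two measures satisfy the same equation with
    the same finite term [E expR (- c V)] and the same positive factor
    [- phi c], so they agree. *)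
Lemma integral_occupation (E : set (T * measurableTypeR R)) (h : R -> R) :
  measurable E -> (forall z, E z -> 0 <= W z) ->
  (forall c p, 0 < c -> 0 < p ->
    (\int[P]_w (expR (- (c * J 1 w)))%:E = (expR p)%:E)%E ->
    (\int[P]_w (expR (- (c * V w)))%:E +
     p%:E * \int[P \x mu]_(z in E) (expR (- (c * W z)))%:E = 1)%E) ->
  measurable_fun setT h -> (forall y, 0 <= h y) ->
  (\int[P \x mu]_(z in E) (h (W z))%:E =
   \int[GV]_(x in `[0%R, +oo[) ((k * x)%:E * mean_excess U zeta h x))%E.
Proof.
move=> mE E0 occ mh h0.
rewrite -(integral_excess_region V U zeta k_gt0 mh h0).
have key c : 0 < c ->
    (\int[P \x mu]_(z in E) (expR (- (c * W z)))%:E < +oo)%E /\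
    (\int[P \x mu]_(z in E) (expR (- (c * W z)))%:E =
     \int[start_law V \x mu]_(z in excess_region U zeta k)
       (expR (- (c * excess_value U zeta z)))%:E)%E.
  move=> c0; have p0 : 0 < - phi c by rewrite oppr_gt0 phi_lt0.
  have o1 := occ _ _ c0 p0 (L1 c0).
  have o2 : (\int[P]_w (expR (- (c * V w)))%:E + (- phi c)%:E *
      \int[start_law V \x mu]_(z in excess_region U zeta k)
       (expR (- (c * excess_value U zeta z)))%:E = 1)%E.
    apply: excess_laplace => //.
    rewrite zeta_psi//; congr EFin; field.
    by rewrite !lt_eqF// phi_lt0.
  have e0 (x : R) : (0 <= (expR x)%:E)%E by rewrite lee_fin expR_ge0.
  by apply: adde_pmule_inj p0 _ _ _ o1 o2; exact: integral_ge0.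
apply: (@eq_integral_laplace _ _ _ _ _ _ _ E (excess_region U zeta k)
  (fun z => W z) (excess_value U zeta) _ _ _ _ _ _ _ _ (fun y => (h y)%:E)) => //.
- exact: measurable_excess_region.
- exact: measurable_excess_value.
- by move=> z; exact: excess_value_ge0.
- by move=> c /key[].
- by move=> c /key[].
- exact/measurable_EFinP.
Qed.

Context (f : R -> R).
Hypothesis f_meas : measurable_fun (`[0, +oo[ : set R) f.
Hypothesis f_ge0 : forall x, 0 <= x -> 0 <= f x.

Let h : R -> R := f \_ `[0, +oo[.

Let mh : measurable_fun setT h.
Proof. by apply/(measurable_restrictT _ _).1. Qed.

Let hE x : 0 <= x -> h x = f x.
Proof. by move=> x0; rewrite /h patchE mem_set//= in_itv/= x0. Qed.

Let h0 x : 0 <= h x.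
Proof.
have [x0|x0] := leP 0 x; first by rewrite hE// f_ge0.
by rewrite /h patchE memNset//= in_itv/= andbT leNgt x0.
Qed.

Let mean_excessE x : 0 <= x ->
  ('E_P[fun w => (f (zeta w + x * U w))%R] = mean_excess U zeta h x)%E.
Proof.
move=> x0; rewrite (mean_excess_full U_ge0 zeta_ge0 x mh h0) unlock.
have mOmega : measurable [set w | 0 <= zeta w /\ 0 <= U w].
  rewrite (_ : [set w | _] = zeta @^-1` `[0, +oo[ `&` U @^-1` `[0, +oo[).
    by apply: measurableI; exact: measurable_funPTI.
  by apply/seteqP; split => w /=; rewrite !in_itv/= !andbT.
have mhx : measurable_fun setT (fun w => (h (zeta w + x * U w))%:E).
  apply/measurable_EFinP; apply: measurableT_comp => //.
  by apply: measurable_funD => //; exact: measurable_funM.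
apply: (integral_squeeze_ae (N := ~` [set w | 0 <= zeta w /\ 0 <= U w])
  (lo := fun w => (h (zeta w + x * U w))%:E)) => //.
- exact: measurableC.
- exact: null_excess_omitted.
- by move=> w; rewrite lee_fin.
- by move=> w; rewrite lee_fin.
- move=> w /contrapT[z0 u0]; rewrite hE ?lexx//.
  by rewrite addr_ge0// mulr_ge0.
Qed.

(** For [V w > 0], the integral along the path is between the integrals of
    [h], the extension of [f] by 0, over the sections of the lower region and
    of the survival region, and these two have the same mean. *)
Lemma mean_area_to_hitting :
  (\int[P]_w integral_to_hitting f (fun t w' => V w' + J t w')%R w =
   k%:E * \int[GV]_(x in `[0%R, +oo[)
     (x%:E * 'E_P[fun w => (f (zeta w + x * U w))%R]))%E.
Proof.
have mup := measurable_survival_region J V.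
have mlo := measurable_lower_region J V.
have mhW : measurable_fun setT (fun z : T * measurableTypeR R => h (W z)).
  exact: measurableT_comp.
have hW0 (z : T * measurableTypeR R) : 0 <= h (W z) by [].
have Eup := integral_occupation mup _
  (upper_occupation_laplace J0 Jind Jsta Jrc JSX S_nd X_cont L V_J V_gt0) mh h0.
have Elo := integral_occupation mlo _
  (lower_occupation_laplace J0 Jind Jsta Jrc JSX S_nd X_cont L V_J V_gt0) mh h0.
have up_ge0 z : survival_region J V z -> 0 <= W z.
  by move=> [z0 D]; exact: (survive_ge0 JSX S_nd X_cont z0 (lexx _) D).
have lo_up z : lower_region J V z -> survival_region J V z.
  move=> [n _ [z0 D]]; split => // m j jz; apply: le_trans (D m j jz) _.
  by rewrite /surplus lerD2r gerBl.
have {}Eup := Eup up_ge0.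
have {}Elo := Elo (fun z lz => up_ge0 z (lo_up z lz)).
pose occ (E : set (T * measurableTypeR R)) w :=
  (\int[mu]_(s in [set s | E (w, s)]) (h (W (w, s)))%:E)%E.
transitivity (\int[P]_w occ (survival_region J V) w)%E; last first.
  rewrite -(integral_prod_xsection P mup mhW hW0) Eup.
  have M0 x : (0 <= mean_excess U zeta h x)%E.
    by apply: integral_ge0 => w _; rewrite lee_fin.
  have -> : (\int[GV]_(x in `[0%R, +oo[) (x%:E * 'E_P[fun w => (f (zeta w + x * U w))%R]) =
      \int[GV]_(x in `[0%R, +oo[) (x%:E * mean_excess U zeta h x))%E.
    by apply: eq_integral => x; rewrite inE/= in_itv/= andbT => /mean_excessE ->.
  rewrite -ge0_integralZl//; last 3 first.
  - apply: emeasurable_funM; first by apply/measurable_EFinP.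
    by apply: measurable_funTS; exact: measurable_mean_excess.
  - by move=> x /=; rewrite in_itv/= andbT => x0; rewrite mule_ge0.
  - by rewrite lee_fin ltW.
  by apply: eq_integral => x _; rewrite muleA EFinM.
apply: (integral_squeeze_ae (N := [set w | V w <= 0]) (lo := occ (lower_region J V))).
- rewrite (_ : [set w | _] = V @^-1` `]-oo, 0]); first exact: measurable_funPTI.
  by apply/seteqP; split => w /=; rewrite in_itv.
- apply: measure_negligible.
    rewrite (_ : [set w | _] = V @^-1` `]-oo, 0]); first exact: measurable_funPTI.
    by apply/seteqP; split => w /=; rewrite in_itv.
  by apply: negligibleS V_gt0 => w /=; rewrite leNgt => /negP.
- exact: (measurable_integral_xsection mlo mhW hW0).
- exact: (measurable_integral_xsection mup mhW hW0).
- by move=> w; apply: integral_ge0 => s _; rewrite lee_fin.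
- by move=> w; apply: integral_ge0 => s _; rewrite lee_fin.
- move=> w /negP; rewrite -ltNge => Vw.
  have sameW s : [set t : R | 0 <= t /\ (t%:E < tau w)%E] s ->
      survival_region J V (w, s) /\ h (W (w, s)) = f (V w + J s w).
    move=> [s0 st]; have D := lt_hitting_survive J0 Jrc JSX S_nd X_cont Vw st.
    split; first by split.
    have W0 := up_ge0 (w, s) (conj s0 D).
    by rewrite hE//= surplusE.
  have lo_tau s : lower_region J V (w, s) -> 0 <= s /\ (s%:E < tau w)%E.
    move=> [n _ [/= s0 D]]; split => //.
    have n0 : (0 : R) < n.+1%:R^-1 by [].
    exact: (survive_lt_hitting Jrc JSX S_nd X_cont n0 s0 D).
  rewrite /integral_to_hitting /occ; apply/andP; split.
    rewrite [leLHS]integral_mkcond [leRHS]integral_mkcond.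
    apply: ge0_le_integral_any => s; rewrite !patchE.
      by case: ifP => // _; rewrite lee_fin.
    case: ifPn => [|_]; last first.
      case: ifPn => // /[!inE] /sameW[D <-]; by rewrite lee_fin.
    rewrite inE => /= /lo_tau sw; rewrite mem_set//.
    by have [_ ->] := sameW _ sw.
  rewrite [leLHS]integral_mkcond [leRHS]integral_mkcond.
  apply: ge0_le_integral_any => s; rewrite !patchE.
    by case: ifPn => // /[!inE] /sameW[_ <-]; rewrite lee_fin.
  case: ifPn => [|_]; last by case: ifP => // _; rewrite lee_fin.
  by rewrite inE => /sameW[D ->]; rewrite mem_set.
- have := integral_prod_xsection P mlo mhW hW0; rewrite Elo => <-.
  by have := integral_prod_xsection P mup mhW hW0; rewrite Eup => <-.
Qed.

End mean_area.

Lemma drifted_brownian_continuous (R : realType) (d : measure_display)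
    (T : measurableType d) (P : probability T R) (m sigma : R)
    (X : R -> {RV P >-> R}) : drifted_brownian_motion m sigma X ->
  forall w, {within `[0, +oo[, continuous (fun t => X t w)}.
Proof.
have cZ (a : R) : {within `[0, +oo[, continuous (fun t : R => a * t)}.
  by apply: continuous_subspaceT => t; apply: continuousM => //; exact: cst_continuous.
rewrite /drifted_brownian_motion; case: ifP => _.
  move=> XE w; apply: (@subspace_eq_continuous _ _ _ (fun t => m * t)
    (fun t => X t w)) (cZ m).
  by move=> t; rewrite inE/= in_itv/= andbT => t0; rewrite XE.
move=> [B [_ _ cB] XE] w.
apply: (@subspace_eq_continuous _ _ _ (fun t => m * t + sigma * B t w)
  (fun t => X t w)).
  by move=> t; rewrite inE/= in_itv/= andbT => t0; rewrite XE.
move=> t; apply: continuousD; first exact: cZ.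
by apply: continuousM; [exact: cst_continuous|exact: cB].
Qed.

Theorem theorem1 (R : realType) (d : measure_display) (T : measurableType d)
  (P : probability T R)
  (c sigma : R) (nu : {measure set R -> \bar R}) (J : R -> {RV P >-> R})
  (hJ : levy_input c sigma nu J)
  (rho : R) (hrho : ('E_P[(J 1)%R] = rho%:E)%E) (rho_lt0 : rho < 0)
  (V U zeta : {RV P >-> R})
  (V_gt0 : {ae P, forall w, 0 < V w})
  (V_J : independent_systems P (sigma_RV V) (sigma_process J))
  (U_ge0 : {ae P, forall w, 0 <= U w})
  (zeta_ge0 : {ae P, forall w, 0 <= zeta w})
  (V_U_zeta : independent_RVs P (fun i => tnth [tuple V; U; zeta] i))
  (U_uniform : forall A : set R, measurable A ->
     distribution P U A = uniform_prob (@ltr01 R) A)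
  (zeta_psi : forall alpha : R, 0 < alpha ->
     laplace_transform P zeta alpha =
     (alpha * right_derivative_at0 (levy_exponent c sigma nu)
       / levy_exponent c sigma nu alpha)%:E)
  (f : R -> R) (f_meas : measurable_fun (`[0, +oo[ : set R) f)
  (f_ge0 : forall x : R, 0 <= x -> 0 <= f x) :
  (\int[P]_w integral_to_hitting f (fun t w' => V w' + J t w')%R w =
   (- rho^-1)%:E *
   \int[distribution P V]_(x in `[0%R, +oo[)
     (x%:E * 'E_P[fun w => (f (zeta w + x * U w))%R]))%E.
Proof.
have [_ _ [J0 Jind Jsta Jcad] [S [X [m [[_ S_nd] BX _ JSX]]]] phiE] := hJ.
have zeta_laplace b : 0 < b -> (\int[P]_w (expR (- (b * zeta w)))%:E =
    (b * rho / levy_exponent c sigma nu b)%:E)%E.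
  move=> b0; have := zeta_psi b b0.
  by rewrite (right_derivative_exponent hrho phiE) /laplace_transform unlock.
have Jrc w (s : R) : 0 <= s -> J u w @[u --> s^'+] --> J s w.
  by have [+ _] := Jcad w; apply.
exact: (mean_area_to_hitting J0 Jind Jsta Jrc JSX S_nd
  (drifted_brownian_continuous BX) phiE hrho rho_lt0 V_gt0 V_J U_ge0 zeta_ge0
  V_U_zeta U_uniform zeta_laplace f_meas f_ge0).
Qed.
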